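(* Let $1<p<2$, $p'=p/(p-1)$, and assume the following $W^{1,p}$ well-posedness: for every $f\in W^{-1,p}(\Omega)$ the problem $-\nabla\cdot(A\nabla z)=f$ in $\Omega$, $z=0$ on $\partial\Omega$, has a unique solution $z\in W_0^{1,p}(\Omega)$, and $\|\nabla z\|_{L^p(\Omega)}\le C_{\mathrm{reg}}\|f\|_{W^{-1,p}(\Omega)}$ with $C_{\mathrm{reg}}$ independent of $f$. Then, for every $w\in W^{1,p}(\Omega)$ with $w|_{\partial\Omega}=g$, $$\|\boldsymbol{\sigma}-\boldsymbol{\sigma}_h\|_{L^p(\Omega)}+\|u-w\|_{W^{1,p}(\Omega)}+\|f_1-\nabla\cdot\boldsymbol{\sigma}_h\|_{L^p(\Omega)}\simeq\eta,$$ with (two-sided) constants independent of $h$ and of $w$, where $$\eta:=\Bigl(\sum_{K\in\mathcal T_h}\eta_K^p\Bigr)^{1/p},\qquad\eta_K^p:=\|A^{-1/2}(\boldsymbol{\sigma}_h+\mathbf f_2)+A^{1/2}\nabla w\|_{L^p(K)}^p+\|f_1-\nabla\cdot\boldsymbol{\sigma}_h\|_{L^p(K)}^p .$$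
   Context: Continuous problem. $\Omega\subset\mathbb R^2$ is a bounded, simply connected Lipschitz domain, $x_0\in\Omega$. The matrix field $A\in L^\infty(\Omega;\mathbb R^{2\times 2})$ is symmetric and uniformly elliptic: $\alpha|\xi|^2\le\xi^TA(x)\xi\le\beta|\xi|^2$ for all $\xi\in\mathbb R^2$ and a.e. $x\in\Omega$, with $0<\alpha\le\beta$. Data: $f_1\in L^p(\Omega)$, $g\in W^{1-1/p,p}(\partial\Omega)$. It is assumed that $-\nabla\cdot(A\nabla u)=f_1+\delta_{x_0}$ in $\Omega$, $u=g$ on $\partial\Omega$, has a unique solution $u\in W^{1,p}(\Omega)$. Let $\mathbf f_2(x):=\frac1{2\pi}\frac{x-x_0}{|x-x_0|^2}$ (so $\nabla\cdot\mathbf f_2=\delta_{x_0}$ in the sense of distributions, $\mathbf f_2\in L^p(\Omega)^2$) and let $\boldsymbol{\sigma}:=-A\nabla u-\mathbf f_2\in L^p(\Omega)^2$; it satisfies $\nabla\cdot\boldsymbol{\sigma}=f_1$. Discrete problem. $\mathcal T_h$ is a shape-regular triangulation of $\Omega$. $\mathrm{RT}_0(\mathcal T_h)$ is the space of $\boldsymbol{\tau}_h\in H(\mathrm{div};\Omega)$ with $\boldsymbol{\tau}_h|_K(x)=\mathbf a+bx$, $\mathbf a\in\mathbb R^2$, $b\in\mathbb R$, on each $K\in\mathcal T_h$; $P_0(\mathcal T_h)$ is the space of piecewise constant functions. $(\cdot,\cdot)$ denotes the integral over $\Omega$ of the product. The pair $(\boldsymbol{\sigma}_h,u_h)\in\mathrm{RT}_0(\mathcal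 T_h)\times P_0(\mathcal T_h)$ is the unique solution of $$(A^{-1}\boldsymbol{\sigma}_h,\boldsymbol{\tau}_h)-(\nabla\cdot\boldsymbol{\tau}_h,u_h)=-(A^{-1}\mathbf f_2,\boldsymbol{\tau}_h)-\langle\boldsymbol{\tau}_h\cdot\mathbf n,g\rangle_{\partial\Omega}\quad\forall\boldsymbol{\tau}_h\in\mathrm{RT}_0(\mathcal T_h),$$ $$(\nabla\cdot\boldsymbol{\sigma}_h,v_h)=(f_1,v_h)\quad\forall v_h\in P_0(\mathcal T_h).$$ $W^{-1,p}(\Omega)$ is the dual of $W_0^{1,p'}(\Omega)$, normed by $\|F\|_{W^{-1,p}(\Omega)}:=\sup_{0\ne\chi\in W_0^{1,p'}(\Omega)}\langle F,\chi\rangle/\|\nabla\chi\|_{L^{p'}(\Omega)}$. The equation $-\nabla\cdot(A\nabla z)=f$ means $\int_\Omega A\nabla z\cdot\nabla\chi\,dx=\langle f,\chi\rangle$ for all $\chi\in W_0^{1,p'}(\Omega)$. *)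

(* Defs.v *)
From HB Require Import structures.
From mathcomp Require Import all_boot all_order all_algebra.
From mathcomp Require Import all_classical all_reals all_analysis.

Set Implicit Arguments.
Unset Strict Implicit.
Unset Printing Implicit Defensive.

Import Order.TTheory GRing.Theory Num.Theory.
Import numFieldNormedType.Exports.

Local Open Scope classical_set_scope.
Local Open Scope ring_scope.

(* Points of the plane, and also vectors: the values of vector fields. *)
Notation plane R := (Real.sort R * Real.sort R)%type.

(* Planar Lebesgue measure (on the Borel sets). *)
Notation mu2 R := ((@lebesgue_measure R) \x (@lebesgue_measure R))%E.

Section Vectors.
Variable R : realType.
Implicit Types (x y : plane R) (M B : 'M[R]_2).

Definition dot x y : R := x.1 * y.1 + x.2 * y.2.

(* Euclidean norm; the library norm `|x| of a pair is the maximum norm. *)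
Definition enorm x : R := Num.sqrt (dot x x).

Definition mulmxv M x : plane R :=
  (M 0 0 * x.1 + M 0 1 * x.2, M 1 0 * x.1 + M 1 1 * x.2).

(* M^(1/2): the symmetric positive semidefinite square root, which is unique
   when it exists; 0 when there is none. *)
Definition sqrtmx M : 'M[R]_2 :=
  xget 0 [set B | [/\ B^T = B, forall x, 0 <= dot x (mulmxv B x)
                    & B *m B = M]].

End Vectors.

Section Domains.
Variable R : realType.
Implicit Types Om : set (plane R).

Definition simply_connected Om : Prop :=
  forall gam : R -> plane R,
    {within `[0, 1], continuous gam} -> gam @` `[0, 1] `<=` Om ->
    gam 0 = gam 1 ->
  exists H : plane R -> plane R,
    [/\ {within `[0, 1] `*` `[0, 1], continuous H},
        H @` (`[0, 1] `*` `[0, 1]) `<=` Om,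
        forall t, t \in `[0, 1] -> H (0, t) = gam t,
        forall t, t \in `[0, 1] -> H (1, t) = gam 0
      & forall s, s \in `[0, 1] -> H (s, 0) = gam 0 /\ H (s, 1) = gam 0].

(* Near each boundary point z, in suitable orthonormal coordinates (s, t)
   centred at z, the open set Om is the strict epigraph of a Lipschitz
   function. *)
Definition lipschitz_boundary Om : Prop :=
  forall z, (closure Om `\` Om) z ->
  exists (e1 e2 : plane R) (r h L : R) (gam : R -> R),
    [/\ [/\ enorm e1 = 1, enorm e2 = 1 & dot e1 e2 = 0],
        [/\ 0 < r, 0 < h & L.-lipschitz gam],
        forall s, `|s| < r -> `|gam s| < h
      & forall s t, `|s| < r -> `|t| < h ->
          Om (z + s *: e1 + t *: e2) <-> gam s < t].

Definition bounded_sc_lipschitz_domain Om : Prop :=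
  [/\ [/\ open Om, Om !=set0 & connected Om], bounded_set Om,
      simply_connected Om & lipschitz_boundary Om].

End Domains.

Section LpSpaces.
Variable R : realType.
Implicit Types (D : set (plane R)) (q : R).
Implicit Types (f : plane R -> R) (F : plane R -> plane R).

Definition Lp D q : set (plane R -> R) :=
  [set f | (f \_ D) \in Lfun (mu2 R) q%:E].

Definition Lpv D q : set (plane R -> plane R) :=
  [set F | Lp D q (fun x => (F x).1) /\ Lp D q (fun x => (F x).2)].

Definition Lpnorm D q f : \bar R := 'N[mu2 R]_(q%:E)[EFin \o (f \_ D)]%E.

Definition Lpvnorm D q F : \bar R := Lpnorm D q (fun x => enorm (F x)).

End LpSpaces.

Section TestFunctions.
Variable R : realType.
Implicit Types (phi : plane R -> R) (Om : set (plane R)).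

Definition e_1 : plane R := (1, 0).
Definition e_2 : plane R := (0, 1).

Definition grad phi : plane R -> plane R :=
  fun x => ('D_e_1 phi x, 'D_e_2 phi x).

Fixpoint of_class_C (n : nat) phi : Prop :=
  continuous phi /\
  if n is m.+1 then
    [/\ forall x, derivable phi x e_1 /\ derivable phi x e_2,
        of_class_C m ('D_e_1 phi) & of_class_C m ('D_e_2 phi)]
  else True.

Definition test_function Om : set (plane R -> R) :=
  [set phi | (forall n, of_class_C n phi) /\
    exists K, [/\ compact K, K `<=` Om & forall x, ~ K x -> phi x = 0]].

End TestFunctions.

(* Weakly differentiable functions are represented together with their weak
   derivative, which is unique almost everywhere: v : sobfun R is the pair
   (v, nabla v) and t : divfield R is the pair (t, div t). *)
Notation sobfun R := ((plane R -> Real.sort R) * (plane R -> plane R))%type.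
Notation divfield R := ((plane R -> plane R) * (plane R -> Real.sort R))%type.

Section Sobolev.
Variable R : realType.
Implicit Types (Om : set (plane R)) (q : R) (v : sobfun R) (t : divfield R).

Definition weak_gradient Om v : Prop :=
  forall phi, test_function Om phi ->
    (\int[mu2 R]_(x in Om) (v.1 x * 'D_(e_1 R) phi x)
      = - \int[mu2 R]_(x in Om) ((v.2 x).1 * phi x)) /\
    (\int[mu2 R]_(x in Om) (v.1 x * 'D_(e_2 R) phi x)
      = - \int[mu2 R]_(x in Om) ((v.2 x).2 * phi x)).

Definition weak_divergence Om t : Prop :=
  forall phi, test_function Om phi ->
    \int[mu2 R]_(x in Om) dot (t.1 x) (grad phi x)
      = - \int[mu2 R]_(x in Om) (t.2 x * phi x).

Definition W1 Om q : set (sobfun R) :=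
  [set v | [/\ Lp Om q v.1, Lpv Om q v.2 & weak_gradient Om v]].

Definition W1norm Om q v : \bar R :=
  ((Lpnorm Om q v.1 `^ q + Lpvnorm Om q v.2 `^ q) `^ q^-1)%E.

(* W_0^{1,q}(Om), the closure of C_c^oo(Om) in W^{1,q}(Om) *)
Definition W10 Om q : set (sobfun R) :=
  [set v | W1 Om q v /\
    exists phi : nat -> plane R -> R,
      (forall n, test_function Om (phi n)) /\
      W1norm Om q (v - (phi n, grad (phi n))) @[n --> \oo] --> 0%E].

Definition Hdiv Om : set (divfield R) :=
  [set t | [/\ Lpv Om 2 t.1, Lp Om 2 t.2 & weak_divergence Om t]].

(* The trace space W^{1-1/q,q}(bd Om) is W^{1,q}(Om) / W_0^{1,q}(Om), and the
   trace operator is the canonical projection. *)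
Definition trace Om q v : set (sobfun R) :=
  [set v' | W1 Om q v' /\ W10 Om q (v - v')].

Definition trace_space Om q : set (set (sobfun R)) :=
  trace Om q @` W1 Om q.

(* <t.n, g> on bd Om, defined by Green's formula with a lifting G of g; it does
   not depend on the choice of G. *)
Definition normal_pairing Om t (g : set (sobfun R)) : R :=
  let G := xget 0 g in
  \int[mu2 R]_(x in Om) (dot (t.1 x) (G.2 x) + t.2 x * G.1 x).

(* W^{-1,q'}(Om), the dual of W_0^{1,q}(Om). Only the values of a functional on
   W_0^{1,q}(Om) matter. *)
Definition dual_W10 Om q : set (sobfun R -> R) :=
  [set F |
    (forall (a : R) v v', W10 Om q v -> W10 Om q v' ->
       F (a *: v + v') = a * F v + F v') /\
    (exists C : R, forall v, W10 Om q v ->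
       (`|F v|%:E <= C%:E * W1norm Om q v)%E)].

Definition dual_norm Om q (F : sobfun R -> R) : \bar R :=
  ereal_sup [set (F v / fine (Lpvnorm Om q v.2))%:E | v in
    [set v | W10 Om q v /\ ~ {ae mu2 R, forall x, Om x -> v.1 x = 0}]].

End Sobolev.

Section ContinuousProblem.
Variable R : realType.
Implicit Types (Om : set (plane R)) (A : plane R -> 'M[R]_2) (p : R).
Implicit Types (u z : sobfun R).

Definition conj_exp p : R := p / (p - 1).

Definition elliptic_coefficient Om A (alpha beta : R) : Prop :=
  (forall i j, (fun x => A x i j) \_ Om \in Lfun (mu2 R) +oo%E) /\
  {ae mu2 R, forall x, Om x ->
     (A x)^T = A x /\
     forall xi : plane R,
       alpha * enorm xi ^+ 2 <= dot xi (mulmxv (A x) xi) <=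
       beta * enorm xi ^+ 2}.

(* z in W_0^{1,p}(Om) solves - div (A nabla z) = F. *)
Definition dirichlet_solution Om A p (F : sobfun R -> R) z : Prop :=
  W10 Om p z /\
  forall chi, W10 Om (conj_exp p) chi ->
    \int[mu2 R]_(x in Om) dot (mulmxv (A x) (z.2 x)) (chi.2 x) = F chi.

Definition W1_well_posed Om A p (Creg : R) : Prop :=
  forall F, dual_W10 Om (conj_exp p) F ->
  exists z,
    [/\ dirichlet_solution Om A p F z,
        forall z', dirichlet_solution Om A p F z' ->
          {ae mu2 R, forall x, Om x -> z'.1 x = z.1 x}
      & (Lpvnorm Om p z.2 <= Creg%:E * dual_norm Om (conj_exp p) F)%E].

(* u in W^{1,p}(Om) solves - div (A nabla u) = f1 + delta_{x0}, u = g on bd Om.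
   As conj_exp p > 2 when 1 < p < 2, every class in W_0^{1,conj_exp p}(Om) has a
   continuous representative, which defines the value at x0. *)
Definition dirac_solution Om A p (x0 : plane R) (f1 : plane R -> R) (g : set (sobfun R)) u
    : Prop :=
  [/\ W1 Om p u, trace Om p u = g
    & forall chi, W10 Om (conj_exp p) chi -> {within Om, continuous chi.1} ->
        \int[mu2 R]_(x in Om) dot (mulmxv (A x) (u.2 x)) (chi.2 x)
        = (\int[mu2 R]_(x in Om) (f1 x * chi.1 x)) + chi.1 x0].

Definition unique_dirac_solution Om A p (x0 : plane R) (f1 : plane R -> R)
    (g : set (sobfun R)) u : Prop :=
  dirac_solution Om A p x0 f1 g u /\
  forall u', dirac_solution Om A p x0 f1 g u' ->
    {ae mu2 R, forall x, Om x -> u'.1 x = u.1 x}.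

(* Its distributional divergence is the Dirac mass at x0. *)
Definition dirac_field (x0 : plane R) : plane R -> plane R :=
  fun x => (2 * pi)^-1 *: ((enorm (x - x0) ^+ 2)^-1 *: (x - x0)).

Definition flux A (x0 : plane R) u : plane R -> plane R :=
  fun x => - mulmxv (A x) (u.2 x) - dirac_field x0 x.

End ContinuousProblem.

Section Triangulations.
Variable R : realType.
Implicit Types (Om : set (plane R)) (s : seq (plane R)).

(* A triangle is given by its three vertices. *)
Notation triangle := (3.-tuple (plane R)).
Implicit Types (K : triangle) (T : seq triangle).

(* The convex hull of the points of s; empty if s is. *)
Definition hull s : set (plane R) :=
  [set x | exists l : plane R -> R,
    [/\ forall v, v \in s -> 0 <= l v, \sum_(v <- s) l v = 1
      & x = \sum_(v <- s) l v *: v]].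

Definition cell K : set (plane R) := interior (hull K).

Definition nondegenerate_triangle K : Prop :=
  let a := tnth K 1 - tnth K 0 in let b := tnth K 2 - tnth K 0 in
  a.1 * b.2 - a.2 * b.1 != 0.

(* Conforming triangulations: two distinct triangles meet in the convex hull of
   their common vertices, that is, in nothing, a vertex or an edge. *)
Definition triangulation Om T : Prop :=
  [/\ forall K, K \in T -> nondegenerate_triangle K,
      closure Om = \bigcup_(K in [set` T]) hull K
    & forall i j, (i < size T)%N -> (j < size T)%N -> i <> j ->
        let K := nth [tuple 0; 0; 0] T i in let L := nth [tuple 0; 0; 0] T j in
        hull K <> hull L /\ hull K `&` hull L = hull [seq v <- K | v \in L]].

Definition diameter K : R :=
  sup [set d | exists x y, [/\ hull K x, hull K y & d = enorm (x - y)]].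

(* The diameter of the largest disc contained in K. *)
Definition indiameter K : R :=
  sup [set d | exists (c : plane R) (r : R),
    [/\ 0 <= r, [set x | enorm (x - c) <= r] `<=` hull K & d = 2 * r]].

Definition shape_regular (kappa : R) T : Prop :=
  forall K, K \in T -> diameter K <= kappa * indiameter K.

Definition RT0 Om T : set (divfield R) :=
  [set t | Hdiv Om t /\
    forall K, K \in T -> exists (a : plane R) (b : R),
      {ae mu2 R, forall x, cell K x -> t.1 x = a + b *: x}].

Definition P0 Om T : set (plane R -> R) :=
  [set v | Lp Om 2 v /\
    forall K, K \in T -> exists c : R,
      {ae mu2 R, forall x, cell K x -> v x = c}].

End Triangulations.

Section DiscreteProblem.
Variable R : realType.
Implicit Types (Om : set (plane R)) (A : plane R -> 'M[R]_2) (p : R).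
Implicit Types (g : set (sobfun R)).
Implicit Types (sigmah : divfield R) (T : seq (3.-tuple (plane R))).

Definition mixed_solution Om A (x0 : plane R) (f1 : plane R -> R) g T sigmah
    (uh : plane R -> R) : Prop :=
  [/\ RT0 Om T sigmah, P0 Om T uh,
      forall t, RT0 Om T t ->
        (\int[mu2 R]_(x in Om) dot (mulmxv (invmx (A x)) (sigmah.1 x)) (t.1 x))
        - (\int[mu2 R]_(x in Om) (t.2 x * uh x))
        = - (\int[mu2 R]_(x in Om)
               dot (mulmxv (invmx (A x)) (dirac_field x0 x)) (t.1 x))
          - normal_pairing Om t g
    & forall v, P0 Om T v ->
        \int[mu2 R]_(x in Om) (sigmah.2 x * v x)
        = \int[mu2 R]_(x in Om) (f1 x * v x)].

Definition unique_mixed_solution Om A (x0 : plane R) (f1 : plane R -> R) g T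
    sigmah (uh : plane R -> R) : Prop :=
  mixed_solution Om A x0 f1 g T sigmah uh /\
  forall sigmah' uh', mixed_solution Om A x0 f1 g T sigmah' uh' ->
    {ae mu2 R, forall x, Om x -> sigmah'.1 x = sigmah.1 x /\ uh' x = uh x}.

Definition estimator A p (x0 : plane R) (f1 : plane R -> R) T sigmah
    (w : sobfun R) : \bar R :=
  ((\sum_(K <- T)
     (Lpvnorm (cell K) p (fun x =>
        mulmxv (invmx (sqrtmx (A x))) (sigmah.1 x + dirac_field x0 x)
        + mulmxv (sqrtmx (A x)) (w.2 x))%R `^ p
      + Lpnorm (cell K) p (f1 - sigmah.2)%R `^ p)) `^ p^-1)%E.

End DiscreteProblem.

(* Main.v *)
Require Import Defs.
From mathcomp Require Import all_boot all_order all_algebra.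
From mathcomp Require Import all_classical all_reals all_analysis measurable_realfun.
From mathcomp Require Import ring lra.
Import Order.TTheory GRing.Theory Num.Theory.
Import numFieldNormedType.Exports.
Local Open Scope classical_set_scope.
Local Open Scope ring_scope.

(** Why the estimate holds. Write sigma = - A grad u - f2 for the exact flux,
z = w - u, and G = sigma_h + f2 + A grad w for the flux residual of the
computed pair. Subtracting the relation that defines sigma gives
  A grad z = G + (sigma - sigma_h),                                       (1)
so that any two of G, sigma - sigma_h and grad z control the third. The
integrand of the estimator is
E = A^(-1/2) (sigma_h + f2) + A^(1/2) grad w, hence A^(1/2) E = G, and
ellipticity makes |E| and |G| equivalent almost everywhere
([energy_residual]). The open cells of a triangulation are disjoint and fill
Om up to a null set ([triangulation_integral]), so that eta is equivalent to
|G|_p + |f1 - div sigma_h|_p with constants that do not see the triangulation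
([residual_estimator]). What remains is to compare these two residuals with
the error.

The residuals are bounded by the error because of (1). For the converse, z has
zero trace, and sigma - sigma_h has divergence f1 - div sigma_h, so that (1)
says, for chi in W^{1,p'}_0,
  int A grad z . grad chi = int G . grad chi - int (f1 - div sigma_h) chi
([flux_residual]). Holder's and Poincare's inequalities bound the right hand
side by (|G|_p + 2 M |f1 - div sigma_h|_p) |grad chi|_p', where [-M, M]^2
contains Om, and W^{1,p} well-posedness turns this into a bound of |grad z|_p
([stability], [gradient_error]). Poincare's inequality gives |z|_p, and (1)
gives |sigma - sigma_h|_p.

Three facts behind this need real work. (a) The field f2 is in L^p for p < 2
([dirac_field_Lp]), and its divergence is the Dirac mass ([dirac_divergence]).
(b) The elements of W^{1,q}_0 satisfy Poincare's inequality ([W10_poincare]).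
(c) Well-posedness determines z only as a function, whereas the estimate is
about its gradient: a weak gradient in W^{1,q}_0 is determined almost
everywhere by the function ([W10_gradient_unique]). The divergence of f2, (b)
and (c) all come from Fubini's theorem and the fundamental theorem of calculus
on lines. *)

Set Implicit Arguments.
Unset Strict Implicit.
Unset Printing Implicit Defensive.

(** [plane R] with its product Borel sigma-algebra. The two types are
convertible, but only this form lets the measurable structure be inferred. *)
Notation mplane R := (measurableTypeR R * measurableTypeR R)%type.

(** * Integrals and Lebesgue norms on the plane *)

Section AeIntegral.
Context d (T : measurableType d) (R : realType).
Variable mu : {measure set T -> \bar R}.
Import HBNNSimple.

(** The integral of a nonnegative function is a supremum over the simple functions
below it, and a simple function may be put to zero on a null set. Hence the
comparison holds for arbitrary nonnegative functions, such as the integrand of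
the estimator, which contains the square root of a matrix field. *)
Lemma ae_le_integral (f g : T -> \bar R) :
  (forall x, 0 <= f x)%E -> (forall x, 0 <= g x)%E ->
  {ae mu, forall x, (f x <= g x)%E} ->
  (\int[mu]_x f x <= \int[mu]_x g x)%E.
Proof.
move=> f0 g0 [N [mN N0 fgN]].
rewrite ge0_integralTE//; apply: ge_ereal_sup => _ [h hf <-].
(* A simple function below f, put to zero on the null set N, lies below g. *)
pose h' := mul_nnsfun h (indic_nnsfun R (measurableC mN)).
have h'E x : h' x = h x * \1_(~` N) x by [].
apply: (@le_trans _ _ (\int[mu]_x (h' x)%:E)%E); last first.
  rewrite integralT_nnsfun (ge0_integralTE _ g0).
  apply: ereal_sup_ubound; exists h' => // x; change ((h' x)%:E <= g x)%E.
  have [xN|xN] := pselect (N x).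
    by rewrite h'E indicE memNset ?mulr0//= => /(_ xN).
  rewrite h'E indicE mem_set// mulr1; apply: le_trans (hf x) _.
  by apply: contrapT => xfg; apply: xN; apply: fgN => /= /xfg.
rewrite -integralT_nnsfun.
apply: ae_ge0_le_integral => //.
- by move=> x _; rewrite lee_fin.
- exact/measurable_EFinP.
- by move=> x _; rewrite lee_fin.
- exact/measurable_EFinP.
- exists N; split => // x /= xh; apply: contrapT => xN; apply: xh => _.
  by change ((h x)%:E <= (h' x)%:E)%E; rewrite h'E indicE mem_set// mulr1.
Qed.

End AeIntegral.

(** Found by inference, this lets [filterS] and its variants combine almost
everywhere statements about the product measure. *)
#[export] Instance mu2_ae_filter (R : realType) :
  Filter (nbhs (almost_everywhere (mu2 R))).
Proof. exact: ae_filter_ringOfSetsType. Qed.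

Section Lp.
Variable R : realType.
Implicit Types (D : set (mplane R)) (f g : mplane R -> R).
Implicit Types (p q : R).
Local Notation mu := (mu2 R).

Lemma Lpnorm_ge0 D q f : (0 <= Lpnorm D q f)%E.
Proof. exact: Lnorm_ge0. Qed.

Lemma LpnormE D q f : q != 0 ->
  (Lpnorm D q f `^ q = \int[mu]_(x in D) (`|f x| `^ q)%:E)%E.
Proof.
move=> q0; rewrite /Lpnorm (poweR_Lnorm mu _ q0) [RHS]integral_mkcond.
apply: eq_integral => x _ /=; rewrite /patch; case: ifP => //= _.
by rewrite normr0 powR0.
Qed.

Lemma Lpnorm_ae_le D q f g : 0 < q ->
  {ae mu, forall x, D x -> `|f x| <= `|g x|} ->
  (Lpnorm D q f <= Lpnorm D q g)%E.
Proof.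
move=> q0 fg; have q0' : q != 0 by rewrite gt_eqF.
rewrite -[leLHS](@poweRe1 _ _ (Lpnorm_ge0 _ _ _)).
rewrite -[leRHS](@poweRe1 _ _ (Lpnorm_ge0 _ _ _)) -(mulfV q0') 2!poweRrM.
rewrite /Lpnorm 2!(poweR_Lnorm mu _ q0').
have I0 (h : mplane R -> R) : (\int[mu]_x `|(EFin \o h \_ D) x| `^ q)%E \in `[0%E, +oo%E].
  by rewrite in_itv/= leey integral_ge0// => x _; rewrite poweR_ge0.
apply: gt0_ler_poweR (I0 f) (I0 g) _; first by rewrite invr_ge0 ltW.
apply: ae_le_integral => [x|x|]; rewrite ?poweR_ge0//.
apply: filterS fg => x fgx; rewrite /= /patch; case: ifPn => [/set_mem Dx|_].
  by rewrite lee_fin ge0_ler_powR ?nnegrE ?(ltW q0) ?fgx.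
exact: lexx.
Qed.

Lemma Lpnorm_ae_eq D q f g : 0 < q ->
  {ae mu, forall x, D x -> `|f x| = `|g x|} -> Lpnorm D q f = Lpnorm D q g.
Proof.
move=> q0 fg; apply/eqP; rewrite eq_le; apply/andP; split;
  by apply: Lpnorm_ae_le => //; apply: filterS fg => x fgx /fgx ->.
Qed.

Lemma Lpnorm_eq D q f g : 0 < q ->
  (forall x, D x -> `|f x| = `|g x|) -> Lpnorm D q f = Lpnorm D q g.
Proof. by move=> q0 fg; apply: Lpnorm_ae_eq => //; exact/nearW. Qed.

Lemma LpP D q f : measurable D ->
  Lp D q f <-> measurable_fun D f /\ (Lpnorm D q f < +oo)%E.
Proof.
move=> mD; rewrite /Lp /Lpnorm /= inE; split.
- move=> /andP[]; rewrite !inE /= => mf ff; split => //.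
  exact/(measurable_restrictT _ mD).
- move=> [/(measurable_restrictT _ mD) mf ff]; apply/andP.
  by rewrite !inE.
Qed.

Lemma Lp_fin D q f : Lp D q f -> (Lpnorm D q f < +oo)%E.
Proof. by rewrite /Lp /Lpnorm /= inE => /andP[_]; rewrite inE. Qed.

Lemma Lp_fin_num D q f : Lp D q f -> Lpnorm D q f \is a fin_num.
Proof. by move=> /Lp_fin; rewrite ge0_fin_numE// Lpnorm_ge0. Qed.

Lemma Lp_measurable D q f : measurable D -> Lp D q f -> measurable_fun D f.
Proof. by move=> mD /(LpP _ _ mD)[]. Qed.

Lemma Lp_dom D q f g : measurable D -> 0 < q -> measurable_fun D f -> Lp D q g ->
  {ae mu, forall x, D x -> `|f x| <= `|g x|} -> Lp D q f.
Proof.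
move=> mD q0 mf gq fg; apply/LpP => //; split => //.
by apply: le_lt_trans (Lp_fin gq); exact: Lpnorm_ae_le.
Qed.

Lemma LpD D q f g : 1 <= q -> Lp D q f -> Lp D q g -> Lp D q (f \+ g).
Proof.
rewrite -lee_fin => q1; rewrite /Lp /= => fq gq.
rewrite (_ : _ \_ D = f \_ D + g \_ D).
  by have [_] := Lfun_addr_closed mu q1; exact.
by apply/funext => x; rewrite /patch fctE; case: ifP; rewrite ?addr0.
Qed.

Lemma LpZ D q f k : 1 <= q -> Lp D q f -> Lp D q (fun x => k * f x).
Proof.
rewrite /Lp /= => q1 fq.
rewrite (_ : _ \_ D = k \o* (f \_ D)); first exact: Lfun_scale.
by apply/funext => x; rewrite /patch /=; case: ifP; rewrite ?mul0r// mulrC.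
Qed.

Lemma LpN D q f : 1 <= q -> Lp D q f -> Lp D q (\- f).
Proof.
move=> q1 fq; rewrite (_ : \- f = fun x => -1 * f x); first exact: LpZ.
by apply/funext => x; rewrite mulN1r.
Qed.

Lemma LpB D q f g : 1 <= q -> Lp D q f -> Lp D q g -> Lp D q (f \- g).
Proof. by move=> q1 fq gq; apply: LpD => //; exact: LpN. Qed.

Lemma Lp0 D q : 1 <= q -> Lp D q (cst 0).
Proof.
rewrite -lee_fin => q1; rewrite /Lp /= (_ : _ \_ D = 0).
  by have [] := Lfun_addr_closed mu q1.
by apply/funext => x; rewrite /patch /=; case: ifP.
Qed.

Lemma LpM_bounded D q f g (M : R) : measurable D -> 1 <= q ->
  measurable_fun D f -> {ae mu, forall x, D x -> `|f x| <= M} ->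
  Lp D q g -> Lp D q (f \* g).
Proof.
move=> mD q1 mf fM gq.
apply: (@Lp_dom _ _ _ (fun x => M * g x)) => //.
- exact: lt_le_trans q1.
- by apply: measurable_funM => //; exact: Lp_measurable gq.
- exact: LpZ.
- apply: filterS fM => x fM Dx /=; rewrite 2!normrM.
  by rewrite ler_wpM2r// (le_trans (fM Dx))// ler_norm.
Qed.

Lemma LpnormZ D q f k : 1 <= q -> Lp D q f ->
  Lpnorm D q (fun x => k * f x) = (`|k|%:E * Lpnorm D q f)%E.
Proof.
move=> q1 fq; have q1' : (1 <= q%:E)%E by rewrite lee_fin.
have := LnormZ (Lfun_Sub q1' fq) k; rewrite /Lpnorm => <-.
congr ('N[_]_ _ [ _ ])%E; apply/funext => x /=; rewrite /patch.
by case: ifP => //=; rewrite scaler0.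
Qed.

Lemma Lpnorm_triangle D q f g : measurable D -> 1 <= q ->
  measurable_fun D f -> measurable_fun D g ->
  (Lpnorm D q (f \+ g)%R <= Lpnorm D q f + Lpnorm D q g)%E.
Proof.
move=> mD q1 /(measurable_restrictT _ mD) mf /(measurable_restrictT _ mD) mg.
rewrite /Lpnorm (_ : EFin \o (f \+ g)%R \_ D = EFin \o (f \_ D \+ g \_ D)).
  exact: minkowski_EFin.
by apply/funext => x; rewrite /patch /=; case: ifP; rewrite ?addr0.
Qed.

Lemma Lp_hoelder D p q f g : measurable D -> 0 < p -> 0 < q -> p^-1 + q^-1 = 1 ->
  measurable_fun D f -> measurable_fun D g ->
  (\int[mu]_(x in D) `|f x * g x|%:E <= Lpnorm D p f * Lpnorm D q g)%E.
Proof.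
move=> mD p0 q0 pq /(measurable_restrictT _ mD) mf /(measurable_restrictT _ mD) mg.
have := hoelder mu mf mg p0 q0 pq; rewrite Lnorm1; apply: le_trans.
rewrite [leLHS]integral_mkcond; apply: ae_le_integral => [x|x|].
- by rewrite /patch; case: ifP.
- by [].
- by apply/nearW => x; rewrite /patch /=; case: ifP; rewrite ?mulr0 ?normr0.
Qed.

Lemma Lp_hoelder_integrable D p q f g : measurable D ->
  0 < p -> 0 < q -> p^-1 + q^-1 = 1 ->
  Lp D p f -> Lp D q g -> mu.-integrable D (EFin \o (f \* g)).
Proof.
move=> mD p0 q0 pq fp gq.
have mf := Lp_measurable mD fp; have mg := Lp_measurable mD gq.
apply/integrableP; split; first by apply/measurable_EFinP; exact: measurable_funM.
apply: le_lt_trans (Lp_hoelder mD p0 q0 pq mf mg) _.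
by rewrite lte_mul_pinfty ?Lpnorm_ge0 ?Lp_fin_num// Lp_fin.
Qed.

Lemma Lp_hoelder_le D p q f g : measurable D ->
  0 < p -> 0 < q -> p^-1 + q^-1 = 1 ->
  Lp D p f -> Lp D q g ->
  (`|\int[mu]_(x in D) (f x * g x)|%:E <= Lpnorm D p f * Lpnorm D q g)%E.
Proof.
move=> mD p0 q0 pq fp gq; have ifg := Lp_hoelder_integrable mD p0 q0 pq fp gq.
have mf := Lp_measurable mD fp; have mg := Lp_measurable mD gq.
apply: le_trans (Lp_hoelder mD p0 q0 pq mf mg).
rewrite EFin_normr_Rintegral//; apply: le_abse_integral => //.
by case/integrableP : ifg.
Qed.

End Lp.

Section Vec.
Variable R : realType.
Implicit Types (x y : plane R) (D : set (mplane R)) (f g : mplane R -> R).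
Implicit Types (F G : mplane R -> plane R) (p q : R).
Local Notation mu := (mu2 R).

Lemma dotC x y : dot x y = dot y x.
Proof. by rewrite /dot mulrC [x.2 * _]mulrC. Qed.

Lemma dot_ge0 x : 0 <= dot x x.
Proof. by rewrite /dot -!expr2 addr_ge0 ?sqr_ge0. Qed.

Lemma enorm_ge0 x : 0 <= enorm x.
Proof. exact: sqrtr_ge0. Qed.

Lemma enorm_sqr x : enorm x ^+ 2 = dot x x.
Proof. by rewrite /enorm sqr_sqrtr ?dot_ge0. Qed.

Lemma enormN x : enorm (- x) = enorm x.
Proof. by rewrite /enorm /dot /= !mulrNN. Qed.

Lemma le_sqr_enorm x (c : R) : 0 <= c -> dot x x <= c ^+ 2 -> enorm x <= c.
Proof. by move=> c0; rewrite -enorm_sqr ler_sqr ?nnegrE ?enorm_ge0. Qed.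

Lemma cauchy_schwarz x y : `|dot x y| <= enorm x * enorm y.
Proof.
rewrite -ler_sqr ?nnegrE ?mulr_ge0 ?enorm_ge0//.
rewrite exprMn !enorm_sqr real_normK ?num_real// /dot -subr_ge0.
(* Lagrange's identity. *)
rewrite (_ : _ - _ = (x.1 * y.2 - x.2 * y.1) ^+ 2) ?sqr_ge0//; ring.
Qed.

Lemma enormD x y : enorm (x + y) <= enorm x + enorm y.
Proof.
apply: le_sqr_enorm; first by rewrite addr_ge0 ?enorm_ge0.
rewrite sqrrD !enorm_sqr.
have := le_trans (ler_norm _) (cauchy_schwarz x y).
by rewrite /dot /=; lra.
Qed.

Lemma norm_fst_le x : `|x.1| <= enorm x.
Proof.
rewrite -ler_sqr ?nnegrE ?enorm_ge0// enorm_sqr real_normK ?num_real//.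
by rewrite /dot -!expr2 lerDl sqr_ge0.
Qed.

Lemma norm_snd_le x : `|x.2| <= enorm x.
Proof.
rewrite -ler_sqr ?nnegrE ?enorm_ge0// enorm_sqr real_normK ?num_real//.
by rewrite /dot -!expr2 lerDr sqr_ge0.
Qed.

Lemma enorm_le x : enorm x <= `|x.1| + `|x.2|.
Proof.
apply: le_sqr_enorm; first by rewrite addr_ge0.
rewrite sqrrD !real_normK ?num_real// /dot -!expr2.
by rewrite addrAC lerDl mulrn_wge0// mulr_ge0.
Qed.

Lemma measurable_enorm D F : measurable_fun D (fst \o F) ->
  measurable_fun D (snd \o F) -> measurable_fun D (fun x => enorm (F x)).
Proof.
move=> m1 m2; apply: (measurableT_comp (f := @Num.sqrt R)).
  by apply: continuous_measurable_fun => x; exact: sqrt_continuous.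
by apply: measurable_funD; apply: measurable_funM.
Qed.

Lemma Lpv_measurable1 D q F : measurable D -> Lpv D q F -> measurable_fun D (fst \o F).
Proof. by move=> mD [+ _]; exact: Lp_measurable. Qed.

Lemma Lpv_measurable2 D q F : measurable D -> Lpv D q F -> measurable_fun D (snd \o F).
Proof. by move=> mD [_ +]; exact: Lp_measurable. Qed.

Lemma LpvP D q F : measurable D -> 1 <= q -> measurable_fun D (fst \o F) ->
  measurable_fun D (snd \o F) -> Lpv D q F <-> Lp D q (fun x => enorm (F x)).
Proof.
move=> mD q1 m1 m2; have q0 : 0 < q by exact: lt_le_trans q1.
have me := measurable_enorm m1 m2; split=> [[h1 h2]|h].
  have n1 : Lp D q (fun x => `|(F x).1|).
    apply: Lp_dom q0 _ h1 _ => //; first exact: measurableT_comp.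
    by apply/nearW => x _; rewrite normr_id.
  have n2 : Lp D q (fun x => `|(F x).2|).
    apply: Lp_dom q0 _ h2 _ => //; first exact: measurableT_comp.
    by apply/nearW => x _; rewrite normr_id.
  apply: Lp_dom q0 me (LpD q1 n1 n2) _ => //.
  apply/nearW => x _ /=; rewrite ger0_norm ?enorm_ge0//.
  by rewrite ger0_norm ?addr_ge0// enorm_le.
by split; apply: Lp_dom q0 _ h _ => //; apply/nearW => x _;
  rewrite [leRHS]ger0_norm ?enorm_ge0// (norm_fst_le, norm_snd_le).
Qed.

Lemma Lpv_enorm D q F : measurable D -> 1 <= q -> Lpv D q F ->
  Lp D q (fun x => enorm (F x)).
Proof.
move=> mD q1 Fq; apply/(LpvP mD q1) => //.
  exact: Lpv_measurable1 Fq.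
exact: Lpv_measurable2 Fq.
Qed.

Lemma LpvD D q F G : 1 <= q -> Lpv D q F -> Lpv D q G -> Lpv D q (F + G).
Proof. by move=> q1 [F1 F2] [G1 G2]; split; [exact: LpD F1 G1|exact: LpD F2 G2]. Qed.

Lemma LpvN D q F : 1 <= q -> Lpv D q F -> Lpv D q (- F).
Proof. by move=> q1 [F1 F2]; split; [exact: LpN F1|exact: LpN F2]. Qed.

Lemma LpvB D q F G : 1 <= q -> Lpv D q F -> Lpv D q G -> Lpv D q (F - G).
Proof. by move=> q1 Fq Gq; apply: LpvD => //; exact: LpvN. Qed.

Lemma Lpvnorm_fin D q F : measurable D -> 1 <= q -> Lpv D q F ->
  (Lpvnorm D q F < +oo)%E.
Proof. by move=> mD q1 Fq; apply: Lp_fin; exact: Lpv_enorm. Qed.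

Lemma Lpvnorm_ae_le D q F G (c : R) : 1 <= q -> 0 <= c ->
  measurable D -> Lpv D q G ->
  {ae mu, forall x, D x -> enorm (F x) <= c * enorm (G x)} ->
  (Lpvnorm D q F <= c%:E * Lpvnorm D q G)%E.
Proof.
move=> q1 c0 mD Gq FG; rewrite /Lpvnorm.
have -> : (c%:E = `|c|%:E)%E by rewrite ger0_norm.
rewrite -LpnormZ//; last exact: Lpv_enorm.
apply: Lpnorm_ae_le; first exact: lt_le_trans q1.
apply: filterS FG => x FG /FG; rewrite ger0_norm ?enorm_ge0// => /le_trans; apply.
exact: ler_norm.
Qed.

Lemma Lpvnorm_triangle D q F G : measurable D -> 1 <= q -> Lpv D q F -> Lpv D q G ->
  (Lpvnorm D q (F + G)%R <= Lpvnorm D q F + Lpvnorm D q G)%E.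
Proof.
move=> mD q1 Fq Gq; have q0 : 0 < q by exact: lt_le_trans q1.
apply: (@le_trans _ _ (Lpnorm D q ((fun x => enorm (F x)) \+ (fun x => enorm (G x)))%R)).
  apply: Lpnorm_ae_le => //; apply/nearW => x _.
  by rewrite !ger0_norm ?addr_ge0 ?enorm_ge0// enormD.
apply: Lpnorm_triangle => //.
  exact: Lp_measurable (Lpv_enorm mD q1 Fq).
exact: Lp_measurable (Lpv_enorm mD q1 Gq).
Qed.

Lemma LpvnormN D q F : 1 <= q -> Lpvnorm D q (- F)%R = Lpvnorm D q F.
Proof.
move=> q1; apply: Lpnorm_eq; first exact: lt_le_trans q1.
by move=> x _; rewrite -[in RHS]enormN.
Qed.

Lemma LpnormN D q f : 0 < q -> Lpnorm D q (- f)%R = Lpnorm D q f.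
Proof. by move=> q0; apply: Lpnorm_eq => // x _; rewrite normrN. Qed.

Lemma Lpv_dot_integrable D p q F G : measurable D ->
  1 <= p -> 1 <= q -> p^-1 + q^-1 = 1 ->
  Lpv D p F -> Lpv D q G -> mu.-integrable D (fun x => (dot (F x) (G x))%:E).
Proof.
move=> mD p1 q1 pq [F1 F2] [G1 G2].
have p0 : 0 < p by exact: lt_le_trans p1.
have q0 : 0 < q by exact: lt_le_trans q1.
exact: (integrableD mD (Lp_hoelder_integrable mD p0 q0 pq F1 G1)
  (Lp_hoelder_integrable mD p0 q0 pq F2 G2)).
Qed.

Lemma Lpv_dot_le D p q F G : measurable D ->
  1 <= p -> 1 <= q -> p^-1 + q^-1 = 1 ->
  Lpv D p F -> Lpv D q G ->
  (`|\int[mu]_(x in D) dot (F x) (G x)|%:E <= Lpvnorm D p F * Lpvnorm D q G)%E.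
Proof.
move=> mD p1 q1 pq Fp Gq.
have p0 : 0 < p by exact: lt_le_trans p1.
have q0 : 0 < q by exact: lt_le_trans q1.
have iFG := Lpv_dot_integrable mD p1 q1 pq Fp Gq.
have mF := Lp_measurable mD (Lpv_enorm mD p1 Fp).
have mG := Lp_measurable mD (Lpv_enorm mD q1 Gq).
apply: le_trans (Lp_hoelder mD p0 q0 pq mF mG).
rewrite (EFin_normr_Rintegral mD iFG).
have [mi _] := integrableP _ _ _ iFG.
apply: le_trans (le_abse_integral mu mD mi) _.
apply: ge0_le_integral => //.
- by apply: measurableT_comp => //.
- by apply/measurable_EFinP; apply: measurableT_comp => //; exact: measurable_funM.
- move=> x _; rewrite /= lee_fin (le_trans (cauchy_schwarz _ _))//.
  exact: ler_norm.
Qed.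

End Vec.

Section Dot.
Variable R : realType.
Implicit Types x y z : plane R.

Lemma dotDl x y z : dot (x + y) z = dot x z + dot y z.
Proof. by rewrite /dot /=; ring. Qed.

Lemma dotNl x y : dot (- x) y = - dot x y.
Proof. by rewrite /dot /=; ring. Qed.

Lemma dotBl x y z : dot (x - y) z = dot x z - dot y z.
Proof. by rewrite dotDl dotNl. Qed.

Lemma dotDr x y z : dot x (y + z) = dot x y + dot x z.
Proof. by rewrite ![dot x _]dotC dotDl. Qed.

Lemma dotZr (a : R) x y : dot x (a *: y) = a * dot x y.
Proof. by rewrite /dot /= /GRing.scale /=; ring. Qed.
End Dot.

Section LpFinite.
Variable R : realType.
Implicit Types (D : set (mplane R)) (f g : mplane R -> R).
Implicit Types (F G : mplane R -> plane R) (p q r : R).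
Local Notation mu := (mu2 R).

Lemma Lp_int D q f : measurable D -> 0 < q -> measurable_fun D f ->
  (\int[mu]_(x in D) (`|f x| `^ q)%:E < +oo)%E -> Lp D q f.
Proof.
move=> mD q0 mf fq; apply/(LpP _ _ mD); split => //.
have q0' : q != 0 by rewrite gt_eqF.
by apply: (lty_poweRy q0'); rewrite (LpnormE _ _ q0').
Qed.

Lemma Lp_one D q : measurable D -> 1 <= q -> (mu D < +oo)%E -> Lp D q (cst 1).
Proof.
move=> mD q1 Dfin; apply: Lp_int => //; first exact: lt_le_trans q1.
under eq_integral do rewrite normr1 powR1.
by rewrite integral_cst// mul1e.
Qed.

Lemma Lp_bounded D q f (M : R) : measurable D -> 1 <= q -> (mu D < +oo)%E ->
  measurable_fun D f -> (forall x, D x -> `|f x| <= M) -> Lp D q f.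
Proof.
move=> mD q1 Dfin mf fM.
rewrite (_ : f = f \* cst 1); last by apply/funext => x /=; rewrite mulr1.
apply: (@LpM_bounded _ _ _ _ _ M) => //; first exact/nearW.
exact: Lp_one.
Qed.

(** Because |f|^q <= 1 + |f|^r. *)
Lemma Lp_sub D q r f : measurable D -> (mu D < +oo)%E -> 1 <= q -> q <= r ->
  Lp D r f -> Lp D q f.
Proof.
move=> mD Dfin q1 qr fr; have mf := Lp_measurable mD fr.
have q0 : 0 < q by exact: lt_le_trans q1.
have r0 : 0 < r by exact: lt_le_trans qr.
have mp (s : R) : measurable_fun D (fun x => (`|f x| `^ s)%:E).
  apply/measurable_EFinP.
  apply: (@measurableT_comp _ _ _ _ _ _ (@powR R ^~ s)) => //.
  exact: measurableT_comp.
apply: Lp_int => //.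
apply: (@le_lt_trans _ _ (\int[mu]_(x in D) (1%:E + (`|f x| `^ r)%:E))%E).
  apply: ge0_le_integral => //.
  - by apply: emeasurable_funD.
  move=> x _; rewrite -EFinD lee_fin.
  have [f1|f1] := leP `|f x| 1.
    rewrite ler_wpDr ?powR_ge0// (@le_trans _ _ (1 `^ q))//.
      by rewrite ge0_ler_powR ?nnegrE ?(ltW q0).
    by rewrite powR1.
  by rewrite ler_wpDl// ler_powR// ltW.
have r0' : r != 0 by rewrite gt_eqF.
rewrite ge0_integralD//.
rewrite integral_cst// mul1e -(LpnormE _ _ r0') lte_add_pinfty//.
by rewrite poweR_lty// Lp_fin.
Qed.

Lemma Lpv_sub D q r F : measurable D -> (mu D < +oo)%E -> 1 <= q -> q <= r ->
  Lpv D r F -> Lpv D q F.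
Proof. by move=> mD Dfin q1 qr [F1 F2]; split; apply: Lp_sub qr _. Qed.

(** Since a^q = a a^(q-1) <= a (a+b)^(q-1), and likewise for b. *)
Lemma powR_superadd (a b q : R) : 0 <= a -> 0 <= b -> 1 <= q ->
  a `^ q + b `^ q <= (a + b) `^ q.
Proof.
move=> a0 b0 q1; have q0 : 0 <= q - 1 by rewrite subr_ge0.
have E (c : R) : 0 <= c -> c `^ q = c * c `^ (q - 1).
  rewrite le_eqVlt => /predU1P[<-|c0].
    by rewrite mul0r powR0// gt_eqF// (lt_le_trans ltr01).
  by rewrite -[X in X * _](powRr1 (ltW c0)) -powRD ?subrKC//
    (gt_eqF c0) implybT.
have ab0 : 0 <= a + b by exact: addr_ge0.
rewrite (E a)// (E b)// (E (a + b))// mulrDl.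
by apply: lerD; rewrite ler_wpM2l// ge0_ler_powR ?nnegrE ?lerDl ?lerDr.
Qed.

Lemma le_pnorm (a b q : R) : 0 <= a -> 0 <= b -> 1 <= q ->
  a <= (a `^ q + b `^ q) `^ q^-1.
Proof.
move=> a0 b0 q1; have q0 : 0 < q by exact: lt_le_trans q1.
rewrite -[leLHS](powRr1 a0) -(mulfV (lt0r_neq0 q0)) powRrM.
by rewrite ge0_ler_powR ?nnegrE ?powR_ge0 ?addr_ge0 ?powR_ge0 ?lerDl ?powR_ge0 ?invr_ge0 ?ltW.
Qed.

Lemma pnorm_le (a b q : R) : 0 <= a -> 0 <= b -> 1 <= q ->
  (a `^ q + b `^ q) `^ q^-1 <= a + b.
Proof.
move=> a0 b0 q1; have q0 : 0 < q by exact: lt_le_trans q1.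
have ab0 : 0 <= a + b by exact: addr_ge0.
rewrite -[leRHS](powRr1 ab0) -(mulfV (lt0r_neq0 q0)) powRrM.
rewrite ge0_ler_powR ?nnegrE ?powR_ge0 ?addr_ge0 ?powR_ge0 ?invr_ge0 ?(ltW q0)//.
exact: powR_superadd.
Qed.

End LpFinite.

Section PowerSums.
Variable R : realType.

Lemma le_poweR (x y : \bar R) (q : R) : 0 < q -> (0 <= x)%E -> (x <= y)%E -> (x `^ q <= y `^ q)%E.
Proof.
move=> q0 x0 xy; have y0 := le_trans x0 xy.
by apply: gt0_ler_poweR xy; rewrite ?(ltW q0)// in_itv /= leey ?x0 ?y0.
Qed.

Lemma poweR_le_inv (x y : \bar R) (q : R) : 0 < q ->
  (0 <= x)%E -> (0 <= y)%E -> (x `^ q <= y `^ q)%E -> (x <= y)%E.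
Proof.
move=> q0 x0 y0 xy; have qn0 : q != 0 by rewrite gt_eqF.
rewrite -(poweRe1 x0) -(poweRe1 y0) -(mulfV qn0) 2!poweRrM.
by apply: gt0_ler_poweR xy; rewrite ?invr_ge0 ?(ltW q0)// in_itv /= leey poweR_ge0.
Qed.

(** The passage from cellwise comparison to comparison of the l^q sums over all
cells, with the same constant. *)
Lemma pnorm_sum_le (I : eqType) (s : seq I) (x1 x2 y1 y2 : I -> \bar R) (c q : R) : 0 <= c -> 0 < q ->
  (forall i, i \in s -> [/\ 0 <= x1 i, 0 <= x2 i, 0 <= y1 i & 0 <= y2 i])%E ->
  (forall i, i \in s -> (x1 i <= c%:E * y1 i)%E /\ (x2 i <= c%:E * y2 i)%E) ->
  ((\sum_(i <- s) (x1 i `^ q + x2 i `^ q)) `^ q^-1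
    <= c%:E * (\sum_(i <- s) (y1 i `^ q + y2 i `^ q)) `^ q^-1)%E.
Proof.
move=> c0 q0 ge0 le; have cE : (0 <= c%:E)%E by rewrite lee_fin.
have qn : q != 0 by rewrite gt_eqF.
have Y0 : (0 <= \sum_(i <- s) (y1 i `^ q + y2 i `^ q))%E.
  by apply: sume_ge0 => i _; rewrite adde_ge0 ?poweR_ge0.
rewrite -[X in (X * _)%E](poweRe1 cE) -(mulfV qn) poweRrM -poweRM ?poweR_ge0//.
apply: le_poweR; rewrite ?invr_gt0//.
  by apply: sume_ge0 => i _; rewrite adde_ge0 ?poweR_ge0.
rewrite ge0_sume_distrr; last by move=> i _; rewrite adde_ge0 ?poweR_ge0.
rewrite big_seq [leRHS]big_seq; apply: lee_sum => i si.
have [a0 b0 a0' b0'] := ge0 i si; have [h1 h2] := le i si.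
rewrite ge0_muleDr ?poweR_ge0// -!poweRM//.
by apply: leeD; apply: le_poweR.
Qed.
End PowerSums.

(** * Borel sets and boxes of the plane *)

Section PlaneTopology.
Variable R : realType.
Implicit Types (U K : set (plane R)).

Lemma nbhs_box (x : plane R) (P : set (plane R)) : nbhs x P <->
  exists2 e : R, 0 < e &
    forall y : plane R, `|y.1 - x.1| < e -> `|y.2 - x.2| < e -> P y.
Proof.
split=> [/nbhs_ballP[e /= e0 h]|[e e0 h]].
  exists e => // y y1 y2; apply: h; split; rewrite -ball_normE /ball_ /=.
    by rewrite distrC.
  by rewrite distrC.
apply/nbhs_ballP; exists e => //= y [y1 y2]; apply: h.
  by move: y1; rewrite -ball_normE /ball_ /= distrC.
by move: y2; rewrite -ball_normE /ball_ /= distrC.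
Qed.

(** An open set of the plane is a countable union of products of intervals with
rational end points. *)
Lemma open_measurable_plane U : open U -> measurable (U : set (mplane R)).
Proof.
move=> oU.
pose B (i : rat * rat * (rat * rat)) : set (mplane R) :=
  `]ratr i.1.1, ratr i.1.2[ `*` `]ratr i.2.1, ratr i.2.2[.
pose C i := [set x | B i `<=` U /\ B i x].
have -> : (U : set (mplane R)) = \bigcup_i C i.
  apply/seteqP; split=> [x Ux|x [i _ [BU Bx]]]; last exact: BU.
  have /nbhs_box[e e0 h] : nbhs x U by exact: open_nbhs_nbhs.
  have lo (t : R) : t - e < t by lra.
  have hi (t : R) : t < t + e by lra.
  have [a] := rat_in_itvoo (lo x.1); rewrite in_itv /= => /andP[a1 a2].
  have [b] := rat_in_itvoo (hi x.1); rewrite in_itv /= => /andP[b1 b2].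
  have [c] := rat_in_itvoo (lo x.2); rewrite in_itv /= => /andP[c1 c2].
  have [d] := rat_in_itvoo (hi x.2); rewrite in_itv /= => /andP[d1 d2].
  exists ((a, b), (c, d)) => //; split=> [y [] /=|].
    rewrite !in_itv /= => /andP[ya yb] /andP[yc yd].
      clear -h ya yb yc yd a1 b2 c1 d2; apply: h; rewrite ltr_norml; apply/andP; split; lra.
  by split; rewrite /= in_itv /= ?a2 ?b1 ?c2 ?d1.
apply: countable_bigcupT_measurable => // i.
have [h|h] := pselect (B i `<=` U).
  rewrite (_ : C i = B i); first exact: measurableX.
  by apply/seteqP; split => x //; case.
by rewrite (_ : C i = set0)//; apply/seteqP; split => x //; case.
Qed.

Lemma continuous_measurable_plane (f : plane R -> R) : continuous f ->
  measurable_fun setT (f : mplane R -> R).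
Proof.
move=> /continuousP cf; apply: (measurability (@RGenOpens.G R)).
  exact: RGenOpens.measurableE.
move=> _ [_ [a [b ->]] <-]; rewrite setTI.
by apply: open_measurable_plane; apply: cf; exact: interval_open.
Qed.

Lemma bounded_box (K : set (plane R)) : bounded_set K ->
  exists2 M : R, 0 < M & forall x, K x -> `|x.1| < M /\ `|x.2| < M.
Proof.
move=> [M0 [_ hM]]; have := hM (Num.max M0 0 + 1).
rewrite (@le_lt_trans _ _ (Num.max M0 0)) ?le_max ?lexx// ?ltrDl// => /(_ erefl) h.
have m0 : 0 <= Num.max M0 0 by rewrite le_max lexx orbT.
exists (Num.max M0 0 + 2); first by lra.
move=> x /h /=; rewrite prod_normE /= ge_max => /andP[h1 h2]; split; lra.
Qed.

Lemma compact_box (K : set (plane R)) : compact K ->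
  exists2 M : R, 0 < M & forall x, K x -> `|x.1| < M /\ `|x.2| < M.
Proof. by move=> /compact_bounded; exact: bounded_box. Qed.

Definition box (M : R) : set (mplane R) := `[- M, M] `*` `[- M, M].

Lemma measurable_box (M : R) : measurable (box M).
Proof. exact: measurableX. Qed.

Lemma boxP (M : R) x : box M x <-> `|x.1| <= M /\ `|x.2| <= M.
Proof. by rewrite /box /= !in_itv /= -!ler_norml; split=> -[]. Qed.

Lemma box_fin_measure (M : R) : (mu2 R (box M) < +oo)%E.
Proof.
rewrite /box.
rewrite product_measure1E//.
pose c := if - M < M then M + M else 0.
have h : lebesgue_measure `[- M, M]%classic = c%:E.
  by rewrite lebesgue_measure_itv /= lte_fin /c; case: ifP => //; rewrite -EFinB opprK.
apply: (@le_lt_trans _ _ (c%:E * c%:E)%E); first by rewrite -h.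
by rewrite -EFinM ltry.
Qed.

Lemma bounded_fin_measure (D : set (mplane R)) : measurable D ->
  bounded_set (D : set (plane R)) -> (mu2 R D < +oo)%E.
Proof.
move=> mD /bounded_box[M M0 h]; apply: le_lt_trans (box_fin_measure M).
apply: le_measure; rewrite ?inE//; first exact: measurable_box.
by move=> x /h[h1 h2]; apply/boxP; rewrite !ltW.
Qed.

End PlaneTopology.

(** * Slices and integration by parts *)

Section Slices.
Variable R : realType.
Implicit Types (phi psi : plane R -> R).
Local Notation mu1 := (@lebesgue_measure R).
Local Notation mu := (mu2 R).

(** The directional derivative is taken along the line, so that the difference
quotients are the same. *)
Lemma is_derive_slice1 phi x y l : is_derive (x, y) (e_1 R) phi l ->
  is_derive (x : R) 1 (fun s => phi (s, y)) l.
Proof.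
move=> [d <-].
have E : (fun h : R => h^-1 *: (((fun s : R => phi (s, y)) \o shift x) (h *: 1) - phi (x, y)))
   = (fun h : R => h^-1 *: ((phi \o shift (x, y)) (h *: e_1 R) - phi (x, y))).
  by apply/funext => h /=; congr (_ *: (phi (_, _) - _)); rewrite /= ?scaler0 ?add0r.
by split; rewrite /derivable /derive E.
Qed.

Lemma is_derive_slice2 phi x y l : is_derive (x, y) (e_2 R) phi l ->
  is_derive (y : R) 1 (fun s => phi (x, s)) l.
Proof.
move=> [d <-].
have E : (fun h : R => h^-1 *: (((fun s : R => phi (x, s)) \o shift y) (h *: 1) - phi (x, y)))
   = (fun h : R => h^-1 *: ((phi \o shift (x, y)) (h *: e_2 R) - phi (x, y))).
  by apply/funext => h /=; congr (_ *: (phi (_, _) - _)); rewrite /= ?scaler0 ?add0r.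
by split; rewrite /derivable /derive E.
Qed.

Lemma is_derive_continuous (f F : R -> R) :
  (forall x : R, is_derive x 1 F (f x)) -> continuous F.
Proof.
move=> dF x; apply: differentiable_continuous; apply/derivable1_diffP.
exact: (@ex_derive _ _ _ _ _ _ _ (dF x)).
Qed.

Lemma FTC_segment (f F : R -> R) a b : a <= b -> continuous f ->
  (forall x : R, is_derive x 1 F (f x)) ->
  (\int[mu1]_(x in `[a, b]) (f x)%:E = (F b - F a)%:E)%E.
Proof.
move=> ab cf dF; have cF := is_derive_continuous dF.
move: ab; rewrite le_eqVlt => /predU1P[->|ab].
  by rewrite subrr set_itv1 integral_set1.
rewrite (@continuous_FTC2 _ f F)//.
- exact: continuous_subspaceT.
- split=> [x _||]; first exact: (@ex_derive _ _ _ _ _ _ _ (dF x)).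
  + exact/cvg_at_right_filter/cF.
  + exact/cvg_at_left_filter/cF.
- by move=> x _; rewrite derive1E (@derive_val _ _ _ _ _ _ _ (dF x)).
Qed.

Lemma integral_supp (f : R -> R) (M : R) : (forall x, M < `|x| -> f x = 0) ->
  (\int[mu1]_x (f x)%:E = \int[mu1]_(x in `[(- M)%R, M]) (f x)%:E)%E.
Proof.
move=> fM; rewrite [RHS]integral_mkcond; apply: eq_integral => x _.
rewrite /patch; case: ifPn => // /negP; rewrite inE /= in_itv /= -ler_norml => /negP.
by rewrite -ltNge => /fM ->.
Qed.

Lemma FTC_supp (f F : R -> R) (M : R) : 0 <= M -> continuous f ->
  (forall x : R, is_derive x 1 F (f x)) ->
  (forall x, M <= `|x| -> F x = 0) -> (forall x, M < `|x| -> f x = 0) ->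
  (\int[mu1]_x (f x)%:E = 0)%E.
Proof.
move=> M0 cf dF F0 f0; rewrite (integral_supp f0) (FTC_segment _ cf dF)//; last by lra.
by rewrite !F0 ?subrr ?normrN ?ger0_norm.
Qed.

(** At a point off a closed set that carries the function, the function vanishes
in a neighbourhood. *)
Lemma derive_off (K : set (plane R)) phi (v x : plane R) l : closed K ->
  (forall x, ~ K x -> phi x = 0) -> is_derive x v phi l -> ~ K x -> l = 0.
Proof.
move=> cK phi0 [_ <-] Kx; rewrite (@near_eq_derive _ _ _ phi (cst 0)) ?derive_cst//.
have : nbhs x (~` K) by apply: open_nbhs_nbhs; split => //; exact: closed_openC.
by apply: filterS => z /phi0.
Qed.

Lemma closed_box (M : R) : closed (box M : set (plane R)).
Proof.
apply: compact_closed; first exact: norm_hausdorff.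
by apply: compact_setX; exact: segment_compact.
Qed.

Lemma notin_box (M : R) (x : plane R) : M < `|x.1| \/ M < `|x.2| -> ~ box M x.
Proof. by move=> h /boxP[h1 h2]; case: h; rewrite ltNge ?h1 ?h2. Qed.

Lemma compact_supp_bounded phi M : continuous phi ->
  (forall x, ~ box M x -> phi x = 0) -> exists C : R, forall x, `|phi x| <= C.
Proof.
move=> cphi phi0.
have : compact (phi @` (box M)).
  apply: continuous_compact; first exact: continuous_subspaceT.
  by apply: compact_setX; exact: segment_compact.
move=> /compact_bounded[C0 [_ hC]]; exists (Num.max C0 0 + 1) => x.
have [xM|xM] := pselect (box M x).
  apply: (hC (Num.max C0 0 + 1)); last by exists x.
  by rewrite (@le_lt_trans _ _ (Num.max C0 0)) ?le_max ?lexx// ltrDl.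
by rewrite phi0// normr0 addr_ge0// le_max lexx orbT.
Qed.

Lemma box_bounded_integrable (k : mplane R -> R) (M C : R) :
  measurable_fun setT k -> (forall x, `|k x| <= C) ->
  (forall x, ~ box M x -> k x = 0) ->
  mu.-integrable setT (EFin \o k).
Proof.
move=> mk kC k0.
have -> : EFin \o k = (EFin \o k) \_ (box M).
  apply/funext => x; rewrite /patch; case: ifPn => // /negP; rewrite inE => /k0 /= ->.
  by [].
apply: (integrable_mkcond (mu := mu) (EFin \o k) (measurable_box M)).1.
apply: (le_integrable (measurable_box M) (g := cst C%:E)).
- by apply/measurable_EFinP; exact: measurable_funTS.
- move=> x _ /=; rewrite lee_fin (le_trans (kC x))//; exact: ler_norm.
- apply/integrableP; split=> //; rewrite integral_cst; last exact: measurable_box.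
  by rewrite lte_mul_pinfty// box_fin_measure.
Qed.

Lemma integral_slices1 (k : mplane R -> R) :
  mu.-integrable setT (EFin \o k) ->
  (forall y, \int[mu1]_x (k (x, y))%:E = 0)%E -> (\int[mu]_x (k x)%:E = 0)%E.
Proof.
move=> ik k0; rewrite -(integral21_prod_meas1 ik).
by rewrite (eq_integral (cst 0%E)) ?integral0// => y _; exact: k0.
Qed.

Lemma integral_slices2 (k : mplane R -> R) :
  mu.-integrable setT (EFin \o k) ->
  (forall x, \int[mu1]_y (k (x, y))%:E = 0)%E -> (\int[mu]_x (k x)%:E = 0)%E.
Proof.
move=> ik k0; rewrite -(integral12_prod_meas1 ik).
by rewrite (eq_integral (cst 0%E)) ?integral0// => y _; exact: k0.
Qed.

Lemma slice1_continuous phi y : continuous phi -> continuous (fun x : R => phi (x, y)).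
Proof.
move=> cphi x; have h : (fun t : R => (t, y)) t @[t --> x] --> (x, y).
  move=> A /nbhs_box[e e0 hA]; apply/nbhs_ballP; exists e => //= t.
  rewrite -ball_normE /ball_ /= => xt.
  by apply: hA; rewrite /= ?subrr ?normr0// distrC.
exact: cvg_comp h (cphi (x, y)).
Qed.

Lemma slice2_continuous phi x : continuous phi -> continuous (fun y : R => phi (x, y)).
Proof.
move=> cphi y; have h : (fun t : R => (x, t)) t @[t --> y] --> (x, y).
  move=> A /nbhs_box[e e0 hA]; apply/nbhs_ballP; exists e => //= t.
  rewrite -ball_normE /ball_ /= => xt.
  by apply: hA; rewrite /= ?subrr ?normr0// distrC.
exact: cvg_comp h (cphi (x, y)).
Qed.

End Slices.

Section IntegrationByParts.
Variable R : realType.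
Implicit Types (phi psi : plane R -> R) (b : R -> R) (M C : R).
Local Notation mu1 := (@lebesgue_measure R).
Local Notation mu := (mu2 R).

(** This is the complement of the interior of [box M]: the functions that vanish
here vanish also at the end points of the segments on which the fundamental
theorem of calculus is applied. *)
Definition off_box M (x : plane R) : Prop := M <= `|x.1| \/ M <= `|x.2|.

Lemma off_boxP M (x : plane R) : ~ box M x -> off_box M x.
Proof.
move=> h; apply: contrapT => hx; apply: h; apply/boxP.
by split; rewrite leNgt; apply/negP => h; apply: hx; [left|right]; exact: ltW.
Qed.

Lemma integrable_supp phi psi (k : mplane R -> R) M C :
  continuous phi -> continuous psi ->
  (forall x, ~ box M x -> phi x = 0) ->
  measurable_fun setT k -> (forall x, `|k x| <= C) ->
  mu.-integrable setT (EFin \o (fun x => phi x * psi x * k x)).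
Proof.
move=> cphi cpsi phi0 mk kC.
have cpp : continuous (fun x : plane R => phi x * psi x).
  by move=> x; exact: cvgM (cphi x) (cpsi x).
have [C1 hC1] : exists C1 : R, forall x, `|phi x * psi x| <= C1.
  by apply: (@compact_supp_bounded _ _ M) => // x xM; rewrite phi0// mul0r.
apply: (@box_bounded_integrable _ _ M (C1 * C)).
- by apply: measurable_funM => //; exact: continuous_measurable_plane cpp.
- by move=> x; rewrite normrM ler_pM.
- by move=> x /phi0 ->; rewrite !mul0r.
Qed.

Lemma measurable_snd_comp b : measurable_fun setT b ->
  measurable_fun setT (fun x : mplane R => b x.2).
Proof. by move=> mb; apply: measurableT_comp. Qed.

Lemma measurable_fst_comp b : measurable_fun setT b ->
  measurable_fun setT (fun x : mplane R => b x.1).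
Proof. by move=> mb; apply: measurableT_comp. Qed.

(** The factor b depends only on the variable that is not differentiated: it is a
constant on each line, so that it needs only to be bounded and measurable.
Only phi vanishes near the boundary of the box. *)
Lemma ibp1 phi phi1 psi psi1 b M C : 0 <= M ->
  (forall x, off_box M x -> phi x = 0) ->
  continuous phi -> continuous phi1 -> (forall x, is_derive x (e_1 R) phi (phi1 x)) ->
  continuous psi -> continuous psi1 -> (forall x, is_derive x (e_1 R) psi (psi1 x)) ->
  measurable_fun setT b -> (forall t, `|b t| <= C) ->
  \int[mu]_x (phi x * psi1 x * b x.2) =
  - \int[mu]_x (phi1 x * psi x * b x.2).
Proof.
move=> M0 phi0 cphi cDphi dphi cpsi cDpsi dpsi mb bC.
have bphi0 x : ~ box M x -> phi x = 0 by move=> /off_boxP; exact: phi0.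
have Dphi0 x : ~ box M x -> phi1 x = 0.
  exact: derive_off (@closed_box R M) bphi0 (dphi x).
have mb2 := measurable_snd_comp mb.
have i1 := integrable_supp cphi cDpsi bphi0 mb2 (fun x => bC x.2).
have i2 := integrable_supp cDphi cpsi Dphi0 mb2 (fun x => bC x.2).
apply/eqP; rewrite -addr_eq0 -RintegralD//; apply/eqP.
rewrite /Rintegral integral_slices1//.
  by apply: eq_integrable (integrableD measurableT i1 i2).
move=> y.
pose f x := b y * (phi (x, y) * psi1 (x, y) + psi (x, y) * phi1 (x, y)).
pose F x := b y * (phi (x, y) * psi (x, y)).
transitivity (\int[mu1]_x (f x)%:E)%E.
  by apply: eq_integral => x _; rewrite /f /=; congr EFin; ring.
apply: (@FTC_supp _ f F M) => //.
- move=> x; apply: cvgM; first exact: cvg_cst.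
  have c (g : plane R -> R) : continuous g -> {for x, continuous (fun x : R => g (x, y))}.
    by move=> cg; exact: slice1_continuous.
  exact: cvgD (cvgM (c _ cphi) (c _ cDpsi)) (cvgM (c _ cpsi) (c _ cDphi)).
- move=> x; apply: is_deriveZ.
  exact: (is_deriveM (is_derive_slice1 (dphi (x, y))) (is_derive_slice1 (dpsi (x, y)))).
- by move=> x xM; rewrite /F phi0 ?mul0r ?mulr0//; left.
- move=> x xM; rewrite /f bphi0; last by apply: notin_box; left.
  by rewrite Dphi0 ?mul0r ?mulr0 ?addr0 ?mulr0//; apply: notin_box; left.
Qed.

Lemma ibp2 phi phi1 psi psi1 b M C : 0 <= M ->
  (forall x, off_box M x -> phi x = 0) ->
  continuous phi -> continuous phi1 -> (forall x, is_derive x (e_2 R) phi (phi1 x)) ->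
  continuous psi -> continuous psi1 -> (forall x, is_derive x (e_2 R) psi (psi1 x)) ->
  measurable_fun setT b -> (forall t, `|b t| <= C) ->
  \int[mu]_x (phi x * psi1 x * b x.1) =
  - \int[mu]_x (phi1 x * psi x * b x.1).
Proof.
move=> M0 phi0 cphi cDphi dphi cpsi cDpsi dpsi mb bC.
have bphi0 x : ~ box M x -> phi x = 0 by move=> /off_boxP; exact: phi0.
have Dphi0 x : ~ box M x -> phi1 x = 0.
  exact: derive_off (@closed_box R M) bphi0 (dphi x).
have mb2 := measurable_fst_comp mb.
have i1 := integrable_supp cphi cDpsi bphi0 mb2 (fun x => bC x.1).
have i2 := integrable_supp cDphi cpsi Dphi0 mb2 (fun x => bC x.1).
apply/eqP; rewrite -addr_eq0 -RintegralD//; apply/eqP.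
rewrite /Rintegral integral_slices2//.
  by apply: eq_integrable (integrableD measurableT i1 i2).
move=> x.
pose f y := b x * (phi (x, y) * psi1 (x, y) + psi (x, y) * phi1 (x, y)).
pose F y := b x * (phi (x, y) * psi (x, y)).
transitivity (\int[mu1]_y (f y)%:E)%E.
  by apply: eq_integral => y _; rewrite /f /=; congr EFin; ring.
apply: (@FTC_supp _ f F M) => //.
- move=> y; apply: cvgM; first exact: cvg_cst.
  have c (g : plane R -> R) : continuous g -> {for y, continuous (fun y : R => g (x, y))}.
    by move=> cg; exact: slice2_continuous.
  exact: cvgD (cvgM (c _ cphi) (c _ cDpsi)) (cvgM (c _ cpsi) (c _ cDphi)).
- move=> y; apply: is_deriveZ.
  exact: (is_deriveM (is_derive_slice2 (dphi (x, y))) (is_derive_slice2 (dpsi (x, y)))).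
- by move=> y xM; rewrite /F phi0 ?mul0r ?mulr0//; right.
- move=> y xM; rewrite /f bphi0; last by apply: notin_box; right.
  by rewrite Dphi0 ?mul0r ?mulr0 ?addr0 ?mulr0//; apply: notin_box; right.
Qed.

End IntegrationByParts.

(** * Test functions *)

Section TestFunctions.
Variable R : realType.
Implicit Types (phi psi : plane R -> R) (Om : set (plane R)) (D : set (mplane R)).
Local Notation mu1 := (@lebesgue_measure R).
Local Notation mu := (mu2 R).

(** The partial derivatives are parameters: what follows treats them as continuous
functions in their own right. *)
Definition C1 phi phi1 phi2 :=
  [/\ continuous phi, continuous phi1, continuous phi2,
      forall x, is_derive x (e_1 R) phi (phi1 x)
    & forall x, is_derive x (e_2 R) phi (phi2 x)].

Definition vanish_at phi phi1 phi2 (x : plane R) :=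
  [/\ phi x = 0, phi1 x = 0 & phi2 x = 0 :> R].

(** All that the sequel uses of a test function: it is of class C^1, and it
vanishes with its first derivatives off a compact set. *)
Lemma test_functionP Om phi : test_function Om phi ->
  exists phi1 phi2 : plane R -> R, [/\ grad phi = (fun x => (phi1 x, phi2 x)),
    forall x, 'D_(e_1 R) phi x = phi1 x, forall x, 'D_(e_2 R) phi x = phi2 x,
    C1 phi phi1 phi2 &
    exists K : set (plane R), [/\ compact K, K `<=` Om &
      forall x, ~ K x -> vanish_at phi phi1 phi2 x]].
Proof.
move=> [/(_ 1%N)/= [cphi [dphi [c1 _] [c2 _]]] [K [cK KOm phi0]]].
have [p1 E1] : exists f, 'D_(e_1 R) phi = f by exists ('D_(e_1 R) phi).
have [p2 E2] : exists f, 'D_(e_2 R) phi = f by exists ('D_(e_2 R) phi).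
have d1 x : is_derive x (e_1 R) phi (p1 x).
  by rewrite -E1; apply: derivableP; case: (dphi x).
have d2 x : is_derive x (e_2 R) phi (p2 x).
  by rewrite -E2; apply: derivableP; case: (dphi x).
have gE : grad phi = (fun x => (p1 x, p2 x)) by rewrite -E1 -E2.
have D1 x : 'D_(e_1 R) phi x = p1 x by rewrite -E1.
have D2 x : 'D_(e_2 R) phi x = p2 x by rewrite -E2.
rewrite E1 in c1; rewrite E2 in c2; clear E1 E2 dphi.
exists p1, p2; split; [exact: gE|exact: D1|exact: D2|by split|].
exists K; split; [exact: cK|exact: KOm|] => x Kx.
have clK : closed K by apply: compact_closed => //; exact: norm_hausdorff.
split; first exact: phi0.
- exact: derive_off clK phi0 (d1 x) Kx.
- exact: derive_off clK phi0 (d2 x) Kx.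
Qed.

Lemma supp_off_box phi phi1 phi2 (K : set (plane R)) : compact K ->
  (forall x, ~ K x -> vanish_at phi phi1 phi2 x) ->
  exists2 M : R, 0 < M & forall x, off_box M x -> vanish_at phi phi1 phi2 x.
Proof.
move=> cK phi0; have [M M0 hM] := compact_box cK; exists M => // x [] xM; apply: phi0 => /hM[].
  by rewrite ltNge xM.
by rewrite [`|x.2| < _]ltNge xM.
Qed.

Lemma Rintegral_off D (k : mplane R -> R) :
  (forall x, ~ D x -> k x = 0) -> \int[mu]_(x in D) k x = \int[mu]_x k x.
Proof.
move=> k0; rewrite Rintegral_mkcond; congr Rintegral; apply/funext => x.
by rewrite /patch; case: ifPn => // /negP; rewrite inE => /k0 ->.
Qed.

Lemma C1_bounded phi phi1 phi2 M : C1 phi phi1 phi2 ->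
  (forall x, off_box M x -> vanish_at phi phi1 phi2 x) ->
  exists C : R, forall x, [/\ `|phi x| <= C, `|phi1 x| <= C & `|phi2 x| <= C].
Proof.
move=> [c0 c1 c2 _ _] h.
have h' x : ~ box M x -> _ := fun hx => h x (off_boxP hx).
have [C0 hC0] : exists C : R, forall x, `|phi x| <= C.
  by apply: (@compact_supp_bounded _ _ M) => // x /h'[].
have [C1 hC1] : exists C : R, forall x, `|phi1 x| <= C.
  by apply: (@compact_supp_bounded _ _ M) => // x /h'[].
have [C2 hC2] : exists C : R, forall x, `|phi2 x| <= C.
  by apply: (@compact_supp_bounded _ _ M) => // x /h'[].
have := le_trans (normr_ge0 _) (hC0 0); have := le_trans (normr_ge0 _) (hC1 0).
have := le_trans (normr_ge0 _) (hC2 0) => C2p C1p C0p.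
exists (C0 + C1 + C2) => x.
have := hC0 x; have := hC1 x; have := hC2 x.
move: (phi x) (phi1 x) (phi2 x) => a b c h1 h2 h3; clear -h1 h2 h3 C2p C1p C0p.
by split; lra.
Qed.

Lemma test_function_weak_gradient Om phi : test_function Om phi ->
  weak_gradient Om (phi, grad phi).
Proof.
move=> /test_functionP[p1 [p2 [-> _ _ [c0 c1 c2 d1 d2] [K [cK KOm phi0]]]]] psi.
move=> /test_functionP[q1 [q2 [_ E1 E2 [c0' c1' c2' d1' d2'] _]]].
have [M M0 h] := supp_off_box cK phi0.
have phi0' x : off_box M x -> phi x = 0 by move=> /h[].
have off x : ~ Om x -> vanish_at phi p1 p2 x by move=> hx; apply: phi0 => /KOm.
have one (t : R) : `|cst (1 : R) t| <= 1 by rewrite normr1.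
have mone : measurable_fun setT (cst 1 : R -> R) by exact: measurable_cst.
split.
- rewrite (@Rintegral_off Om); last by move=> x /off[/= -> _ _]; rewrite mul0r.
  rewrite (@Rintegral_off Om); last by move=> x /off[_ /= -> _]; rewrite mul0r.
  under eq_Rintegral do rewrite E1.
  have := ibp1 (ltW M0) phi0' c0 c1 d1 c0' c1' d1' mone one.
  under eq_Rintegral do rewrite mulr1.
  by under [in X in _ = - X -> _]eq_Rintegral do rewrite mulr1.
- rewrite (@Rintegral_off Om); last by move=> x /off[/= -> _ _]; rewrite mul0r.
  rewrite (@Rintegral_off Om); last by move=> x /off[_ _ /= ->]; rewrite mul0r.
  under eq_Rintegral do rewrite E2.
  have := ibp2 (ltW M0) phi0' c0 c2 d2 c0' c2' d2' mone one.
  under eq_Rintegral do rewrite mulr1.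
  by under [in X in _ = - X -> _]eq_Rintegral do rewrite mulr1.
Qed.

Lemma test_function_Lp Om phi q : measurable (Om : set (mplane R)) ->
  (mu Om < +oo)%E -> 1 <= q -> test_function Om phi ->
  Lp Om q phi /\ Lpv Om q (grad phi).
Proof.
move=> mOm Omfin q1 /test_functionP[p1 [p2 [-> _ _ hC1 [K [cK _ phi0]]]]].
have [M M0 h] := supp_off_box cK phi0.
have [C hC] := C1_bounded hC1 h; have [c0 c1 c2 _ _] := hC1.
have m (f : plane R -> R) : continuous f -> (forall x, `|f x| <= C) -> Lp Om q f.
  move=> /continuous_measurable_plane mf fC.
  apply: (@Lp_bounded _ _ _ _ C) => //; exact: measurable_funTS.
by split; [|split]; apply: m => // x; have [] := hC x.
Qed.

Lemma test_function_W1 Om phi q : measurable (Om : set (mplane R)) ->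
  (mu Om < +oo)%E -> 1 <= q -> test_function Om phi -> W1 Om q (phi, grad phi).
Proof.
move=> mOm Omfin q1 tphi; have [h1 h2] := test_function_Lp mOm Omfin q1 tphi.
by split; [exact: h1|exact: h2|exact: test_function_weak_gradient].
Qed.

(** The constant sequence approximates. *)
Lemma test_function_W10 Om phi q : measurable (Om : set (mplane R)) ->
  (mu Om < +oo)%E -> 1 <= q -> test_function Om phi -> W10 Om q (phi, grad phi).
Proof.
move=> mOm Omfin q1 tphi; split; first exact: test_function_W1.
exists (fun=> phi); split; first by move=> _; exact: tphi.
have q0 : q != 0 by rewrite gt_eqF// (lt_le_trans ltr01).
have q0' : q%:E != 0%E :> \bar R by rewrite eqe.
have L0 : Lpnorm Om q (cst 0) = 0%E.
  rewrite /Lpnorm (_ : EFin \o _ = cst 0%E); first exact: Lnorm0.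
  by apply/funext => x; rewrite /patch /=; case: ifP.
rewrite subrr /W1norm /Lpvnorm /=.
rewrite (_ : (fun x => enorm _) = cst 0); last first.
  by apply/funext => x; rewrite /enorm /dot /= mulr0 addr0 sqrtr0.
rewrite (_ : Lpnorm Om q 0 = 0%E); last exact: L0.
rewrite poweR0r// adde0 poweR0r ?invr_eq0//.
exact: cvg_cst.
Qed.

End TestFunctions.

(** * Density and the Poincare inequality in W^{1,q}_0 *)

Section Poincare.
Variable R : realType.
Local Notation mu1 := (@lebesgue_measure R).
Local Notation mu := (mu2 R).

Lemma measurable_powR_norm d (T : measurableType d) (f : T -> R) (q : R) :
  measurable_fun setT f -> measurable_fun setT (fun x => (`|f x| `^ q)%:E).
Proof.
move=> mf; apply/measurable_EFinP.
apply: (@measurableT_comp _ _ _ _ _ _ (@powR R ^~ q)) => //.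
exact: measurableT_comp.
Qed.

Lemma lebesgue_segment (M : R) : 0 <= M -> mu1 `[- M, M]%classic = (2 * M)%:E.
Proof.
move=> M0; rewrite lebesgue_measure_itv /= lte_fin.
case: ltP => h; first by rewrite -EFinB; congr EFin; ring.
by congr EFin; lra.
Qed.

(** F x is the integral of f from -M to x; apply Holder's inequality on the
segment [-M, M], which has length 2 M. *)
Lemma poincare1 (f F : R -> R) (M q : R) : 0 <= M -> 1 < q -> continuous f ->
  (forall x : R, is_derive x 1 F (f x)) ->
  (forall x, M <= `|x| -> F x = 0) -> forall x,
  ((`|F x| `^ q)%:E <= ((2 * M) `^ (q - 1))%:E * \int[mu1]_x (`|f x| `^ q)%:E)%E.
Proof.
move=> M0 q1 cf dF F0 x.
have q0 : 0 < q by exact: lt_trans q1.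
have qn0 : q != 0 by rewrite gt_eqF.
have Iq0 : (0 <= \int[mu1]_x (`|f x| `^ q)%:E)%E by exact: integral_ge0.
have [xM|xM] := leP M `|x|.
  by rewrite F0// normr0 powR0// mule_ge0// lee_fin powR_ge0.
have [xM1 xM2] : - M <= x /\ x <= M.
  by move: xM; rewrite ltr_norml => /andP[/ltW ? /ltW ?].
have mf : measurable_fun setT f by exact: continuous_measurable_fun.
pose S : set (measurableTypeR R) := `[- M, M]%classic.
have mS : measurable S by exact: measurable_itv.
have F1 : (`|F x|%:E <= 'N[mu1]_1[EFin \o (f \* \1_S)%R])%E.
  have -> : `|F x|%:E = `|\int[mu1]_(t in `[(- M)%R, x]) (f t)%:E|%E.
    by rewrite (FTC_segment _ cf dF)// [F (- M)]F0 ?subr0// normrN ger0_norm.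
  apply: le_trans (le_abse_integral _ _ _) _ => //.
    by apply/measurable_EFinP; exact: measurable_funTS.
  rewrite Lnorm1 [leLHS]integral_mkcond; apply: ae_le_integral => [t|t|].
  - by rewrite /patch; case: ifP.
  - by [].
  - apply/nearW => t; rewrite /patch; case: ifPn => [/set_mem|_]; last exact: abse_ge0.
    rewrite /= in_itv /= => /andP[t1 t2]; rewrite indicE mem_set ?mulr1//.
    by rewrite /S /= in_itv /= t1 (le_trans t2 xM2).
(* The conjugate exponent of q. *)
pose q' := q / (q - 1).
have q10 : 0 < q - 1 by rewrite subr_gt0.
have q'0 : 0 < q' by rewrite divr_gt0.
have qq' : q^-1 + q'^-1 = 1.
  by rewrite /q' invf_div -{1}(mul1r q^-1) -mulrDl addrCA subrr addr0 mulfV.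
have mS1 : measurable_fun setT (\1_S : _ -> R) by exact: measurable_indic.
have F2 := le_trans F1 (hoelder mu1 mf mS1 q0 q'0 qq').
have NS : 'N[mu1]_q'%:E[EFin \o \1_S]%E = ((2 * M) `^ q'^-1)%:E.
  rewrite unlock /Lnorm (_ : (\int[mu1]_t _)%E = (2 * M)%:E)//.
  rewrite -(lebesgue_segment M0) -[RHS]mul1e -(integral_cst mu1 mS) [RHS]integral_mkcond.
  apply: eq_integral => t _; rewrite /patch /= indicE; case: ifPn => tS.
    by rewrite normr1 powR1.
  by rewrite normr0 powR0// gt_eqF.
rewrite NS in F2.
have -> : (`|F x| `^ q)%:E = (`|F x|%:E `^ q)%E by [].
apply: (@le_trans _ _ (('N[mu1]_q%:E[EFin \o f] * ((2 * M) `^ q'^-1)%:E) `^ q)%E).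
  apply: gt0_ler_poweR F2; first exact: ltW.
  - by rewrite in_itv /= leey lee_fin normr_ge0.
  - by rewrite in_itv /= leey mule_ge0// ?Lnorm_ge0// lee_fin powR_ge0.
rewrite poweRM ?Lnorm_ge0 ?lee_fin ?powR_ge0// muleC (poweR_Lnorm mu1 _ qn0).
rewrite poweR_EFin -powRrM /q' invf_div divfK//.
Qed.

(** Integrate the one-dimensional bound over the horizontal lines, and over the
segment of length 2 M that each of them has in the box; only the first
partial derivative is used. *)
Lemma poincare_box phi phi1 phi2 (M q : R) : 0 <= M -> 1 < q -> C1 phi phi1 phi2 ->
  (forall x, off_box M x -> vanish_at phi phi1 phi2 x) ->
  (\int[mu]_x (`|phi x| `^ q)%:E <=
    ((2 * M) `^ q)%:E * \int[mu]_x (`|phi1 x| `^ q)%:E)%E.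
Proof.
move=> M0 q1 [c0 c1 c2 d1 _] h.
have q0 : 0 < q by exact: lt_trans q1.
have mp (f : plane R -> R) : continuous f -> measurable_fun setT (fun x : mplane R => (`|f x| `^ q)%:E).
  by move=> cf; apply: measurable_powR_norm; exact: continuous_measurable_plane.
have m0 := mp _ c0; have m1 := mp _ c1.
have pos (f : plane R -> R) (x : mplane R) : (0 <= (`|f x : R| `^ q)%:E)%E by rewrite lee_fin powR_ge0.
rewrite (fubini_tonelli2 _ m0 (pos phi)) (fubini_tonelli2 _ m1 (pos phi1)).
have mG := @measurable_fun_fubini_tonelli_G _ _ _ _ _ mu1 _ m1 (pos phi1).
set G := fubini_G _ _ in mG *.
have G0 y : (0 <= G y)%E by apply: integral_ge0 => x _; exact: pos.
rewrite -ge0_integralZl//; last by rewrite lee_fin powR_ge0.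
apply: ae_le_integral => [y|y|].
- by apply: integral_ge0 => x _; exact: pos.
- by rewrite mule_ge0 ?G0// lee_fin powR_ge0.
apply/nearW => y; rewrite /fubini_G.
pose S : set (measurableTypeR R) := `[- M, M]%classic.
apply: (@le_trans _ _ (\int[mu1]_(x in S) (((2 * M) `^ (q - 1))%:E * G y))%E).
  rewrite [leRHS]integral_mkcond; apply: ae_le_integral => [x|x|].
  - exact: (pos phi (x, y)).
  - by rewrite /patch; case: ifP => // _; rewrite mule_ge0// lee_fin powR_ge0.
  apply/nearW => x; rewrite /patch; case: ifPn => [_|/negP xS].
    apply: (@poincare1 (fun s => phi1 (s, y)) (fun s => phi (s, y))) => //.
    - exact: slice1_continuous.
    - by move=> s; exact: is_derive_slice1 (d1 (s, y)).
    - by move=> s sM; have [] // := h (s, y) (or_introl sM).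
  have xM : off_box M (x, y).
    left => /=; rewrite leNgt; apply/negP => xM; apply: xS.
    by rewrite inE /S /= in_itv /= -ler_norml ltW.
  by have [-> _ _] := h _ xM; rewrite normr0 powR0 ?gt_eqF.
rewrite integral_cst; last exact: measurable_itv.
rewrite [X in (_ * X <= _)%E](_ : _ = (2 * M)%:E); last exact: lebesgue_segment.
move: (G y) (G0 y) => g g0; rewrite muleAC -EFinM.
have [->|M1] := eqVneq M 0; first by rewrite !mulr0 mul0e mule_ge0// lee_fin powR_ge0.
have M2 : 0 < 2 * M by rewrite mulr_gt0// lt_neqAle eq_sym M1.
rewrite -[X in ((_ * X)%:E * _)%E](powRr1 (ltW M2)) -powRD ?subrK ?lexx//.
by rewrite (gt_eqF M2) implybT.
Qed.

End Poincare.

Section SobolevZero.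
Variable R : realType.
Variables (Om : set (mplane R)).
Hypotheses (mOm : measurable Om) (Omfin : (mu2 R Om < +oo)%E).
Implicit Types (v : sobfun R) (phi : plane R -> R) (p q : R).
Local Notation mu := (mu2 R).

(** Every comparison between the W^{1,q} norm and its two constituents goes
through this bound and the next one, which are those of the l^q norm on pairs
of numbers. *)
Lemma W1norm_ge v q : 1 <= q -> Lp Om q v.1 -> Lpv Om q v.2 ->
  (Lpnorm Om q v.1 <= W1norm Om q v)%E /\ (Lpvnorm Om q v.2 <= W1norm Om q v)%E.
Proof.
move=> q1 v1 v2.
have := Lp_fin_num v1; have := Lp_fin_num (Lpv_enorm mOm q1 v2).
have := Lpnorm_ge0 Om q v.1; have := Lpnorm_ge0 Om q (fun x => enorm (v.2 x)).
rewrite /W1norm /Lpvnorm; case: (Lpnorm Om q v.1) => // a.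
case: (Lpnorm Om q _) => // b; rewrite !lee_fin => b0 a0 _ _.
by split; [exact: le_pnorm|rewrite addrC; exact: le_pnorm].
Qed.

Lemma W1norm_le v q : 1 <= q -> Lp Om q v.1 -> Lpv Om q v.2 ->
  (W1norm Om q v <= Lpnorm Om q v.1 + Lpvnorm Om q v.2)%E.
Proof.
move=> q1 v1 v2.
have := Lp_fin_num v1; have := Lp_fin_num (Lpv_enorm mOm q1 v2).
have := Lpnorm_ge0 Om q v.1; have := Lpnorm_ge0 Om q (fun x => enorm (v.2 x)).
rewrite /W1norm /Lpvnorm; case: (Lpnorm Om q v.1) => // a.
case: (Lpnorm Om q _) => // b; rewrite !lee_fin => b0 a0 _ _.
exact: pnorm_le.
Qed.

Lemma cvge0_small (w : nat -> \bar R) (e : R) : w n @[n --> \oo] --> 0%E -> 0 < e ->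
  exists n, (w n < e%:E)%E.
Proof.
move=> /fine_cvgP[wfin w0] e0.
have we : \forall n \near \oo, fine (w n) < e by exact: cvgr_lt w0 _ e0.
near \oo => n; exists n.
have fn : w n \is a fin_num by near: n.
by rewrite -(fineK fn) lte_fin; near: n.
Unshelve. all: by end_near.
Qed.

Lemma W10_approx v q (e : R) : 1 <= q -> W10 Om q v -> 0 < e ->
  exists phi, [/\ test_function Om phi, (Lpnorm Om q (v.1 \- phi)%R <= e%:E)%E
    & (Lpvnorm Om q (v.2 - grad phi)%R <= e%:E)%E].
Proof.
move=> q1 [[v1 v2 _] [phi [tphi cphi]]] e0.
have [n wn] := cvge0_small cphi e0; exists (phi n).
have [p1 p2] := test_function_Lp mOm Omfin q1 (tphi n).
have [h1 h2] := @W1norm_ge (v - (phi n, grad (phi n))) q q1 (LpB q1 v1 p1) (LpvB q1 v2 p2).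
by split; [exact: tphi|exact: le_trans h1 (ltW wn)|exact: le_trans h2 (ltW wn)].
Qed.

(** Both integrals are continuous in v for the W^{1,q} norm by Holder's
inequality, and test functions are dense in W^{1,q}_0. *)
Lemma W10_density p q (H : mplane R -> plane R) (h : mplane R -> R) :
  1 < p -> 1 < q -> p^-1 + q^-1 = 1 -> Lpv Om p H -> Lp Om p h ->
  (forall phi, test_function Om phi ->
    \int[mu]_(x in Om) dot (H x) (grad phi x) + \int[mu]_(x in Om) (h x * phi x) = 0) ->
  forall v, W10 Om q v ->
    \int[mu]_(x in Om) dot (H x) (v.2 x) + \int[mu]_(x in Om) (h x * v.1 x) = 0.
Proof.
move=> p1 q1 pq HH hh H0 v Wv; have [[v1 v2 _] _] := Wv.
have p1' := ltW p1; have q1' := ltW q1.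
have p0 : 0 < p by exact: lt_trans p1.
have q0 : 0 < q by exact: lt_trans q1.
set L := LHS; apply/eqP; rewrite -normr_le0; apply/ler_addgt0Pr => e e0; rewrite add0r.
(* An approximation of v within e / c changes L by at most e. *)
pose c := fine (Lpvnorm Om p H) + fine (Lpnorm Om p h) + 1.
have nH : Lpvnorm Om p H = (fine (Lpvnorm Om p H))%:E.
  by rewrite fineK// Lp_fin_num//; exact: Lpv_enorm.
have nh : Lpnorm Om p h = (fine (Lpnorm Om p h))%:E by rewrite fineK// Lp_fin_num.
have nH0 : 0 <= fine (Lpvnorm Om p H) by rewrite fine_ge0// Lpnorm_ge0.
have nh0 : 0 <= fine (Lpnorm Om p h) by rewrite fine_ge0// Lpnorm_ge0.
have c0 : 0 < c by rewrite ltr_wpDl// addr_ge0.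
have [phi [tphi a1 a2]] := W10_approx q1' Wv (divr_gt0 e0 c0).
have [p1phi p2phi] := test_function_Lp mOm Omfin q1' tphi.
have E1 : \int[mu]_(x in Om) dot (H x) ((v.2 - grad phi) x) =
    \int[mu]_(x in Om) dot (H x) (v.2 x) - \int[mu]_(x in Om) dot (H x) (grad phi x).
  rewrite -(RintegralB mOm (Lpv_dot_integrable mOm p1' q1' pq HH v2)
    (Lpv_dot_integrable mOm p1' q1' pq HH p2phi)).
  by apply: eq_Rintegral => x _; rewrite /dot /=; ring.
have E2 : \int[mu]_(x in Om) (h x * (v.1 \- phi) x) =
    \int[mu]_(x in Om) (h x * v.1 x) - \int[mu]_(x in Om) (h x * phi x).
  rewrite -(RintegralB mOm (Lp_hoelder_integrable mOm p0 q0 pq hh v1)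
    (Lp_hoelder_integrable mOm p0 q0 pq hh p1phi)).
  by apply: eq_Rintegral => x _ /=; ring.
have -> : L = \int[mu]_(x in Om) dot (H x) ((v.2 - grad phi) x) +
    \int[mu]_(x in Om) (h x * (v.1 \- phi) x).
  by rewrite E1 E2 /L -[LHS]subr0 -(H0 _ tphi); ring.
have B1 := Lpv_dot_le mOm p1' q1' pq HH (LpvB q1' v2 p2phi).
have B2 := Lp_hoelder_le mOm p0 q0 pq hh (LpB q1' v1 p1phi).
have {}B1 : `|\int[mu]_(x in Om) dot (H x) ((v.2 - grad phi) x)| <=
    fine (Lpvnorm Om p H) * (e / c).
  rewrite -lee_fin; apply: le_trans B1 _; rewrite EFinM -nH.
  by apply: lee_wpmul2l => //; exact: Lpnorm_ge0.
have {}B2 : `|\int[mu]_(x in Om) (h x * (v.1 \- phi) x)| <=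
    fine (Lpnorm Om p h) * (e / c).
  rewrite -lee_fin; apply: le_trans B2 _; rewrite EFinM -nh.
  by apply: lee_wpmul2l => //; exact: Lpnorm_ge0.
apply: le_trans (ler_normD _ _) _; apply: le_trans (lerD B1 B2) _.
rewrite -mulrDl mulrA ler_pdivrMr// mulrC ler_pM2l// /c.
by rewrite lerDl.
Qed.

Lemma test_function_poincare phi (M q : R) : 0 <= M -> 1 < q ->
  (forall x, off_box M x -> ~ Om x) -> test_function Om phi ->
  (Lpnorm Om q phi <= (2 * M)%:E * Lpvnorm Om q (grad phi))%E.
Proof.
move=> M0 q1 OmM tphi; have q0 : 0 < q by exact: lt_trans q1.
have qn0 : q != 0 by rewrite gt_eqF.
have [_ gphiL] := test_function_Lp mOm Omfin (ltW q1) tphi.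
move: tphi gphiL => /test_functionP[p1 [p2 [-> _ _ C1phi [K [cK KOm phi0]]]]] gphiL.
have off x : ~ Om x -> vanish_at phi p1 p2 x by move=> hx; apply: phi0 => /KOm.
have h x : off_box M x -> vanish_at phi p1 p2 x by move=> /OmM; exact: off.
have PB := poincare_box M0 q1 C1phi h.
have offE (f : plane R -> R) : (forall x, ~ Om x -> f x = 0) ->
    (\int[mu]_x (`|f x| `^ q)%:E = Lpnorm Om q f `^ q)%E.
  move=> f0; rewrite (LpnormE _ _ qn0) [RHS]integral_mkcond; apply: eq_integral => x _.
  by rewrite /patch; case: ifPn => // /negP; rewrite inE => /f0 ->; rewrite normr0 powR0.
rewrite (offE phi) in PB; last by move=> x /off[].
rewrite (offE p1) in PB; last by move=> x /off[].
have le1 : (Lpnorm Om q p1 <= Lpvnorm Om q (fun x => (p1 x, p2 x)))%E.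
  apply: Lpnorm_ae_le => //; apply/nearW => x _.
  by rewrite [leRHS]ger0_norm ?enorm_ge0// (norm_fst_le (p1 x, p2 x)).
apply: (@le_trans _ _ ((2 * M)%:E * Lpnorm Om q p1)%E); last first.
  by apply: lee_wpmul2l le1; rewrite lee_fin mulr_ge0.
have M2 : (0 <= (2 * M)%:E)%E by rewrite lee_fin mulr_ge0.
rewrite -poweR_EFin -poweRM ?Lpnorm_ge0// in PB.
by apply: poweR_le_inv PB => //; rewrite ?mule_ge0 ?Lpnorm_ge0.
Qed.

(** By density from test functions. *)
Lemma W10_poincare v (M q : R) : 0 <= M -> 1 < q ->
  (forall x, off_box M x -> ~ Om x) -> W10 Om q v ->
  (Lpnorm Om q v.1 <= (2 * M)%:E * Lpvnorm Om q v.2)%E.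
Proof.
move=> M0 q1 OmM Wv; have q1' := ltW q1; have [[v1 v2 _] _] := Wv.
have n1 := fineK (Lp_fin_num v1); have n2 := fineK (Lp_fin_num (Lpv_enorm mOm q1' v2)).
rewrite /Lpvnorm -n1 -n2 -EFinM lee_fin.
set a := fine _; set b := fine _.
apply/ler_addgt0Pr => e e0.
have c0 : 0 < 1 + 2 * M by rewrite ltr_pwDl// mulr_ge0.
have [phi [tphi a1 a2]] := W10_approx q1' Wv (divr_gt0 e0 c0).
have [p1phi p2phi] := test_function_Lp mOm Omfin q1' tphi.
have T1 : (Lpnorm Om q v.1 <= Lpnorm Om q (v.1 \- phi)%R + Lpnorm Om q phi)%E.
  rewrite [X in (Lpnorm Om q X <= _)%E](_ : _ = (v.1 \- phi) \+ phi); last first.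
    by apply/funext => x /=; rewrite subrK.
  apply: Lpnorm_triangle => //; first exact: Lp_measurable (LpB q1' v1 p1phi).
  exact: Lp_measurable p1phi.
have T2 : (Lpvnorm Om q (grad phi) <= Lpvnorm Om q (v.2 - grad phi)%R + Lpvnorm Om q v.2)%E.
  rewrite -(LpvnormN _ _ q1').
  rewrite [X in (Lpvnorm Om q X <= _)%E](_ : _ = (v.2 - grad phi) + (- v.2)); last first.
    by apply/funext => x; rewrite !fctE; ring.
  rewrite -[X in (_ <= _ + X)%E](LpvnormN _ _ q1').
  by apply: Lpvnorm_triangle => //; [exact: LpvB|exact: LpvN].
have P := test_function_poincare M0 q1 OmM tphi.
rewrite -lee_fin n1; apply: le_trans T1 _.
apply: le_trans (leeD a1 P) _.
have M2 : (0 <= (2 * M)%:E)%E by rewrite lee_fin mulr_ge0.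
apply: (@le_trans _ _ ((e / (1 + 2 * M))%:E + (2 * M)%:E * ((e / (1 + 2 * M))%:E + b%:E))%E).
  apply: leeD => //; apply: lee_wpmul2l => //; apply: le_trans T2 _.
  by apply: leeD => //; rewrite /Lpvnorm n2.
rewrite [leLHS](_ : _ = (e / (1 + 2 * M) + 2 * M * (e / (1 + 2 * M) + b))%:E) ?lee_fin//.
rewrite (_ : _ + _ * (_ + _) = 2 * M * b + (e / (1 + 2 * M)) * (1 + 2 * M)); last by ring.
by rewrite divfK// gt_eqF.
Qed.

End SobolevZero.

(** * Uniqueness of the weak gradient *)

Section ZeroIntegrals.
Context d (T : measurableType d) (R : realType).
Variable mu : {measure set T -> \bar R}.

(** Together with the pi-lambda theorem, this reduces the vanishing of all
integrals of f to their vanishing on a generating family of sets that is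
stable by intersection. *)
Lemma dynkin_integral_zero (f : T -> \bar R) :
  mu.-integrable setT f -> (\int[mu]_x f x = 0)%E ->
  dynkin [set S | measurable S /\ (\int[mu]_(x in S) f x = 0)%E].
Proof.
move=> fi f0; split => [|S [mS S0]|F tF FH].
- by split.
- split; first exact: measurableC.
  have : (\int[mu]_(x in S `|` ~` S) f x = 0)%E by rewrite setUv.
  rewrite integral_setU //; first by rewrite S0 add0e.
  + exact: measurableC.
  + by rewrite setUv; exact: measurable_int fi.
  + by apply/disj_setPS; rewrite setICr.
- have mF k : measurable (F k) by have [] := FH k.
  split; first exact: bigcup_measurable.
  rewrite integral_bigcup//; last first.
    by apply: (integrableS measurableT) fi => //; exact: bigcup_measurable.
  by apply: eseries0 => k _ _; have [] := FH k.
Qed.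

Lemma dynkin_preimage d' (U : measurableType d') (g : T -> U) (H : set (set T)) :
  measurable_fun setT g ->
  dynkin H -> dynkin [set A | measurable A /\ H (g @^-1` A)].
Proof.
move=> mg [HT HC HU]; split => [|A [mA HA]|F tF FH].
- by split.
- by split; [exact: measurableC|exact: HC].
- split; first by apply: bigcup_measurable => k _; have [] := FH k.
  rewrite preimage_bigcup; apply: HU; last by move=> k; have [] := FH k.
  apply/trivIsetP => i j _ _ ij; rewrite -preimage_setI.
  by move/trivIsetP : tF => /(_ i j I I ij) ->; rewrite preimage_set0.
Qed.

(** The rays generate the Borel sets of the line and are stable by intersection. *)
Lemma integral_zero_rays (f : T -> \bar R) (g : T -> measurableTypeR R) :
  mu.-integrable setT f -> measurable_fun setT g -> (\int[mu]_x f x = 0)%E ->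
  (forall c : R, (\int[mu]_(x in g @^-1` `]c, +oo[) f x = 0)%E) ->
  forall A, measurable A -> (\int[mu]_(x in g @^-1` A) f x = 0)%E.
Proof.
move=> fi mg f0 fc A mA.
pose H := [set B : set (measurableTypeR R) | measurable B /\
  [set S | measurable S /\ (\int[mu]_(x in S) f x = 0)%E] (g @^-1` B)].
suff : H A by move=> [_ []].
have lH : lambda_system setT H.
  by apply/dynkin_lambda_system/dynkin_preimage => //; exact: dynkin_integral_zero.
have GI : setI_closed (@RGenOInfty.G R).
  move=> _ _ [x ->] [y ->]; exists (Num.max x y); apply/seteqP; split => z /=.
    by rewrite !in_itv /= !andbT gt_max => -[-> ->].
  by rewrite !in_itv /= !andbT gt_max => /andP[].
apply: (lambda_system_subset GI lH) => //; last first.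
  have E := RGenOInfty.measurableE R.
  by have : ((R.-ocitv).-measurable).-sigma.-measurable A := mA; rewrite E.
move=> _ [x ->]; split; first exact: measurable_itv.
by split => //; rewrite -[X in measurable X]setTI; apply: mg => //; exact: measurable_itv.
Qed.

End ZeroIntegrals.

Lemma cvg_atan_sg (R : realType) (t : R) :
  atan (n%:R * t) @[n --> \oo] --> pi / 2 * Num.sg t.
Proof.
have pos (s : R) : 0 < s -> atan (n%:R * s) @[n --> \oo] --> pi / 2.
  move=> s0; have h : x * s @[x --> +oo] --> +oo by apply: (gt0_cvgMly s0); exact: cvg_id.
  have h' := cvg_comp _ _ h (@cvgy_atan R).
  exact: cvg_comp _ _ (@cvgr_idn R) h'.
case: (ltgtP t 0) => [t0|t0|->].
- rewrite ltr0_sg// mulrN1 (_ : (fun n => _) = (fun n => - atan (n%:R * - t))).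
    by apply: cvgN; apply: pos; rewrite oppr_gt0.
  by apply/funext => n; rewrite mulrN atanN opprK.
- by rewrite gtr0_sg// mulr1; exact: pos.
- rewrite sgr0 mulr0 (_ : (fun n => _) = cst 0); first exact: cvg_cst.
  by apply/funext => n; rewrite mulr0 atan0.
Qed.

(** As k grows, atan (k t) tends to (pi / 2) sg t boundedly, and the indicator of
t > 0 is (1 + sg t) / 2 off t = 0. The arctangent replaces a mollified
indicator function: it is smooth with a bounded derivative. *)
Lemma integral_zero_atan d (T : measurableType d) (R : realType)
    (mu : {measure set T -> \bar R}) (F g : T -> R) (c : R) :
  mu.-integrable setT (EFin \o F) -> measurable_fun setT g ->
  mu (g @^-1` [set c]) = 0%E -> (\int[mu]_x (F x)%:E = 0)%E ->
  (forall k : nat, \int[mu]_x (F x * atan (k%:R * (g x - c)))%:E = 0)%E ->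
  (\int[mu]_(x in g @^-1` `]c, +oo[) (F x)%:E = 0)%E.
Proof.
move=> iF mg g0 F0 Fk; have mF := measurable_int _ iF.
have mF' : measurable_fun setT F by exact/measurable_EFinP.
have mS : measurable (g @^-1` `]c, +oo[).
  by rewrite -[X in measurable X]setTI; apply: mg => //; exact: measurable_itv.
have mN : measurable (g @^-1` [set c]).
  by rewrite -[X in measurable X]setTI; apply: mg => //; exact: measurable_set1.
have mat k : measurable_fun setT (fun x => F x * atan (k%:R * (g x - c))).
  apply: measurable_funM => //; apply: measurableT_comp => //.
    by apply: continuous_measurable_fun => x; exact: continuous_atan.
  apply: measurable_funM => //; exact: measurable_funB.
have sgE (t : R) : Num.sg t = (t \in `]0, +oo[)%:R - (t \in `]-oo, 0[)%:R.
  by rewrite !in_itv /= andbT; case: (ltgtP t 0) => h;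
    rewrite ?(gtr0_sg h) ?(ltr0_sg h) ?h ?sgr0 ?subr0 ?sub0r.
have msg : measurable_fun setT (fun x => Num.sg (g x - c)).
  apply: (measurableT_comp (f := @Num.sg R)); last exact: measurable_funB.
  rewrite (_ : Num.sg = (fun t => \1_(`]0, +oo[%classic) t - \1_(`]-oo, 0[%classic) t)).
    by apply: measurable_funB; apply: measurable_indic; exact: measurable_itv.
  by apply/funext => t; rewrite sgE !indicE !mem_setE.
pose h x := F x * (pi / 2 * Num.sg (g x - c)).
have mh : measurable_fun setT h.
  by apply: measurable_funM => //; apply: measurable_funM.
have ih0 : (\int[mu]_x (h x)%:E = 0)%E.
  have dc := @dominated_convergence _ _ _ mu setT measurableT
    (fun k x => (F x * atan (k%:R * (g x - c)))%:E) (fun x => (h x)%:E)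
    (fun x => (2 * `|F x|)%:E)
    (fun k => (measurable_EFinP _ _).2 (mat k)) ((measurable_EFinP _ _).2 mh).
  have A1 : {ae mu, forall x, setT x ->
      (F x * atan (n%:R * (g x - c)))%:E @[n --> \oo] --> (h x)%:E}.
    apply/nearW => x _; apply: cvg_EFin; first exact/nearW.
    by apply: cvgM; [exact: cvg_cst|exact: cvg_atan_sg].
  have A2 : mu.-integrable setT (fun x => (2 * `|F x|)%:E).
    by apply: eq_integrable (integrableZl measurableT 2 (integrable_abse iF)).
  have A3 : {ae mu, forall x (n : nat), setT x ->
      (`|(F x * atan (n%:R * (g x - c)))%:E| <= (2 * `|F x|)%:E)%E}.
    apply/nearW => x n _; rewrite /= lee_fin normrM mulrC ler_wpM2r//.
    rewrite ler_norml; have := atan_gtNpi2 (n%:R * (g x - c)).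
    have := atan_ltpi2 (n%:R * (g x - c)); have := @pihalf_lt2 R.
    by move=> h1 h2 h3; apply/andP; split; lra.
  have [_ _ H] := dc A1 A2 A3.
  have : (fun n => \int[mu]_x (F x * atan (n%:R * (g x - c)))%:E)%E = cst 0%E.
    by apply/funext => k; exact: Fk.
  move: H => /[swap] ->.
  by move=> /(cvg_unique (@ereal_hausdorff R) (cvg_cst _)) <-.
have pi0 : pi != 0 :> R by rewrite gt_eqF// pi_gt0.
have ih : mu.-integrable setT (EFin \o h).
  apply: (le_integrable measurableT (g := fun x => (2 * F x)%:E)).
  - exact/measurable_EFinP.
  - move=> x _; rewrite /= lee_fin /h !normrM mulrC ler_wpM2r// (ger0_norm (@ler0n _ 2)).
    rewrite normr_sg [`|pi|]ger0_norm ?pi_ge0// [`|_^-1|]ger0_norm ?invr_ge0//.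
    by have := @pihalf_lt2 R; case: (_ != 0) => /= h0; rewrite ?mulr1 ?mulr0// ltW.
  - by apply: eq_integrable (integrableZl measurableT 2 iF).
have ih' : (\int[mu]_x ((F x)%:E + (2 / pi)%:E * (h x)%:E) = 0)%E.
  rewrite integralD//; last exact: integrableZl.
  by rewrite integralZl// F0 ih0 mule0 adde0.
rewrite integral_mkcond; apply/eqP.
have -> : (\int[mu]_x ((fun x => (F x)%:E) \_ (g @^-1` `]c, +oo[)) x =
    \int[mu]_x ((2^-1)%:E * ((F x)%:E + (2 / pi)%:E * (h x)%:E)))%E.
  apply: ae_eq_integral => //.
  - by apply/(measurable_restrictT _ mS); exact: measurable_funTS.
  - apply: emeasurable_funM => //; apply: emeasurable_funD => //.
    by apply: emeasurable_funM => //; exact/measurable_EFinP.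
  exists (g @^-1` [set c]); split => // x /= xg; apply: contrapT => gxc; apply: xg => _.
  rewrite /patch; case: ifPn => [/set_mem|/negP]; last rewrite inE.
    rewrite /= in_itv /= andbT -subr_gt0 => gc.
    transitivity (2^-1 * (F x + 2 / pi * h x))%:E; last by rewrite EFinM EFinD EFinM.
    congr EFin; rewrite /h gtr0_sg//.
    by clear -pi0; move: (pi : R) (F x) pi0 => t y t0; field.
  rewrite /= in_itv /= andbT => /negP; rewrite -leNgt => gc.
  have {}gc : g x - c < 0 by rewrite subr_lt0 lt_neqAle gc andbT; apply/eqP => /gxc.
  transitivity (2^-1 * (F x + 2 / pi * h x))%:E; last by rewrite EFinM EFinD EFinM.
    congr EFin; rewrite /h ltr0_sg//.
  by clear -pi0; move: (pi : R) (F x) pi0 => t y t0; field.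
rewrite integralZl ?ih' ?mule0//.
by apply: integrableD => //; exact: integrableZl.
Qed.

(** Measurable rectangles generate the product sigma-algebra. *)
Lemma integral_zero_rectangles d1 d2 (T1 : measurableType d1) (T2 : measurableType d2)
    (R : realType) (mu : {measure set (T1 * T2) -> \bar R}) (f : T1 * T2 -> \bar R) :
  mu.-integrable setT f ->
  (forall A B, measurable A -> measurable B ->
    (\int[mu]_(x in A `*` B) f x = 0)%E) ->
  ae_eq mu setT f (cst 0%E).
Proof.
move=> fi f0.
pose H := [set S : set (T1 * T2) | measurable S /\ (\int[mu]_(x in S) f x = 0)%E].
have lH : lambda_system setT H.
  apply/dynkin_lambda_system/dynkin_integral_zero => //.
  by rewrite -setXTT; exact: f0.
apply: integral_ae_eq => // S _ mS.
suff : H S by move=> [_ ->]; rewrite integral0.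
move: mS; rewrite measurable_prod_measurableType; apply: lambda_system_subset => //.
  move=> _ _ [A1 mA1 [B1 mB1 <-]] [A2 mA2 [B2 mB2 <-]].
  exists (A1 `&` A2); first exact: measurableI.
  exists (B1 `&` B2); first exact: measurableI.
  by rewrite setXI.
move=> _ [A mA [B mB <-]]; split; first exact: measurableX.
exact: f0.
Qed.

Section GradientUniqueness.
Variable R : realType.
Local Notation mu1 := (@lebesgue_measure R).
Local Notation mu := (mu2 R).

Lemma is_derive_fst (a : R -> R) (x : plane R) l : is_derive (x.1 : R) 1 a l ->
  is_derive x (e_1 R) (fun x : plane R => a x.1) l.
Proof.
move=> [d <-].
have E : (fun h : R => h^-1 *: (((fun x : plane R => a x.1) \o shift x) (h *: e_1 R) - a x.1))
   = (fun h : R => h^-1 *: ((a \o shift x.1) (h *: 1) - a x.1)) by [].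
by split; rewrite /derivable /derive ?E.
Qed.

Lemma is_derive_snd (a : R -> R) (x : plane R) l : is_derive (x.2 : R) 1 a l ->
  is_derive x (e_2 R) (fun x : plane R => a x.2) l.
Proof.
move=> [d <-].
have E : (fun h : R => h^-1 *: (((fun x : plane R => a x.2) \o shift x) (h *: e_2 R) - a x.2))
   = (fun h : R => h^-1 *: ((a \o shift x.2) (h *: 1) - a x.2)) by [].
by split; rewrite /derivable /derive ?E.
Qed.

Lemma continuous_fst_comp (a : R -> R) : continuous a ->
  continuous (fun x : plane R => a x.1).
Proof.
move=> ca x; have h : fst z @[z --> x] --> x.1.
  move=> A /nbhs_ballP[e /= e0 hA]; apply/nbhs_box; exists e => // y h1 _.
  by apply: hA; rewrite -ball_normE /ball_ /= distrC.
exact: cvg_comp h (ca x.1).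
Qed.

Lemma continuous_snd_comp (a : R -> R) : continuous a ->
  continuous (fun x : plane R => a x.2).
Proof.
move=> ca x; have h : snd z @[z --> x] --> x.2.
  move=> A /nbhs_ballP[e /= e0 hA]; apply/nbhs_box; exists e => // y _ h1.
  by apply: hA; rewrite -ball_normE /ball_ /= distrC.
exact: cvg_comp h (ca x.2).
Qed.

Lemma null_vertical (c : R) : mu (fst @^-1` [set c]) = 0%E.
Proof.
have -> : fst @^-1` [set c] = [set c] `*` [set: R] :> set (mplane R).
  by apply/seteqP; split => [x /= ->|x []].
rewrite product_measure1E; [|exact: measurable_set1|exact: measurableT].
by rewrite [X in (X * _)%E](lebesgue_measure_set1 c) mul0e.
Qed.

Lemma null_horizontal (c : R) : mu (snd @^-1` [set c]) = 0%E.
Proof.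
have -> : snd @^-1` [set c] = [set: R] `*` [set c] :> set (mplane R).
  by apply/seteqP; split => [x /= ->|x []].
rewrite product_measure1E; [|exact: measurableT|exact: measurable_set1].
by rewrite [X in (_ * X)%E](lebesgue_measure_set1 c) mule0.
Qed.

(** The coordinates of the plane are the intended g and g'; they are abstracted
so that the two may be exchanged. *)
Lemma integral_zero_product (F : mplane R -> R) (g g' : mplane R -> measurableTypeR R) :
  mu.-integrable setT (EFin \o F) ->
  measurable_fun setT g -> measurable_fun setT g' ->
  (forall c, mu (g @^-1` [set c]) = 0%E) ->
  (forall B, measurable B -> \int[mu]_x (F x * \1_B (g' x))%:E = 0)%E ->
  (forall B c (k : nat), measurable B ->
    \int[mu]_x (F x * \1_B (g' x) * atan (k%:R * (g x - c)))%:E = 0)%E ->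
  forall A B, measurable A -> measurable B ->
  (\int[mu]_(x in g @^-1` A `&` g' @^-1` B) (F x)%:E = 0)%E.
Proof.
move=> iF mg mg' gc F0 Fk A B mA mB.
have mF := measurable_int _ iF.
have mF' : measurable_fun setT F by exact/measurable_EFinP.
pose F1 x := F x * \1_B (g' x).
have m1 : measurable_fun setT (fun x => \1_B (g' x) : R).
  by apply: measurableT_comp => //; exact: measurable_indic.
have mF1 : measurable_fun setT F1 by exact: measurable_funM.
have iF1 : mu.-integrable setT (EFin \o F1).
  apply: le_integrable iF => //; first exact/measurable_EFinP.
  move=> x _; rewrite /= lee_fin /F1 normrM -[leRHS]mulr1 ler_wpM2l//.
  by rewrite indicE; case: (_ \in _); rewrite ?normr0 ?normr1.
have mB' : measurable (g' @^-1` B).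
  by rewrite -[X in measurable X]setTI; exact: mg'.
rewrite integral_mkcondr.
rewrite (eq_integral (EFin \o F1)); last first.
  move=> x _; rewrite /patch /F1 /= indicE.
  have -> : (x \in g' @^-1` B) = (g' x \in B) by apply/idP/idP; rewrite !inE.
  by case: ifP; rewrite ?mulr1 ?mulr0.
apply: integral_zero_rays mA => //; first exact: F0.
move=> c; apply: integral_zero_atan (gc c) (F0 B mB) _ => //.
by move=> k; exact: Fk.
Qed.

Variables (Om : set (mplane R)).
Hypotheses (mOm : measurable Om) (Omfin : (mu2 R Om < +oo)%E).

(** The multiplier a(x1) b(x2) neither vanishes at the boundary of Om nor is
smooth in x2. It may be used nevertheless: test functions already vanish near
the boundary, so that the identity holds for them by [ibp1], and it extends
to W^{1,q}_0 by [W10_density]. *)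
Lemma W10_ibp1 (q : R) v (a a' b : R -> R) (C : R) : 1 < q -> W10 Om q v ->
  continuous a' -> (forall t : R, is_derive t 1 a (a' t)) ->
  (forall t, [/\ `|a t| <= C, `|a' t| <= C & `|b t| <= C]) -> measurable_fun setT b ->
  \int[mu]_(x in Om) ((v.2 x).1 * (a x.1 * b x.2)) =
  - \int[mu]_(x in Om) (v.1 x * (a' x.1 * b x.2)).
Proof.
move=> q1 Wv ca' da bC mb; have ca := is_derive_continuous da.
have C0 : 0 <= C by have [+ _ _] := bC 0; apply: le_trans.
pose p := q / (q - 1).
have q10 : 0 < q - 1 by rewrite subr_gt0.
have q0 : 0 < q by exact: lt_trans q1.
have p1 : 1 < p by rewrite /p ltr_pdivlMr// mul1r gtrBl.
have pq : p^-1 + q^-1 = 1.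
  by rewrite /p invf_div -{2}(mul1r q^-1) -mulrDl subrK mulfV// gt_eqF.
have mb2 := measurable_snd_comp mb.
have ma1 := continuous_measurable_plane (continuous_fst_comp ca).
have ma1' := continuous_measurable_plane (continuous_fst_comp ca').
have L (f : mplane R -> R) : measurable_fun setT f -> (forall x, `|f x| <= C * C) -> Lp Om p f.
  move=> mf fC; apply: (@Lp_bounded _ _ _ _ (C * C)) => //; first exact: ltW.
  exact: measurable_funTS.
pose H x : plane R := (a x.1 * b x.2, 0).
pose h x := a' x.1 * b x.2.
have HH : Lpv Om p H.
  split; last by apply: Lp0; exact: ltW.
  apply: L; first exact: measurable_funM.
  by move=> x; rewrite normrM ler_pM//; [have [] := bC x.1|have [] := bC x.2].
have hh : Lp Om p h.
  apply: L; first exact: measurable_funM.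
  by move=> x; rewrite normrM ler_pM//; [have [] := bC x.1|have [] := bC x.2].
have tst phi : test_function Om phi ->
    \int[mu]_(x in Om) dot (H x) (grad phi x) + \int[mu]_(x in Om) (h x * phi x) = 0.
  move=> /test_functionP[d1 [d2 [-> _ _ [c0 c1 c2 e1 e2] [K [cK KOm phi0]]]]].
  have [M M0 hM] := supp_off_box cK phi0.
  have phi0' x : off_box M x -> phi x = 0 by move=> /hM[].
  have off x : ~ Om x -> vanish_at phi d1 d2 x by move=> hx; apply: phi0 => /KOm.
  rewrite (@Rintegral_off _ Om); last first.
    by move=> x /off[_ h1 _]; rewrite /dot /= h1 mul0r mulr0 addr0.
  rewrite (@Rintegral_off _ Om); last by move=> x /off[h1 _ _]; rewrite h1 mulr0.
  have bC' t : `|b t| <= C by have [] := bC t.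
  have := ibp1 (ltW M0) phi0' c0 c1 e1 (continuous_fst_comp ca) (continuous_fst_comp ca')
    (fun x => is_derive_fst (da x.1)) mb bC'.
  move/eqP; rewrite -addr_eq0 addrC => /eqP <-; congr (_ + _); apply: eq_Rintegral => x _.
    by rewrite /dot /H /=; ring.
  by rewrite /h; ring.
have := W10_density mOm Omfin p1 q1 pq HH hh tst Wv => /eqP; rewrite addr_eq0 => /eqP E.
transitivity (\int[mu]_(x in Om) dot (H x) (v.2 x)).
  by apply: eq_Rintegral => x _; rewrite /dot /H /=; ring.
by rewrite E; congr (- _); apply: eq_Rintegral => x _; rewrite /h mulrC.
Qed.

Lemma W10_ibp2 (q : R) v (a a' b : R -> R) (C : R) : 1 < q -> W10 Om q v ->
  continuous a' -> (forall t : R, is_derive t 1 a (a' t)) ->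
  (forall t, [/\ `|a t| <= C, `|a' t| <= C & `|b t| <= C]) -> measurable_fun setT b ->
  \int[mu]_(x in Om) ((v.2 x).2 * (a x.2 * b x.1)) =
  - \int[mu]_(x in Om) (v.1 x * (a' x.2 * b x.1)).
Proof.
move=> q1 Wv ca' da bC mb; have ca := is_derive_continuous da.
have C0 : 0 <= C by have [+ _ _] := bC 0; apply: le_trans.
pose p := q / (q - 1).
have q10 : 0 < q - 1 by rewrite subr_gt0.
have q0 : 0 < q by exact: lt_trans q1.
have p1 : 1 < p by rewrite /p ltr_pdivlMr// mul1r gtrBl.
have pq : p^-1 + q^-1 = 1.
  by rewrite /p invf_div -{2}(mul1r q^-1) -mulrDl subrK mulfV// gt_eqF.
have mb2 := measurable_fst_comp mb.
have ma1 := continuous_measurable_plane (continuous_snd_comp ca).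
have ma1' := continuous_measurable_plane (continuous_snd_comp ca').
have L (f : mplane R -> R) : measurable_fun setT f -> (forall x, `|f x| <= C * C) -> Lp Om p f.
  move=> mf fC; apply: (@Lp_bounded _ _ _ _ (C * C)) => //; first exact: ltW.
  exact: measurable_funTS.
pose H x : plane R := (0, a x.2 * b x.1).
pose h x := a' x.2 * b x.1.
have HH : Lpv Om p H.
  split; first by apply: Lp0; exact: ltW.
  apply: L; first exact: measurable_funM.
  by move=> x; rewrite normrM ler_pM//; [have [] := bC x.2|have [] := bC x.1].
have hh : Lp Om p h.
  apply: L; first exact: measurable_funM.
  by move=> x; rewrite normrM ler_pM//; [have [] := bC x.2|have [] := bC x.1].
have tst phi : test_function Om phi ->
    \int[mu]_(x in Om) dot (H x) (grad phi x) + \int[mu]_(x in Om) (h x * phi x) = 0.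
  move=> /test_functionP[d1 [d2 [-> _ _ [c0 c1 c2 e1 e2] [K [cK KOm phi0]]]]].
  have [M M0 hM] := supp_off_box cK phi0.
  have phi0' x : off_box M x -> phi x = 0 by move=> /hM[].
  have off x : ~ Om x -> vanish_at phi d1 d2 x by move=> hx; apply: phi0 => /KOm.
  rewrite (@Rintegral_off _ Om); last first.
    by move=> x /off[_ _ h1]; rewrite /dot /= h1 mul0r mulr0 addr0.
  rewrite (@Rintegral_off _ Om); last by move=> x /off[h1 _ _]; rewrite h1 mulr0.
  have bC' t : `|b t| <= C by have [] := bC t.
  have := ibp2 (ltW M0) phi0' c0 c2 e2 (continuous_snd_comp ca) (continuous_snd_comp ca')
    (fun x => is_derive_snd (da x.2)) mb bC'.
  move/eqP; rewrite -addr_eq0 addrC => /eqP <-; congr (_ + _); apply: eq_Rintegral => x _.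
    by rewrite /dot /H /=; ring.
  by rewrite /h; ring.
have := W10_density mOm Omfin p1 q1 pq HH hh tst Wv => /eqP; rewrite addr_eq0 => /eqP E.
transitivity (\int[mu]_(x in Om) dot (H x) (v.2 x)).
  by apply: eq_Rintegral => x _; rewrite /dot /H /=; ring.
by rewrite E; congr (- _); apply: eq_Rintegral => x _; rewrite /h mulrC.
Qed.

Lemma Lp_integrable (q : R) (f : mplane R -> R) : 1 <= q -> Lp Om q f ->
  mu.-integrable Om (EFin \o f).
Proof.
move=> q1 /(Lp_sub mOm Omfin (lexx 1) q1).
rewrite /Lp /= => /Lfun1_integrable; rewrite -restrict_EFin.
exact: (integrable_mkcond (mu := mu) (EFin \o f) mOm).2.
Qed.

Lemma LpM_integrable (q M : R) (f k : mplane R -> R) : 1 <= q -> Lp Om q f ->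
  measurable_fun Om k -> (forall x, `|k x| <= M) ->
  mu.-integrable Om (EFin \o (fun x => f x * k x)).
Proof.
move=> q1 fq mk kM; rewrite (_ : (fun x => f x * k x) = k \* f); last first.
  by apply/funext => x /=; rewrite mulrC.
apply: (Lp_integrable q1); apply: (@LpM_bounded _ _ _ _ _ M) => //.
exact/nearW.
Qed.

(** The values of the coordinates g and g' are tested by smooth a and by bounded
measurable b, as in [W10_ibp1]. *)
Definition separated_tests_vanish (D : mplane R -> R) (g g' : mplane R -> R) :=
  forall (a a' b : R -> R) (C : R), continuous a' ->
    (forall t : R, is_derive t 1 a (a' t)) ->
    (forall t, [/\ `|a t| <= C, `|a' t| <= C & `|b t| <= C]) -> measurable_fun setT b ->
    \int[mu]_(x in Om) (D x * (a (g x) * b (g' x))) = 0.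

(** Choose b = 1_B, and for a the constant 1 and the functions atan (k (t - c)). *)
Lemma separated_tests_rectangles (q : R) (D : mplane R -> R)
    (g g' : mplane R -> measurableTypeR R) : 1 <= q -> Lp Om q D ->
  measurable_fun setT g -> measurable_fun setT g' ->
  (forall c, mu (g @^-1` [set c]) = 0%E) ->
  separated_tests_vanish D g g' -> forall A B, measurable A -> measurable B ->
  (\int[mu]_(x in g @^-1` A `&` g' @^-1` B) ((D \_ Om) x)%:E = 0)%E.
Proof.
move=> q1 Dq mg mg' gc hD.
have iD := Lp_integrable q1 Dq.
have iD' : mu.-integrable setT (EFin \o (D \_ Om)).
  rewrite -restrict_EFin.
  exact: (integrable_mkcond (mu := mu) (EFin \o D) mOm).1.
have RE (k : mplane R -> R) (M : R) : measurable_fun Om k -> (forall x, `|k x| <= M) ->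
    \int[mu]_(x in Om) (D x * k x) = 0 ->
    (\int[mu]_x ((D \_ Om) x * k x)%:E = 0)%E.
  move=> mk kM h; have ifk := LpM_integrable q1 Dq mk kM.
  have -> : (\int[mu]_x ((D \_ Om) x * k x)%:E = \int[mu]_(x in Om) (D x * k x)%:E)%E.
    rewrite [RHS]integral_mkcond; apply: eq_integral => x _; rewrite /patch.
    by case: ifP => //; rewrite mul0r.
  have := integrable_fin_num mOm ifk; move: h; rewrite /Rintegral /comp.
  by case: (\int[_]_(x in _) _)%E => //= r ->.
have B1 (B : set R) (t : R) : `|\1_B t : R| <= 1.
  by rewrite indicE; case: (_ \in _); rewrite ?normr0 ?normr1.
apply: integral_zero_product => // [B mB|B c k mB].
- apply: (RE _ 1) => //.
    by apply: measurable_funTS; apply: measurableT_comp => //; exact: measurable_indic.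
  have := hD (cst 1) (cst 0) \1_B 1.
  under eq_Rintegral do rewrite mul1r.
  apply; last exact: measurable_indic.
  + by move=> t; exact: cvg_cst.
  + by move=> t; rewrite normr1 normr0 ler01 lexx; split.
- under eq_integral do rewrite -mulrA.
  have cT : continuous (fun t : R => 1 + (k%:R * (t - c)) ^+ 2).
    move=> t; apply: cvgD; first exact: cvg_cst.
    by apply: cvgM; (apply: cvgM; [exact: cvg_cst|apply: cvgB; [exact: cvg_id|exact: cvg_cst]]).
  have T1 (t : R) : 1 <= 1 + (k%:R * (t - c)) ^+ 2 by rewrite lerDl sqr_ge0.
  pose a (t : R) := atan (k%:R * (t - c)).
  pose a' (t : R) := k%:R * (1 + (k%:R * (t - c)) ^+ 2)^-1.
  have aC (t : R) : `|a t| <= 2 + k%:R.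
    have := atan_gtNpi2 (k%:R * (t - c)); have := atan_ltpi2 (k%:R * (t - c)).
    have := @pihalf_lt2 R; have := @ler0n R k; rewrite /a => h1 h2 h3 h4.
    by rewrite ler_norml; apply/andP; split; lra.
  have ca : continuous a.
    move=> t; apply: (@cvg_comp _ _ _ (fun t => k%:R * (t - c)) (@atan R)).
      by apply: cvgM; [exact: cvg_cst|apply: cvgB; [exact: cvg_id|exact: cvg_cst]].
    exact: continuous_atan.
  apply: (RE _ ((2 + k%:R) * 1)).
  + apply: measurable_funTS; apply: measurable_funM.
      by apply: measurableT_comp => //; exact: measurable_indic.
    by apply: (measurableT_comp (f := a)) => //; exact: continuous_measurable_fun.
  + by move=> x; rewrite mulrC normrM; apply: ler_pM => //; exact: aC.
  + have := hD a a' \1_B (2 + k%:R).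
    under eq_Rintegral do rewrite [X in _ * X]mulrC.
    apply; last exact: measurable_indic.
    * move=> t; apply: cvgM; first exact: cvg_cst.
      apply: cvgV; last exact: cT.
      by rewrite gt_eqF// (lt_le_trans ltr01)// T1.
    * move=> t; rewrite /a' mulrC.
      apply: (@is_derive1_comp _ (@atan R) (fun t => k%:R * (t - c))).
      have h : is_derive t 1 (k%:R *: (id - cst c) : R -> R) (k%:R *: (1 - 0) : R).
        by apply: is_deriveZ.
      have E : k%:R *: (1 - 0) = k%:R :> R by rewrite subr0 /GRing.scale /= mulr1.
      by rewrite E in h.
    * move=> t; split; first exact: aC.
        rewrite /a' normrM ger0_norm// normfV ger0_norm; last exact: le_trans (T1 t).
        rewrite (@le_trans _ _ k%:R) ?lerDr//.
        by rewrite ler_piMr// invf_le1 ?T1// (lt_le_trans ltr01)// T1.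
      by rewrite (le_trans (B1 _ _))//; have := @ler0n R k; lra.
Qed.

Lemma Lp_restrict_ae0 (q : R) (D : mplane R -> R) : 1 <= q -> Lp Om q D ->
  (forall A B, measurable A -> measurable B ->
    (\int[mu]_(x in A `*` B) ((D \_ Om) x)%:E = 0)%E) ->
  {ae mu, forall x, Om x -> D x = 0}.
Proof.
move=> q1 Dq h.
have iD' : mu.-integrable setT (EFin \o (D \_ Om)).
  rewrite -restrict_EFin.
  exact: (integrable_mkcond (mu := mu) (EFin \o D) mOm).1 (Lp_integrable q1 Dq).
have := integral_zero_rectangles iD' h; apply: filterS => x /(_ I) /=.
by rewrite /patch => + Omx; rewrite mem_set// => -[].
Qed.

(** Integration by parts shows that the difference of the two gradients is
orthogonal to all multipliers a(x1) b(x2), hence to the indicators of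
rectangles, hence zero. This avoids approximating indicators by compactly
supported test functions inside Om. *)
Lemma W10_gradient_unique (q : R) v v' : 1 < q -> W10 Om q v -> W10 Om q v' ->
  {ae mu, forall x, Om x -> v.1 x = v'.1 x} ->
  {ae mu, forall x, Om x -> v.2 x = v'.2 x}.
Proof.
move=> q1 Wv Wv' vv'; have q1' := ltW q1.
have [[v1 [v21 v22] _] _] := Wv; have [[v1' [v21' v22'] _] _] := Wv'.
have key (f f' h h' : mplane R -> R) (k k' : mplane R -> R) (M : R) :
    Lp Om q f -> Lp Om q f' -> Lp Om q h -> Lp Om q h' ->
    {ae mu, forall x, Om x -> h x = h' x} ->
    measurable_fun Om k -> measurable_fun Om k' ->
    (forall x, `|k x| <= M) -> (forall x, `|k' x| <= M) ->
    \int[mu]_(x in Om) (f x * k x) = - (\int[mu]_(x in Om) (h x * k' x))%R ->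
    \int[mu]_(x in Om) (f' x * k x) = - (\int[mu]_(x in Om) (h' x * k' x))%R ->
    \int[mu]_(x in Om) ((f x - f' x) * k x) = 0.
  move=> fq fq' hq hq' hh' mk mk' kM kM' E E'.
  have i := LpM_integrable q1' fq mk kM; have i' := LpM_integrable q1' fq' mk kM.
  under eq_Rintegral do rewrite mulrBl.
  rewrite (RintegralB mOm i i') E E' opprK addrC; apply/eqP; rewrite subr_eq0; apply/eqP.
  have j := LpM_integrable q1' hq mk' kM'; have j' := LpM_integrable q1' hq' mk' kM'.
  rewrite /Rintegral; congr fine; apply: ae_eq_integral mOm _ _ _.
  - exact: measurable_int j'.
  - exact: measurable_int j.
  - by apply: filterS hh' => x hh' /hh' ->.
have z1 : {ae mu, forall x, Om x -> (v.2 x).1 - (v'.2 x).1 = 0}.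
  apply: (@Lp_restrict_ae0 q) => //; first exact: LpB.
  apply: (@separated_tests_rectangles q _ fst snd) => //; first exact: LpB.
    exact: null_vertical.
  move=> a a' b C ca' da bC mb; have ca := is_derive_continuous da.
  have ma := continuous_measurable_plane (continuous_fst_comp ca).
  have ma' := continuous_measurable_plane (continuous_fst_comp ca').
  have mb2 := measurable_snd_comp mb.
  apply: (key _ _ v.1 v'.1 _ (fun x => a' x.1 * b x.2) (C * C)) => //.
  - by apply: measurable_funTS; exact: measurable_funM.
  - by apply: measurable_funTS; exact: measurable_funM.
  - by move=> x; rewrite normrM ler_pM//; [have [] := bC x.1|have [] := bC x.2].
  - by move=> x; rewrite normrM ler_pM//; [have [] := bC x.1|have [] := bC x.2].
  - exact: (W10_ibp1 q1 Wv ca' da bC mb).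
  - exact: (W10_ibp1 q1 Wv' ca' da bC mb).
have z2 : {ae mu, forall x, Om x -> (v.2 x).2 - (v'.2 x).2 = 0}.
  apply: (@Lp_restrict_ae0 q) => //; first exact: LpB.
  move=> A B mA mB.
  have -> : A `*` B = snd @^-1` B `&` fst @^-1` A :> set (mplane R).
    by apply/seteqP; split => x [].
  move: B A mB mA.
  apply: (@separated_tests_rectangles q _ snd fst) => //; first exact: LpB.
    exact: null_horizontal.
  move=> a a' b C ca' da bC mb; have ca := is_derive_continuous da.
  have ma := continuous_measurable_plane (continuous_snd_comp ca).
  have ma' := continuous_measurable_plane (continuous_snd_comp ca').
  have mb2 := measurable_fst_comp mb.
  apply: (key _ _ v.1 v'.1 _ (fun x => a' x.2 * b x.1) (C * C)) => //.
  - by apply: measurable_funTS; exact: measurable_funM.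
  - by apply: measurable_funTS; exact: measurable_funM.
  - by move=> x; rewrite normrM ler_pM//; [have [] := bC x.2|have [] := bC x.1].
  - by move=> x; rewrite normrM ler_pM//; [have [] := bC x.2|have [] := bC x.1].
  - exact: (W10_ibp2 q1 Wv ca' da bC mb).
  - exact: (W10_ibp2 q1 Wv' ca' da bC mb).
apply: filterS2 z1 z2 => x z1 z2 Omx.
have /eqP := z1 Omx; have /eqP := z2 Omx; rewrite !subr_eq0 => /eqP E2 /eqP E1.
by rewrite [LHS]surjective_pairing [RHS]surjective_pairing E1 E2.
Qed.

End GradientUniqueness.

(** * The Dirac field: integrability and divergence *)

Section OneDimensional.
Variable R : realType.
Local Notation mu1 := (@lebesgue_measure R).

Lemma is_derive_cvg (f : R -> R) (x l : R) :
  h^-1 * (f (x + h) - f x) @[h --> 0^'] --> l -> is_derive x 1 f l.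
Proof.
move=> h.
have E : (fun h : R => h^-1 *: ((f \o shift x) (h *: (1 : R)) - f x)) =
    (fun h : R => h^-1 * (f (x + h) - f x)).
  apply/funext => t; congr (_ * (f _ - _)).
  by rewrite /= addrC -[t *: 1]/(t * 1) mulr1.
by split; rewrite /derivable /derive E; [exact: cvgP h|exact: cvg_lim h].
Qed.

Lemma mean_value (f f' : R -> R) : (forall t : R, is_derive t 1 f (f' t)) ->
  forall a b, exists2 c, `|c - a| <= `|b - a| & f b - f a = f' c * (b - a).
Proof.
move=> df a b; have cf := is_derive_continuous df.
have aux (u v : R) : u < v -> exists2 c, u < c < v & f v - f u = f' c * (v - u).
  move=> uv; have [c] := MVT uv (fun x _ => df x) (continuous_subspaceT cf).
  by rewrite in_itv /= => cuv E; exists c.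
case: (ltgtP a b) => [ab|ba|->]; last by exists b; rewrite ?subrr ?mulr0.
- have [c /andP[c1 c2] E] := aux _ _ ab; exists c => //.
  by rewrite !ger0_norm ?subr_ge0 ?lerD2r ?ltW.
- have [c /andP[c1 c2] E] := aux _ _ ba; exists c.
    by rewrite !ler0_norm ?subr_le0 ?lerN2 ?lerD2r ?ltW.
  by rewrite -[LHS]opprB E -mulrN opprB.
Qed.

(** The chain rule along a line, for which continuous partial derivatives are
enough: increments are taken parallel to one axis at a time. *)
Lemma is_derive_ray (phi phi1 phi2 : plane R -> R) (c : plane R) (tau s : R) :
  C1 phi phi1 phi2 ->
  is_derive s 1 (fun s => phi (s, c.2 + (s - c.1) * tau))
    (phi1 (s, c.2 + (s - c.1) * tau) + tau * phi2 (s, c.2 + (s - c.1) * tau)).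
Proof.
move=> [c0 c1 c2 d1 d2]; apply: is_derive_cvg.
set y := c.2 + (s - c.1) * tau.
apply/cvgrPdist_le => e e0.
(* The derivative is phi1 + tau phi2: an error of this size in both partial
derivatives adds up to e. *)
have e20 : 0 < e / (1 + `|tau|) by rewrite divr_gt0// ltr_wpDr.
have /nbhs_box[d11 d11p h1] : nbhs (s, y) [set z | `|phi1 z - phi1 (s, y)| <= e / (1 + `|tau|)].
  by have /cvgrPdist_le/(_ _ e20) := c1 (s, y); apply: filterS => z; rewrite distrC.
have /nbhs_box[d22 d22p h2] : nbhs (s, y) [set z | `|phi2 z - phi2 (s, y)| <= e / (1 + `|tau|)].
  by have /cvgrPdist_le/(_ _ e20) := c2 (s, y); apply: filterS => z; rewrite distrC.
pose d := Num.min d11 d22 / (1 + `|tau|).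
have m0 : 0 < Num.min d11 d22 by rewrite lt_min d11p.
have t1 : 1 <= 1 + `|tau| by rewrite lerDl.
have t0 : 0 < 1 + `|tau| by rewrite ltr_wpDr.
have d0 : 0 < d by rewrite divr_gt0.
have dm : d <= Num.min d11 d22 by rewrite ler_pdivrMr// ler_peMr// ltW.
near=> h.
have hn0 : h != 0 by near: h; exact: nbhs_dnbhs_neq.
have hd : `|h| < d by near: h; apply: dnbhs0_lt.
have [x1 x1h E1] := mean_value (fun t => is_derive_slice1 (d1 (t, y + h * tau))) s (s + h).
have [x2 x2h E2] := mean_value (fun t => is_derive_slice2 (d2 (s, t))) y (y + h * tau).
have {}x1h : `|x1 - s| <= `|h| by move: x1h; rewrite addrAC subrr add0r.
have {}x2h : `|x2 - y| <= `|h * tau| by move: x2h; rewrite addrAC subrr add0r.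
have ht : `|h * tau| < Num.min d11 d22.
  rewrite normrM (@le_lt_trans _ _ (`|h| * (1 + `|tau|)))//.
    by rewrite ler_wpM2l// lerDr.
  by rewrite -ltr_pdivlMr.
have hm : `|h| < Num.min d11 d22 by exact: lt_le_trans dm.
have -> : c.2 + (s + h - c.1) * tau = y + h * tau by rewrite /y; ring.
have -> : phi (s + h, y + h * tau) - phi (s, y) =
    h * (phi1 (x1, y + h * tau) + tau * phi2 (s, x2)).
  transitivity ((phi (s + h, y + h * tau) - phi (s, y + h * tau))
    + (phi (s, y + h * tau) - phi (s, y))); first by ring.
  by rewrite E1 E2; ring.
rewrite mulKf//.
have B1 : `|phi1 (x1, y + h * tau) - phi1 (s, y)| <= e / (1 + `|tau|).
  apply: h1 => /=; first by rewrite (le_lt_trans x1h)// (lt_le_trans hm)// ge_min lexx.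
  by rewrite addrAC subrr add0r (lt_le_trans ht)// ge_min lexx.
have B2 : `|phi2 (s, x2) - phi2 (s, y)| <= e / (1 + `|tau|).
  apply: h2 => /=; first by rewrite subrr normr0.
  by rewrite (le_lt_trans x2h)// (lt_le_trans ht)// ge_min lexx orbT.
rewrite distrC.
rewrite (_ : _ - _ = (phi1 (x1, y + h * tau) - phi1 (s, y))
  + tau * (phi2 (s, x2) - phi2 (s, y))); last by ring.
apply: le_trans (ler_normD _ _) _; rewrite normrM.
have T : `|tau| * `|phi2 (s, x2) - phi2 (s, y)| <= `|tau| * (e / (1 + `|tau|)).
  by rewrite ler_wpM2l.
apply: le_trans (lerD B1 T) _.
by rewrite -{1}(mul1r (e / _)) -mulrDl mulrCA mulfV ?mulr1// gt_eqF.
Unshelve. all: by end_near.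
Qed.

Lemma integral_affine_ge0 (G : R -> R) (a c : R) : 0 < a -> continuous G ->
  (forall x, 0 <= G x) ->
  (\int[mu1]_x (G x)%:E = \int[mu1]_x (a * G (c + a * x))%:E)%E.
Proof.
move=> a0 cG G0; pose F (x : R) := c + a * x.
have dF (x : R) : is_derive x 1 F a.
  apply: is_derive_cvg; apply: cvg_near_cst; near=> h.
  have hn0 : h != 0 by near: h; exact: nbhs_dnbhs_neq.
  by rewrite /F (_ : _ - _ = h * a) ?mulKf//; ring.
have F'E : F^`()%classic = cst a.
  by apply/funext => x; rewrite derive1E (@derive_val _ _ _ _ _ _ _ (dF x)).
rewrite (@increasing_ge0_integration_by_substitutionT _ F G)//.
- by apply: eq_integral => x _; rewrite /= F'E /F mulrC.
- by move=> x y xy; rewrite /F ltrD2l ltr_pM2l.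
- by rewrite F'E => x; exact: cvg_cst.
- by rewrite F'E; apply: cvgP; exact: cvg_cst.
- by rewrite F'E; apply: cvgP; exact: cvg_cst.
- apply/cvgrNyPle => M; have := nbhs_ninfty_le (num_real (a^-1 * (M - c))).
  by apply: filterS => x xM; rewrite /F -lerBrDl -ler_pdivlMl.
- apply/cvgryPge => M; have := nbhs_pinfty_ge (num_real (a^-1 * (M - c))).
  by apply: filterS => x xM; rewrite /F -lerBlDl -ler_pdivrMl.
Unshelve. all: by end_near.
Qed.

(** The nonnegative case, applied to the positive and negative parts. *)
Lemma integral_affine (G : R -> R) (a c : R) : 0 < a -> continuous G ->
  (\int[mu1]_x (G x)%:E = \int[mu1]_x (a * G (c + a * x))%:E)%E.
Proof.
move=> a0 cG.
have cmax (g : R -> R) : continuous g -> continuous (fun x => Num.max (g x) 0).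
  by move=> cg x; apply: continuous_max; [exact: cg|exact: cvg_cst].
have cP := cmax _ cG.
have cN : continuous (fun x => Num.max (- G x) 0).
  by apply: cmax => x; apply: cvgN; exact: cG.
rewrite integralE [RHS]integralE; congr (_ - _)%E.
- transitivity (\int[mu1]_x (Num.max (G x) 0)%:E)%E.
    by apply: eq_integral => x _; rewrite funeposE /= -EFin_max.
  rewrite (integral_affine_ge0 c a0 cP); last by move=> x; rewrite le_max lexx orbT.
  by apply: eq_integral => x _; rewrite funeposE /= -EFin_max maxr_pMr ?mulr0// ltW.
- transitivity (\int[mu1]_x (Num.max (- G x) 0)%:E)%E.
    by apply: eq_integral => x _; rewrite funenegE /= -EFin_max.
  rewrite (integral_affine_ge0 c a0 cN); last by move=> x; rewrite le_max lexx orbT.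
  by apply: eq_integral => x _; rewrite funenegE /= -EFin_max maxr_pMr ?mulr0 ?mulrN// ltW.
Qed.

Lemma integral_arctan : (\int[mu1]_x ((1 + x ^+ 2)^-1)%:E = pi%:E)%E.
Proof.
rewrite ge0_symfun_integralT.
- have := integral0y_oneDsqr R.
  rewrite (_ : [set x : R | 0 <= x] = `[0, +oo[%classic); last first.
    by apply/seteqP; split => x; rewrite /= in_itv /= andbT.
  rewrite /oneDsqr => ->; rewrite -EFinM; congr EFin.
  by rewrite mulrC divfK.
- by move=> x; rewrite invr_ge0 addr_ge0// sqr_ge0.
- exact: continuous_oneDsqrV.
- by move=> x; rewrite /= sqrrN.
Qed.

End OneDimensional.

Section DiracFieldLp.
Variable R : realType.
Local Notation mu1 := (@lebesgue_measure R).
Local Notation mu := (mu2 R).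

Lemma measurable_power (c r : R) : measurable_fun setT (fun s : R => `|s - c| `^ r).
Proof.
apply: (@measurableT_comp _ _ _ _ _ _ (@powR R ^~ r)) => //.
by apply: measurableT_comp => //; exact: measurable_funB.
Qed.

(** The sign e says on which side of the singularity c the segment lies. *)
Lemma integral_power_segment (e c a b r : R) : e = 1 \/ e = -1 -> r < 1 -> a < b ->
  (forall s, a <= s <= b -> 0 < e * (s - c)) ->
  (\int[mu1]_(s in `[a, b]) (`|s - c| `^ (- r))%:E =
    (e * (e * (b - c)) `^ (1 - r) / (1 - r) - e * (e * (a - c)) `^ (1 - r) / (1 - r))%:E)%E.
Proof.
move=> he r1 ab pos; have r10 : 1 - r != 0 by rewrite subr_eq0 gt_eqF.
have e2 : e * e = 1 by case: he => ->; rewrite ?mulrNN mulr1.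
pose F s := e * (e * (s - c)) `^ (1 - r) / (1 - r).
have dpow (k s : R) : 0 < e * (s - c) ->
    is_derive s 1 (fun s => (e * (s - c)) `^ k) (k * (e * (s - c)) `^ (k - 1) * e).
  move=> s0; apply: (@is_derive1_comp _ (@powR R ^~ k) (fun s => e * (s - c))).
    exact: is_derive1_powR.
  have h : is_derive s 1 (e *: (id - cst c) : R -> R) (e *: (1 - 0) : R) by apply: is_deriveZ.
  have E : e *: (1 - 0) = e :> R by rewrite subr0 /GRing.scale /= mulr1.
  by rewrite E in h.
have dF s : 0 < e * (s - c) -> is_derive s 1 F ((e * (s - c)) `^ (- r)).
  move=> s0; have := is_deriveZ (e / (1 - r)) (dpow (1 - r) s s0).
  rewrite (_ : _ \*: _ = F); last first.
    by apply/funext => t; rewrite /F /GRing.scale /= mulrAC.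
  rewrite (_ : _ *: _ = (e * (s - c)) `^ (- r))//.
  rewrite (_ : 1 - r - 1 = - r); last by ring.
  rewrite /GRing.scale /=.
  move: ((e * (s - c)) `^ (- r)) (1 - r) r10 => X k k0.
  by rewrite -[RHS]mul1r -e2; field.
have cpow k s : 0 < e * (s - c) -> {for s, continuous (fun s => (e * (s - c)) `^ k)}.
  move=> s0; apply: differentiable_continuous; apply/derivable1_diffP.
  exact: (@ex_derive _ _ _ _ _ _ _ (dpow k s s0)).
have cF s : 0 < e * (s - c) -> {for s, continuous F}.
  move=> s0; apply: differentiable_continuous; apply/derivable1_diffP.
  exact: (@ex_derive _ _ _ _ _ _ _ (dF s s0)).
transitivity (\int[mu1]_(s in `[a, b]) ((e * (s - c)) `^ (- r))%:E)%E.
  apply: eq_integral => s; rewrite inE /= in_itv /= => /pos s0.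
  congr (_ `^ _)%:E; case: he s0 => ->; rewrite ?mul1r ?mulN1r.
    by move/gtr0_norm.
  by rewrite oppr_gt0 => /ltr0_norm.
rewrite (@continuous_FTC2 _ _ F)//.
- apply: continuous_in_subspaceT => s; rewrite inE /= in_itv /= => /pos; exact: cpow.
- split.
  + move=> s; rewrite in_itv /= => /andP[s1 s2].
    by apply: (@ex_derive _ _ _ _ _ _ _ (dF s _)); apply: pos; rewrite !ltW.
  + by apply/cvg_at_right_filter/cF/pos; rewrite lexx ltW.
  + by apply/cvg_at_left_filter/cF/pos; rewrite lexx ltW.
- move=> s; rewrite in_itv /= => /andP[s1 s2].
  have s0 : 0 < e * (s - c) by apply: pos; rewrite !ltW.
  by rewrite derive1E (@derive_val _ _ _ _ _ _ _ (dF s s0)).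
Qed.

(** Remove a segment of half-length d n around the singularity: the integrals over
the two remaining segments are bounded independently of n. *)
Lemma integral_power_fin (c N r : R) : 0 < N -> 0 < r < 1 ->
  (\int[mu1]_(s in `[(c - N)%R, (c + N)%R]) (`|s - c| `^ (- r))%:E < +oo)%E.
Proof.
move=> N0 /andP[r0 r1].
have r10 : 0 < 1 - r by rewrite subr_gt0.
(* n.+2 makes the removed segments strictly shorter than N from the start. *)
pose d (n : nat) : R := N / n.+2%:R.
have d0 n : 0 < d n by rewrite divr_gt0.
have dN n : d n < N by rewrite ltr_pdivrMr// ltr_pMr// ltr1n.
have dd n m : (n <= m)%N -> d m <= d n.
  by move=> nm; rewrite ler_pM2l// lef_pV2 ?posrE// ler_nat !ltnS.
pose A n : set (measurableTypeR R) := `[c - N, c - d n]%classic.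
pose B n : set (measurableTypeR R) := `[c + d n, c + N]%classic.
have mA n : measurable (A n) by exact: measurable_itv.
have mB n : measurable (B n) by exact: measurable_itv.
pose f (s : measurableTypeR R) := (`|s - c| `^ (- r))%:E.
have f0 s : (0 <= f s)%E by rewrite lee_fin powR_ge0.
have mf : measurable_fun setT f by apply/measurable_EFinP; exact: measurable_power.
pose K := N `^ (1 - r) / (1 - r).
have bnd n : (\int[mu1]_(s in A n `|` B n) f s <= (K + K)%:E)%E.
  rewrite ge0_integral_setU//; last 2 first.
  - exact: measurable_funTS.
  - apply/disj_setPS => s []; rewrite /A /B /= !in_itv /= => /andP[_ h1] /andP[h2 _].
    by have := d0 n => h3; lra.
  rewrite EFinD; apply: leeD.
    rewrite (@integral_power_segment (-1) c _ _ r)//; [|by right| |]; last 2 first.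
    - by rewrite ler_ltD// ltrN2.
    - by move=> s /andP[_ h]; have := d0 n => h3; lra.
    rewrite lee_fin /K !mulN1r !opprB !mulNr opprK addrC.
    rewrite (_ : c + (N - c) = N); last by ring.
    by rewrite gerBl// divr_ge0 ?powR_ge0// ltW.
  rewrite (@integral_power_segment 1 c _ _ r)//; [|by left| |]; last 2 first.
  - by rewrite ltrD2l.
  - by move=> s /andP[h _]; have := d0 n => h3; lra.
  rewrite lee_fin /K !mul1r (_ : c + N - c = N); last by ring.
  by rewrite gerBl// divr_ge0 ?powR_ge0// ltW.
have := @ge0_nondecreasing_set_cvg_integral _ _ _ (fun n => A n `|` B n) f mu1.
move=> /(_ _ (fun n => measurableU _ _ (mA n) (mB n)) _ _) cvgI.
have {}cvgI : (\int[mu1]_(s in A n `|` B n) f s @[n --> \oo] -->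
    \int[mu1]_(s in \bigcup_n (A n `|` B n)) f s)%E.
  apply: cvgI => //; last by move=> n; exact: measurable_funTS.
  move=> n m nm; rewrite /A /B subsetEset => s [] /=; rewrite !in_itv /= => /andP[h1 h2]; [left|right].
    by rewrite /= ?in_itv /= h1 (le_trans h2)// lerD2l lerN2 dd.
  by rewrite /= ?in_itv /= h2 andbT (le_trans _ h1)// lerD2l dd.
have lim : (\int[mu1]_(s in \bigcup_n (A n `|` B n)) f s <= (K + K)%:E)%E.
  rewrite -(cvg_lim _ cvgI)//; apply: lime_le; first by apply: cvgP; exact: cvgI.
  exact/nearW.
apply: le_lt_trans (ltry (K + K)); apply: le_trans lim.
rewrite [leLHS]integral_mkcond [leRHS]integral_mkcond.
apply: ae_le_integral => [s|s|]; rewrite ?/patch.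
- by case: ifP.
- by case: ifP.
apply/nearW => s; case: ifPn => [|_]; last by case: ifP.
rewrite inE /= in_itv /= => /andP[h1 h2].
have [->|sc] := eqVneq s c.
  rewrite subrr normr0 powR0 ?oppr_eq0 ?gt_eqF//.
  by case: ifP.
rewrite mem_set//.
have sc0 : 0 < `|s - c| by rewrite normr_gt0 subr_eq0.
pose n := Num.bound (N / `|s - c|).
have hn : d n <= `|s - c|.
  have := archi_boundP (divr_ge0 (ltW N0) (ltW sc0)).
  rewrite ltr_pdivrMr// => /ltW h; rewrite ler_pdivrMr// mulrC (le_trans h)//.
  by rewrite ler_pM2r// ler_nat /n leqW.
exists n => //; move: hn; rewrite ler_normr => /orP[] h; [right|left].
  by rewrite /A /B /= ?in_itv /=; apply/andP; split; lra.
by rewrite /A /B /= ?in_itv /=; apply/andP; split; lra.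
Qed.

(** With w^2 = u v one has u w <= u^2 + v^2. This bounds a function that is singular at
one point by a product of two functions of one variable each. *)
Lemma dirac_component_le (u v p : R) : 0 < u -> 0 < v -> 0 <= p ->
  (u / (u ^+ 2 + v ^+ 2)) `^ p <= u `^ (- (p / 2)) * v `^ (- (p / 2)).
Proof.
move=> u0 v0 p0; pose w := Num.sqrt (u * v).
have uv0 : 0 <= u * v by rewrite mulr_ge0 ?ltW.
have w0 : 0 < w by rewrite sqrtr_gt0 mulr_gt0.
have ww : w ^+ 2 = u * v by rewrite sqr_sqrtr.
have d0 : 0 < u ^+ 2 + v ^+ 2 by rewrite addr_gt0// exprn_gt0.
have h : u / (u ^+ 2 + v ^+ 2) <= w^-1.
  rewrite ler_pdivrMr// mulrC ler_pdivlMr//.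
  have := sqr_ge0 (u - w); have := sqr_ge0 (u - v); rewrite !sqrrB ww => h1 h2.
  by have := sqr_ge0 v; have := sqr_ge0 u => h3 h4; lra.
apply: (@le_trans _ _ (w^-1 `^ p)).
  rewrite ge0_ler_powR// nnegrE ?invr_ge0 ?(ltW w0)// divr_ge0// ltW//.
rewrite -powRM ?(ltW u0) ?(ltW v0)// -[w^-1](powR_inv1 (ltW w0)) /w -(powR12_sqrt uv0).
by rewrite -!powRrM (_ : 2^-1 * (-1 * p) = - (p / 2)) ?lexx//; lra.
Qed.

Lemma measurable_dirac_field (x0 : plane R) :
  measurable_fun setT (fun x : mplane R => (dirac_field x0 x).1) /\
  measurable_fun setT (fun x : mplane R => (dirac_field x0 x).2).
Proof.
have mX : measurable_fun setT (fun x : mplane R => x.1 - x0.1).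
  exact: measurable_funB.
have mY : measurable_fun setT (fun x : mplane R => x.2 - x0.2).
  exact: measurable_funB.
have mV : measurable_fun setT (fun x : mplane R => (enorm (x - x0) ^+ 2)^-1).
  under eq_fun do rewrite -powR_inv1 ?sqr_ge0// enorm_sqr /dot.
  apply: (@measurableT_comp _ _ _ _ _ _ (@powR R ^~ (-1))) => //.
  by apply: measurable_funD; apply: measurable_funM.
split; rewrite /dirac_field /=.
- by apply: measurable_funM => //; apply: measurable_funM.
- by apply: measurable_funM => //; apply: measurable_funM.
Qed.

(** With the preceding bound, Tonelli's theorem reduces integrability to that of
|s|^(-p/2) near 0 on the line, that is to p < 2. *)
Lemma dirac_field_Lp (x0 : plane R) (D : set (mplane R)) (M p : R) :
  0 < M -> 1 < p < 2 -> measurable D -> D `<=` box M ->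
  Lpv D p (dirac_field x0).
Proof.
move=> M0 /andP[p1 p2] mD DM; have p0 : 0 < p by exact: lt_trans p1.
have [m1 m2] := measurable_dirac_field x0.
pose r := p / 2; have r01 : 0 < r < 1.
  by rewrite divr_gt0//= ltr_pdivrMr// mul1r.
pose N := M + `|x0.1| + `|x0.2|.
have N0 : 0 < N by rewrite !ltr_wpDr.
have hN (c s : R) : `|c| <= `|x0.1| + `|x0.2| -> `|s| <= M -> c - N <= s <= c + N.
  rewrite -ler_distl /N => hc hs; rewrite (le_trans (ler_normB _ _))//.
  by rewrite -addrA lerD.
pose S c : set (measurableTypeR R) := `[c - N, c + N]%classic.
pose k c (s : measurableTypeR R) : \bar R := ((fun s => (`|s - c| `^ (- r))%:E) \_ (S c)) s.
have mS c : measurable (S c) by exact: measurable_itv.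
have mk c : measurable_fun setT (k c).
  apply/(measurable_restrictT _ (mS c)); apply: measurable_funTS.
  by apply/measurable_EFinP; exact: measurable_power.
have k0 c s : (0 <= k c s)%E by rewrite /k /patch; case: ifP; rewrite ?lee_fin ?powR_ge0.
have Ik c : (\int[mu1]_s k c s < +oo)%E.
  rewrite /k -integral_mkcond; exact: integral_power_fin.
have main : (\int[mu]_x (k x0.1 x.1 * k x0.2 x.2) < +oo)%E.
  rewrite (@fubini_tonelli1 _ _ _ _ _ mu1 mu1 (fun x => (k x0.1 x.1 * k x0.2 x.2)%E)); last 2 first.
  - by apply: emeasurable_funM; apply: (measurableT_comp (mk _)).
  - by move=> x; rewrite mule_ge0.
  rewrite /fubini_F /=.
  rewrite (eq_integral (fun s => (\int[mu1]_t k x0.2 t) * k x0.1 s)%E); last first.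
    move=> s _; rewrite ge0_integralZl//; exact: muleC.
  rewrite ge0_integralZl//; last exact: integral_ge0.
  by rewrite lte_mul_pinfty ?Ik// ?integral_ge0// ge0_fin_numE ?Ik// integral_ge0.
have pi1 : (2 * pi)^-1 <= 1 :> R.
  have := @pihalf_ge1 R => h; rewrite invf_le1; first by lra.
  by rewrite mulr_gt0// pi_gt0.
have pi0 : 0 <= (2 * pi)^-1 :> R by rewrite invr_ge0 mulr_ge0// pi_ge0.
have bound (f : mplane R -> R) : measurable_fun setT f ->
    (forall x, x.1 != x0.1 -> x.2 != x0.2 ->
      `|f x| `^ p <= `|x.1 - x0.1| `^ (- r) * `|x.2 - x0.2| `^ (- r)) ->
    Lp D p f.
  move=> mf fle; apply: Lp_int => //; first exact: measurable_funTS.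
  apply: le_lt_trans main; rewrite [leLHS]integral_mkcond.
  apply: ae_le_integral => [x|x|].
  - by rewrite /patch; case: ifP; rewrite // lee_fin powR_ge0.
  - by rewrite mule_ge0.
  have n1 : {ae mu, forall x : mplane R, x.1 != x0.1}.
    exists (fst @^-1` [set x0.1]); split; last by move=> x /= /negP/negPn/eqP.
      by rewrite -[X in measurable X]setTI; apply: measurable_fst => //; exact: measurable_set1.
    exact: null_vertical.
  have n2 : {ae mu, forall x : mplane R, x.2 != x0.2}.
    exists (snd @^-1` [set x0.2]); split; last by move=> x /= /negP/negPn/eqP.
      by rewrite -[X in measurable X]setTI; apply: measurable_snd => //; exact: measurable_set1.
    exact: null_horizontal.
  apply: filterS2 n1 n2 => x x1 x2; rewrite /patch.
  case: ifPn => [/set_mem Dx|_]; last by rewrite mule_ge0.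
  have /boxP[h1 h2] := DM _ Dx; rewrite /k /patch !mem_set ?lee_fin ?fle//=.
  - by rewrite /S /= in_itv /= hN// lerDr.
  - by rewrite /S /= in_itv /= hN// lerDl.
split; apply: bound => // x x1 x2.
- rewrite /dirac_field /= enorm_sqr /dot /= -!expr2.
  have u0 : 0 < `|x.1 - x0.1| by rewrite normr_gt0 subr_eq0.
  have v0 : 0 < `|x.2 - x0.2| by rewrite normr_gt0 subr_eq0.
  apply: le_trans (dirac_component_le u0 v0 (ltW p0)).
  rewrite ge0_ler_powR ?nnegrE ?(ltW p0)//.
  rewrite !real_normK ?num_real// normrM (ger0_norm pi0).
  rewrite normrM [`|_^-1|]ger0_norm ?invr_ge0 ?addr_ge0 ?sqr_ge0// [X in _ * X]mulrC.
  by rewrite ler_piMl// divr_ge0// addr_ge0 ?sqr_ge0.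
- rewrite /dirac_field /= enorm_sqr /dot /= -!expr2.
  have u0 : 0 < `|x.1 - x0.1| by rewrite normr_gt0 subr_eq0.
  have v0 : 0 < `|x.2 - x0.2| by rewrite normr_gt0 subr_eq0.
  rewrite [leRHS]mulrC; apply: le_trans (dirac_component_le v0 u0 (ltW p0)).
  rewrite ge0_ler_powR ?nnegrE ?(ltW p0)//.
  rewrite !real_normK ?num_real// normrM (ger0_norm pi0) [_ + (x.1 - _) ^+ 2]addrC.
  rewrite normrM [`|_^-1|]ger0_norm ?invr_ge0 ?addr_ge0 ?sqr_ge0// [X in _ * X]mulrC.
  by rewrite ler_piMl// divr_ge0// addr_ge0 ?sqr_ge0.
Qed.

End DiracFieldLp.

Section DiracDivergence.
Variable R : realType.
Local Notation mu1 := (@lebesgue_measure R).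
Local Notation mu := (mu2 R).

Lemma measurable_sg : measurable_fun setT (@Num.sg R).
Proof.
rewrite (_ : Num.sg = (fun t : R => \1_(`]0, +oo[%classic) t - \1_(`]-oo, 0[%classic) t)).
  by apply: measurable_funB; apply: measurable_indic; exact: measurable_itv.
apply/funext => t; rewrite !indicE !mem_setE !in_itv /= andbT.
by case: (ltgtP t 0) => h;
  rewrite ?(gtr0_sg h) ?(ltr0_sg h) ?h ?sgr0 ?subr0 ?sub0r.
Qed.

Variables (phi phi1 phi2 : plane R -> R) (x0 : plane R) (M : R).
Hypotheses (M0 : 0 < M) (hC1 : C1 phi phi1 phi2)
  (h0 : forall x, off_box M x -> vanish_at phi phi1 phi2 x).

Let F (x : mplane R) : R := dot (dirac_field x0 x) (phi1 x, phi2 x).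

(** |s - x0.1| F(s, x0.2 + |s - x0.1| t): on each vertical line the second
coordinate is counted in units of the distance to x0.1. In the coordinates
(s, t) the singularity of the field is cancelled by the Jacobian, and the
curves t = constant are pairs of half-lines issued from x0. *)
Let H (x : mplane R) : R := (2 * pi)^-1 * ((1 + x.2 ^+ 2)^-1 *
  (Num.sg (x.1 - x0.1) * phi1 (x.1, x0.2 + `|x.1 - x0.1| * x.2)
   + x.2 * phi2 (x.1, x0.2 + `|x.1 - x0.1| * x.2))).

Let HF (s t : R) : s != x0.1 ->
  `|s - x0.1| * F (s, x0.2 + `|s - x0.1| * t) = H (s, t).
Proof.
move=> sx; have d0 : `|s - x0.1| != 0 by rewrite normr_eq0 subr_eq0.
rewrite /F /H /dot /dirac_field /= enorm_sqr /dot /=.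
have E : s - x0.1 = Num.sg (s - x0.1) * `|s - x0.1| by rewrite mulr_sg_norm.
have -> : x0.2 + `|s - x0.1| * t - x0.2 = `|s - x0.1| * t by ring.
have -> : (s - x0.1) * (s - x0.1) = `|s - x0.1| ^+ 2 by rewrite real_normK ?num_real// expr2.
rewrite [in X in _ * (_ *: (_ *: X) * _ + _)]E.
set d := `|s - x0.1| in d0 *.
move: (phi1 _) (phi2 _) (Num.sg _) ((2 * pi)^-1) => a b e k.
move: d d0 => d d0.
have t0 : 1 + t ^+ 2 != 0 by rewrite gt_eqF// ltr_wpDr// sqr_ge0.
rewrite /GRing.scale /=.
have -> : (d ^+ 2 + d * t * (d * t))^-1 = (d ^+ 2)^-1 * (1 + t ^+ 2)^-1.
  by rewrite -invfM; congr (_^-1); ring.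
field.
by rewrite t0 d0.
Qed.

Let measurableH : measurable_fun setT H.
Proof.
have [_ c1 c2 _ _] := hC1.
pose g (x : plane R) : plane R := (x.1, x0.2 + `|x.1 - x0.1| * x.2).
have cfst : continuous (fun x : plane R => x.1).
  by apply: (continuous_fst_comp (a := id)) => x; exact: cvg_id.
have csnd : continuous (fun x : plane R => x.2).
  by apply: (continuous_snd_comp (a := id)) => x; exact: cvg_id.
have cg2 : continuous (fun x : plane R => x0.2 + `|x.1 - x0.1| * x.2).
  move=> x; apply: cvgD; first exact: cvg_cst.
  apply: cvgM; last exact: csnd.
  apply: cvg_norm; apply: cvgB; [exact: cfst|exact: cvg_cst].
have cg : continuous g.
  move=> x A /nbhs_box[e e0 hA].
  have /cvgrPdist_lt/(_ _ e0) n1 := cfst x.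
  have /cvgrPdist_lt/(_ _ e0) n2 := cg2 x.
  by apply: filterS2 n1 n2 => y y1 y2; apply: hA => /=; rewrite distrC.
have m1 : measurable_fun setT (fun x : mplane R => phi1 (g x)).
  by apply: (@continuous_measurable_plane _ (fun x => phi1 (g x))) => x;
    exact: cvg_comp (cg x) (c1 (g x)).
have m2 : measurable_fun setT (fun x : mplane R => phi2 (g x)).
  by apply: (@continuous_measurable_plane _ (fun x => phi2 (g x))) => x;
    exact: cvg_comp (cg x) (c2 (g x)).
have mi : measurable_fun setT (fun x : mplane R => (1 + x.2 ^+ 2)^-1).
  apply: (measurable_snd_comp (b := fun t : R => (1 + t ^+ 2)^-1)).
  apply: continuous_measurable_fun => t; exact: (@continuous_oneDsqrV R t).
apply: measurable_funM => //; apply: measurable_funM => //.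
apply: measurable_funD; apply: measurable_funM => //.
apply: (measurableT_comp measurable_sg); exact: measurable_funB.
Qed.

Let slice_continuous (s : R) : s != x0.1 -> continuous (fun t : R => F (s, t)).
Proof.
move=> sx; have [_ c1 c2 _ _] := hC1.
have cD : continuous (fun t : R => (s - x0.1) ^+ 2 + (t - x0.2) ^+ 2).
  move=> t; apply: cvgD; first exact: cvg_cst.
  by apply: cvgM; (apply: cvgB; [exact: cvg_id|exact: cvg_cst]).
have D0 t : (s - x0.1) ^+ 2 + (t - x0.2) ^+ 2 != 0.
  by rewrite gt_eqF// ltr_wpDr ?sqr_ge0// exprn_even_gt0//= subr_eq0.
have cV : continuous (fun t : R => ((s - x0.1) ^+ 2 + (t - x0.2) ^+ 2)^-1).
  by move=> t; apply: cvgV; [exact: D0|exact: cD].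
rewrite (_ : (fun t => F (s, t)) = (fun t =>
  (2 * pi)^-1 * (((s - x0.1) ^+ 2 + (t - x0.2) ^+ 2)^-1 * (s - x0.1)) * phi1 (s, t)
  + (2 * pi)^-1 * (((s - x0.1) ^+ 2 + (t - x0.2) ^+ 2)^-1 * (t - x0.2)) * phi2 (s, t))).
  move=> t; apply: cvgD.
    apply: cvgM; last exact: (slice2_continuous c1).
    by apply: cvgM; [exact: cvg_cst|apply: cvgM; [exact: cV|exact: cvg_cst]].
  apply: cvgM; last exact: (slice2_continuous c2).
  apply: cvgM; first exact: cvg_cst.
  by apply: cvgM; [exact: cV|apply: cvgB; [exact: cvg_id|exact: cvg_cst]].
by apply/funext => t; rewrite /F /dot /dirac_field /= enorm_sqr.
Qed.

Let slice_subst (s : R) : s != x0.1 ->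
  (\int[mu1]_t (F (s, t))%:E = \int[mu1]_t (H (s, t))%:E)%E.
Proof.
move=> sx; have d0 : 0 < `|s - x0.1| by rewrite normr_gt0 subr_eq0.
rewrite (integral_affine x0.2 d0 (slice_continuous sx)).
by apply: eq_integral => t _; rewrite HF.
Qed.

Let slice_subst_norm (s : R) : s != x0.1 ->
  (\int[mu1]_t `|(F (s, t))%:E| = \int[mu1]_t `|(H (s, t))%:E|)%E.
Proof.
move=> sx; have d0 : 0 < `|s - x0.1| by rewrite normr_gt0 subr_eq0.
have cN : continuous (fun t => `|F (s, t)|).
  by move=> t; apply: cvg_norm; exact: slice_continuous.
rewrite (integral_affine_ge0 x0.2 d0 cN)//.
by apply: eq_integral => t _; rewrite -HF//= normrM (ger0_norm (ltW d0)).
Qed.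

Let integrableF : mu.-integrable setT (EFin \o F).
Proof.
have off x : ~ box M x -> F x = 0.
  by move=> /off_boxP/h0[_ p1 p2]; rewrite /F /dot /= p1 p2 !mulr0 addr0.
have -> : EFin \o F = (EFin \o F) \_ (box M).
  apply/funext => x; rewrite /patch; case: ifPn => // /negP; rewrite inE => /off /= ->.
  by [].
apply: (integrable_mkcond (mu := mu) (EFin \o F) (measurable_box M)).1.
have p1 : 1 <= 3 / 2 :> R by rewrite ler_pdivlMr// mul1r ler_nat.
have q1 : 1 <= 3 :> R by rewrite ler1n.
have pq : (3 / 2)^-1 + 3^-1 = 1 :> R by field.
apply: (Lpv_dot_integrable (measurable_box M) p1 q1 pq).
  apply: (@dirac_field_Lp _ _ _ M) => //; last exact: measurable_box.
  by apply/andP; split; lra.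
have [C hC] := C1_bounded hC1 h0; have [_ c1 c2 _ _] := hC1.
split; apply: (@Lp_bounded _ _ _ _ C) => //; try exact: measurable_box; try exact: box_fin_measure.
- by apply: measurable_funTS; exact: continuous_measurable_plane c1.
- by move=> x _; have [] := hC x.
- by apply: measurable_funTS; exact: continuous_measurable_plane c2.
- by move=> x _; have [] := hC x.
Qed.

Let ae_neq : {ae mu1, forall s : R, s != x0.1}.
Proof.
exists [set x0.1]; split; [exact: measurable_set1|exact: lebesgue_measure_set1|].
by move=> s /= /negP/negPn/eqP.
Qed.

Let integrableH : mu.-integrable setT (EFin \o H).
Proof.
have mH : measurable_fun setT (EFin \o H) by exact/measurable_EFinP.
apply/(integrable12ltyP mu1 mu1 mH).
have mF := measurable_int _ integrableF.
have := (integrable12ltyP mu1 mu1 mF).1 integrableF; apply: le_lt_trans.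
apply: ae_le_integral => [s|s|]; rewrite ?integral_ge0//.
case: ae_neq => N [mN N0 hN]; exists N; split => // s /= sN; apply: hN => /= sx.
by apply: sN; rewrite -slice_subst_norm.
Qed.

(** Along each of the two half-lines of slopes t and -t issued from x0, H is up to
a factor the derivative of phi, which goes from phi x0 to 0: both half-lines
contribute the same amount. *)
Let ray_integral (t : R) : (\int[mu1]_s (H (s, t))%:E =
  ((1 + t ^+ 2)^-1)%:E * (- (pi^-1 * phi x0))%:E)%E.
Proof.
(* phi vanishes off [-N, N], which contains x0.1: the two half-lines are
integrated over [-N, x0.1] and [x0.1, N]. *)
pose N := M + `|x0.1|.
have M0' := ltW M0.
have xN : - N <= x0.1 <= N by rewrite -ler_norml /N lerDr.
pose K : R := (2 * pi)^-1 * (1 + t ^+ 2)^-1.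
pose psi tau (s : R) := phi (s, x0.2 + (s - x0.1) * tau).
pose psi' tau (s : R) :=
  phi1 (s, x0.2 + (s - x0.1) * tau) + tau * phi2 (s, x0.2 + (s - x0.1) * tau).
have dpsi k tau (s : R) : is_derive s 1 (k *: psi tau : R -> R) (k * psi' tau s).
  by apply: is_deriveZ; exact: is_derive_ray.
have cray tau f : continuous f -> continuous (fun s : R => f (s, x0.2 + (s - x0.1) * tau) : R).
  move=> cf s; apply: (@cvg_comp _ _ _ (fun s : R => (s, x0.2 + (s - x0.1) * tau)) f); last exact: cf.
  move=> A /nbhs_box[e e0 hA].
  have c2 : {for s, continuous (fun s : R => x0.2 + (s - x0.1) * tau)}.
    apply: cvgD; first exact: cvg_cst.
    by apply: cvgM; [apply: cvgB; [exact: cvg_id|exact: cvg_cst]|exact: cvg_cst].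
  have /cvgrPdist_lt/(_ _ e0) n2 := c2.
  have n1 : \forall y \near s, `|s - y| < e.
    by have /cvgrPdist_lt/(_ _ e0) := @cvg_id _ (nbhs s).
  by apply: filterS2 n1 n2 => y y1 y2; apply: hA => /=; rewrite distrC.
have cpsi' k tau : continuous (fun s => k * psi' tau s).
  have [_ c1 c2 _ _] := hC1.
  move=> s; apply: cvgM; first exact: cvg_cst.
  by apply: cvgD; [exact: cray|apply: cvgM; [exact: cvg_cst|exact: cray]].
have psi0 tau (s : R) : M <= `|s| -> psi tau s = 0.
  by move=> sM; have [] := h0 (x := (s, x0.2 + (s - x0.1) * tau)) (or_introl sM).
have psi'0 tau (s : R) : M <= `|s| -> psi' tau s = 0.
  move=> sM; have [_ h1 h2] := h0 (x := (s, x0.2 + (s - x0.1) * tau)) (or_introl sM).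
  by rewrite /psi' h1 h2 mulr0 addr0.
have psix tau : psi tau x0.1 = phi x0.
  by rewrite /psi subrr mul0r addr0 -surjective_pairing.
have NM : M <= N by rewrite lerDl.
have [xN1 xN2] : - N <= x0.1 /\ x0.1 <= N by move: xN => /andP[].
have S1 := FTC_segment xN2 (cpsi' K t) (dpsi K t).
have S2 := FTC_segment xN1 (cpsi' (- K) (- t)) (dpsi (- K) (- t)).
pose S (a b : R) : set (measurableTypeR R) := `[a, b]%classic.
have mS a b : measurable (S a b) by exact: measurable_itv.
have iS a b k tau : mu1.-integrable setT ((fun s => (k * psi' tau s)%:E) \_ (S a b)).
  apply/(integrable_mkcond _ (mS a b)).
  apply: continuous_compact_integrable; first exact: segment_compact.
  by apply: continuous_subspaceT; exact: cpsi'.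
have := integrableD measurableT (iS x0.1 N K t) (iS (- N) x0.1 (- K) (- t)) => iD.
transitivity (\int[mu1]_s (((fun s => (K * psi' t s)%:E) \_ (S x0.1 N)) s +
    ((fun s => (- K * psi' (- t) s)%:E) \_ (S (- N)%R x0.1)) s))%E.
  apply: ae_eq_integral => //.
  - apply/measurable_EFinP; exact: measurable_fun_pair1 measurableH.
  - exact: measurable_int iD.
  case: ae_neq => A [mA A0 hA]; exists A; split => // s /= sA; apply: hA => /= sx.
  apply: sA => _; rewrite /H /= mulrA -/K.
  have out : N < `|s| -> psi' t s = 0 /\ psi' (- t) s = 0.
    by move=> sN; rewrite !psi'0// (le_trans NM)// ltW.
  case: (ltgtP s x0.1) sx => // sx _.
  - rewrite ltr0_sg ?subr_lt0// ler0_norm; last by rewrite subr_le0 ltW.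
    rewrite [X in (X + _)%E]/patch memNset ?add0e; last first.
      by rewrite /S /= in_itv /= leNgt sx.
    rewrite mulN1r (_ : - (s - x0.1) * t = (s - x0.1) * - t); last by ring.
    rewrite /patch; case: ifPn => [_|/negP].
      by congr EFin; rewrite /psi'; ring.
    rewrite inE /S /= in_itv /= (ltW sx) andbT => /negP; rewrite -ltNge => sN.
    have sN' : N < `|s| by rewrite -[`|s|]normrN (lt_le_trans _ (ler_norm _))// ltrNr.
    have [_] := out sN'; rewrite /psi' => e.
    congr EFin; rewrite -[RHS](mulr0 (- K)) -e; ring.
  - rewrite gtr0_sg ?subr_gt0// gtr0_norm ?subr_gt0// mul1r.
    rewrite [X in (_ + X)%E]/patch memNset ?adde0; last first.
      by rewrite /S /= in_itv /= [s <= _]leNgt sx andbF.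
    rewrite /patch; case: ifPn => [_|/negP]; first by [].
    rewrite inE /S /= in_itv /= (ltW sx) /= => /negP; rewrite -ltNge => sN.
    have [e _] := out (lt_le_trans sN (ler_norm _)).
    by congr EFin; rewrite -[RHS](mulr0 K) -e /psi'.
rewrite integralD// -[X in (X + _)%E]integral_mkcond -[X in (_ + X)%E]integral_mkcond.
rewrite S1 S2 -EFinD -EFinM; congr EFin.
rewrite /= !fctE !psix !psi0 ?normrN ?[`|N|]ger0_norm ?(le_trans M0')//.
rewrite /GRing.scale /= /K invfM; move: (1 + t ^+ 2) => u.
by move: (pi^-1) (u^-1) (phi x0) => a b c; field.
Qed.

(** Change variables on the vertical lines, exchange the order of integration,
integrate along the half-lines, and use that the integral of 1 / (1 + t^2) is
pi. *)
Lemma dirac_divergence : (\int[mu]_x (F x)%:E = (- phi x0)%:E)%E.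
Proof.
rewrite -(integral12_prod_meas1 integrableF).
transitivity (\int[mu1]_s fubini_F mu1 (EFin \o H) s)%E.
  apply: ae_eq_integral => //.
  - exact: measurable_fubini_F integrableF.
  - exact: measurable_fubini_F integrableH.
  - case: ae_neq => N [mN N0 hN]; exists N; split => // s /= sN; apply: hN => /= sx.
    by apply: sN => _; exact: slice_subst sx.
rewrite (integral12_prod_meas1 integrableH) -(integral21_prod_meas1 integrableH).
rewrite /fubini_G; under eq_integral do rewrite ray_integral.
have mi : measurable_fun setT (fun t : measurableTypeR R => ((1 + t ^+ 2)^-1)%:E).
  by apply/measurable_EFinP; apply: continuous_measurable_fun => t; exact: (@continuous_oneDsqrV R t).
have i0 (t : R) : 0 <= (1 + t ^+ 2)^-1 by rewrite invr_ge0 addr_ge0// sqr_ge0.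
rewrite integralZr//; last first.
  apply/integrableP; split => //.
  under eq_integral do rewrite /= ger0_norm//.
  by rewrite integral_arctan ltry.
rewrite integral_arctan -EFinM; congr EFin.
by rewrite mulrN mulrA mulfV ?mul1r// gt_eqF// pi_gt0.
Qed.

End DiracDivergence.

(** * Triangulations of Lipschitz domains *)

Section Barycentric.
Variable R : realType.
Local Notation mu1 := (@lebesgue_measure R).
Local Notation mu := (mu2 R).
Local Notation triangle := (3.-tuple (plane R)).

Definition affine_fun (k : R * plane R) (x : plane R) : R := k.1 + dot k.2 x.

Lemma affine_sum k (I : Type) (s : seq I) (l : I -> R) (F : I -> plane R) :
  \sum_(i <- s) l i = 1 ->
  affine_fun k (\sum_(i <- s) l i *: F i) = \sum_(i <- s) l i * affine_fun k (F i).
Proof.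
move=> l1.
have h t : dot k.2 (\sum_(i <- t) l i *: F i) = \sum_(i <- t) l i * dot k.2 (F i).
  elim: t => [|v t IH]; first by rewrite !big_nil /dot /= !mulr0 addr0.
  by rewrite !big_cons -IH /dot /= /GRing.scale /=; ring.
rewrite /affine_fun h; under [RHS]eq_bigr do rewrite mulrDr.
by rewrite big_split /= -mulr_suml l1 mul1r.
Qed.

Lemma affine_combination k a (x y : plane R) :
  affine_fun k (x + a *: (y - x)) = (1 - a) * affine_fun k x + a * affine_fun k y.
Proof. by rewrite /affine_fun /dot /= /GRing.scale /=; ring. Qed.

Lemma continuous_affine k : continuous (affine_fun k).
Proof.
move=> x; apply: cvgD; first exact: cvg_cst.
apply: cvgD; apply: cvgM; try exact: cvg_cst.
  by apply: (continuous_fst_comp (a := id)) => y; exact: cvg_id.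
by apply: (continuous_snd_comp (a := id)) => y; exact: cvg_id.
Qed.

(** Affine coordinates of the triangle: [lam i] is 1 at the vertex i, and vanishes
at the two others, that is on the opposite side. *)
Definition barycentric (K : triangle) (lam : 'I_3 -> plane R -> R) : Prop :=
  [/\ forall i, exists k, lam i = affine_fun k,
      forall i j, lam i (tnth K j) = (i == j)%:R
    & forall x, hull K x <-> forall i, 0 <= lam i x].

Lemma ord3_ind (P : 'I_3 -> Prop) : P 0 -> P 1 -> P 2 -> forall i, P i.
Proof.
move=> P0 P1 P2; case=> [[|[|[|//]]]] h; [have -> : Ordinal h = 0 by exact: val_inj|
  have -> : Ordinal h = 1 by exact: val_inj|have -> : Ordinal h = 2 by exact: val_inj] => //.
Qed.

Lemma hull_tuple (K : triangle) : uniq K -> forall x, hull K x <->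
  exists l : 'I_3 -> R, [/\ forall i, 0 <= l i, \sum_i l i = 1 & x = \sum_i l i *: tnth K i].
Proof.
move=> uK x; split => [[l [l0 l1 ->]]|[l [l0 l1 ->]]].
  exists (fun i => l (tnth K i)); rewrite -l1 !big_tuple; split => // i.
  by apply: l0; exact: mem_tnth.
exists (fun v => if [pick i | tnth K i == v] is Some i then l i else 0).
have E i : (if [pick j | tnth K j == tnth K i] is Some j then l j else 0) = l i.
  case: pickP => [j /eqP/(tuple_uniqP _ uK) -> //|/(_ i)]; by rewrite eqxx.
split.
- by move=> v _; case: pickP.
- by rewrite big_tuple -l1; apply: eq_bigr.
- by rewrite big_tuple; apply: eq_bigr => i _; rewrite E.
Qed.

(** The coordinates are quotients of signed areas, by Cramer's rule. *)
Lemma barycentric_exists (K : triangle) : nondegenerate_triangle K ->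
  uniq K /\ exists lam, barycentric K lam.
Proof.
rewrite /nondegenerate_triangle; set a := tnth K 0; set b := tnth K 1; set c := tnth K 2.
set D := (X in X != 0) => D0.
(* k1 and k2 are the coordinates of x - a in the basis (b - a, c - a), and k0
makes the sum equal to 1. *)
pose k2 : R * plane R := (((b.2 - a.2) * a.1 - (b.1 - a.1) * a.2) / D,
    (- (b.2 - a.2) / D, (b.1 - a.1) / D)).
pose k1 : R * plane R := (((c.1 - a.1) * a.2 - (c.2 - a.2) * a.1) / D,
    ((c.2 - a.2) / D, - (c.1 - a.1) / D)).
pose k0 : R * plane R := (1 - k1.1 - k2.1, (- k1.2.1 - k2.2.1, - k1.2.2 - k2.2.2)).
pose k (i : 'I_3) := nth k0 [:: k0; k1; k2] i.
have delta i j : affine_fun (k i) (tnth K j) = (i == j)%:R.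
  move: i j; apply: ord3_ind; apply: ord3_ind; rewrite -/a -/b -/c /k /=;
  rewrite /affine_fun /dot /=; move: D0; rewrite /D /=; move: (a) (b) (c) => [a1 a2] [b1 b2] [c1 c2] /= D0;
  by field.
have uK : uniq K.
  apply/tuple_uniqP => i j E; apply/eqP; move: (delta i j).
  rewrite -E delta eqxx; case: (i == j) => // /eqP; by rewrite oner_eq0.
split => //; exists (fun i => affine_fun (k i)); split => //; first by move=> i; exists (k i).
move=> x; rewrite hull_tuple//; split => [[l [l0 l1 ->]] i|h].
  have -> : affine_fun (k i) (\sum_j l j *: tnth K j) = l i.
    rewrite (affine_sum _ _ l1) (bigD1 i)//= delta eqxx mulr1 big1 ?addr0// => j /negPf ji.
    by rewrite delta eq_sym ji mulr0.
  exact: l0.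
exists (fun i => affine_fun (k i) x); split => //; rewrite !big_ord_recl big_ord0 /k/=.
  by rewrite /affine_fun/dot/=; ring.
have -> : tnth K (lift ord0 (ord0 : 'I_2)) = b by congr tnth; exact: val_inj.
have -> : tnth K (lift ord0 (lift ord0 (ord0 : 'I_1))) = c by congr tnth; exact: val_inj.
rewrite -/a; move: D0; rewrite /k0 /k1 /k2 /affine_fun /D /dot /=; move: (a) (b) (c) x {h} => [a1 a2] [b1 b2] [c1 c2] [x1 x2] /= D0.
by apply: injective_projections; rewrite /= /GRing.scale /=; field.
Qed.
End Barycentric.

Section Cells.
Variable R : realType.
Local Notation mu1 := (@lebesgue_measure R).
Local Notation mu := (mu2 R).
Local Notation triangle := (3.-tuple (plane R)).

(** A line that is not vertical meets each vertical line in one point. *)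
Lemma null_affine (k : R * plane R) : k.2 != 0 ->
  mu ([set x | affine_fun k x = 0] : set (mplane R)) = 0%E.
Proof.
move=> k0; have [k2|k2] := eqVneq k.2.2 0.
  have k1 : k.2.1 != 0.
    apply: contra_neq k0 => k1; move: k1 k2; case: k.2 => a b /= -> ->; by [].
  rewrite (_ : [set x | affine_fun k x = 0] = fst @^-1` [set - k.1 / k.2.1]); last first.
    apply/seteqP; split => x /=; rewrite /affine_fun /dot k2 mul0r addr0.
      move=> /eqP; rewrite addrC addr_eq0 => /eqP e.
      by rewrite -e mulrAC mulfV// mul1r.
    by move=> ->; rewrite mulrC mulfVK// subrr.
  exact: null_vertical.
rewrite /product_measure1 /=; apply: integral0_eq => s _ /=.
rewrite (_ : xsection _ s = [set - (k.1 + k.2.1 * s) / k.2.2]); last first.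
  apply/seteqP; split => t; rewrite /xsection /= inE /affine_fun /dot /= addrA.
    move=> /eqP; rewrite addrC addr_eq0 => /eqP e.
    by rewrite -e mulrAC mulfV// mul1r.
  by move=> ->; rewrite [k.2.2 * _]mulrC mulfVK// subrr.
exact: lebesgue_measure_set1.
Qed.

Lemma barycentric_null (K : triangle) lam i : barycentric K lam ->
  mu ([set x | lam i x = 0] : set (mplane R)) = 0%E.
Proof.
move=> [a d _]; have [k E] := a i; rewrite E; apply: null_affine; apply/eqP => k0.
pose j : 'I_3 := if i == 0 then 1 else 0.
have ij : i != j.
  by rewrite /j; case: (eqVneq i 0) => [->|].
have : affine_fun k (tnth K i) = affine_fun k (tnth K j).
  by rewrite /affine_fun k0 /dot /= !mul0r.
by move/eqP; rewrite -E !d eqxx (negPf ij) oner_eq0.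
Qed.

Lemma cell_open (K : triangle) : open (cell K).
Proof. exact: open_interior. Qed.

Lemma measurable_cell (K : triangle) : measurable (cell K : set (mplane R)).
Proof. by apply: open_measurable_plane; exact: cell_open. Qed.

(** A point of the triangle off the three lines that carry its sides is interior:
the barycentric coordinates remain positive near it. *)
Lemma hull_cell (K : triangle) lam x : barycentric K lam -> hull K x ->
  (forall i, lam i x != 0) -> cell K x.
Proof.
move=> [a _ h] /h h0 n0; rewrite /cell /interior /=.
have : \forall y \near x, forall i, 0 < lam i y.
  have P i : \forall y \near x, 0 < lam i y.
    have [k E] := a i.
    have c := @continuous_affine _ k x; rewrite -E in c.
    have li : 0 < lam i x by rewrite lt_def n0 h0.
    have /cvgrPdist_lt/(_ _ li) := c; apply: filterS => y /=.
    by rewrite ltr_norml => /andP[_]; rewrite ltrBlDr ltrDl.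
  by apply: filterS3 (P 0) (P 1) (P 2) => y h1 h2 h3; apply: ord3_ind.
by apply: filterS => y hy; apply/h => i; exact: ltW.
Qed.

(** Move from x a little towards a point where the function does not vanish. *)
Lemma affine_open_neq0 k (U : set (plane R)) x : open U -> U x -> (exists y, affine_fun k y != 0) ->
  exists2 y, U y & affine_fun k y != 0.
Proof.
move=> oU Ux [v v0]; have [e|] := eqVneq (affine_fun k x) 0; last by exists x.
have [d d0 hd] := (nbhs_box x U).1 (open_nbhs_nbhs (conj oU Ux)).
pose m := 1 + `|v.1 - x.1| + `|v.2 - x.2|.
have m0 : 0 < m by rewrite /m -addrA ltr_pwDl// addr_ge0.
pose a := d / 2 / m.
have a0 : 0 < a by rewrite !divr_gt0.
have am : a * m < d by rewrite /a divfK ?gt_eqF// ltr_pdivrMr// mulr2n mulrDr mulr1 ltrDl.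
exists (x + a *: (v - x)).
  by apply: hd; rewrite /= /GRing.scale /= addrC addKr normrM (gtr0_norm a0);
    apply: le_lt_trans am; rewrite ler_pM2l// /m; move: (normr_ge0 (v.1 - x.1)) (normr_ge0 (v.2 - x.2)); lra.
by rewrite affine_combination e mulr0 add0r mulf_neq0// gt_eqF.
Qed.

Lemma hull_perm (s t : seq (plane R)) : perm_eq s t -> hull s = hull t.
Proof.
move=> st; apply/seteqP; split => x [l [l0 l1 ->]]; exists l; split.
- by move=> v vt; apply: l0; rewrite (perm_mem st).
- by rewrite -(perm_big _ st).
- by rewrite -(perm_big _ st).
- by move=> v vt; apply: l0; rewrite -(perm_mem st).
- by rewrite (perm_big _ st).
- by rewrite (perm_big _ st).
Qed.

(** Some vertex v of K is not a vertex of L, as the hulls differ. The common part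
is spanned by the other vertices, so that it lies on the side opposite to v,
which contains no open set. *)
Lemma cell_disjoint (K L : triangle) :
  nondegenerate_triangle K -> nondegenerate_triangle L -> hull K <> hull L ->
  hull K `&` hull L = hull [seq v <- K | v \in L] -> cell K `&` cell L = set0.
Proof.
move=> /barycentric_exists[uK [lam bK]] /barycentric_exists[uL _] KL int.
apply/seteqP; split => // x [xK xL] /=.
have [sub|/allPn[v vK vL]] := boolP (all (mem L) K).
  apply: KL; apply: hull_perm; apply: uniq_perm => //.
  have [_] := uniq_min_size uK (allP sub) (eq_leq (etrans (size_tuple L) (esym (size_tuple K)))).
  by [].
have /tnthP[i vi] := vK; have [a d h] := bK; have [k E] := a i.
have [y [yK yL]] : exists2 y, (cell K `&` cell L) y & affine_fun k y != 0.
  apply: (@affine_open_neq0 k _ x) => //; first by apply: openI; exact: cell_open.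
  by exists (tnth K i); rewrite -E d eqxx oner_neq0.
have : (hull K `&` hull L) y by split; [exact: interior_subset yK|exact: interior_subset yL].
rewrite int => -[l [l0 l1 ->]].
rewrite (affine_sum k _ l1) big_seq big1 ?eqxx// => w; rewrite mem_filter => /andP[wL /tnthP[j wj]].
rewrite wj -E d; case: eqVneq => [ij|]; last by rewrite mulr0.
by move: vL; rewrite /= vi ij -wj wL.
Qed.

(** A Lipschitz domain lies on one side of its boundary: just below a boundary
point z, that is at z - ep e2, there is a small disc that does not meet Om.
An open cell contained in the closure of Om is therefore contained in Om. *)
Lemma lipschitz_interior_closure (Om : set (plane R)) : lipschitz_boundary Om ->
  interior (closure Om) `<=` Om.
Proof.
move=> lip z iz; apply: contrapT => nz.
have cz : closure Om z by exact: interior_subset iz.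
have [e1 [e2 [r [h [L [gam [[n1 n2 o] [r0 h0 gL] gh hO]]]]]]] := lip z (conj cz nz).
have g0 : 0 <= gam 0.
  rewrite leNgt; apply/negP => g0; apply: nz.
  by have := (hO 0 0); rewrite !normr0 !scale0r !addr0 => -> .
have e11 : dot e1 e1 = 1 by rewrite -enorm_sqr n1 expr1n.
have e22 : dot e2 e2 = 1 by rewrite -enorm_sqr n2 expr1n.
pose k1 : R * plane R := (- dot e1 z, e1); pose k2 : R * plane R := (- dot e2 z, e2).
have dec y : y = z + affine_fun k1 y *: e1 + affine_fun k2 y *: e2.
  have [h1 h2 h3] : [/\ e1.1 ^+ 2 + e2.1 ^+ 2 = 1, e1.2 ^+ 2 + e2.2 ^+ 2 = 1
      & e1.1 * e1.2 + e2.1 * e2.2 = 0].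
    move: o e11 e22; rewrite /dot; move: e1.1 e1.2 e2.1 e2.2 => a b c d h1 h2 h3.
    have [D [ec ed]] : exists D, c = - (b * D) /\ d = a * D.
      exists (a * d - b * c); split.
        transitivity (a * (a * c + b * d) - b * (a * d - b * c)); last by rewrite h1 mulr0 sub0r.
        by rewrite -[LHS]mulr1 -h2; ring.
      transitivity (a * (a * d - b * c) + b * (a * c + b * d)); last by rewrite h1 mulr0 addr0.
      by rewrite -[LHS]mulr1 -h2; ring.
    have D2 : D * D = 1.
      by rewrite -h3 ec ed -[LHS]mulr1 -h2; ring.
    split.
    - by rewrite -h2 ec -[b * b]mulr1 -D2; ring.
    - by rewrite -h2 ed -[a * a]mulr1 -D2; ring.
    - transitivity (a * b * (1 - D * D)); first by rewrite ec ed; ring.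
      by rewrite D2 subrr mulr0.
  apply: injective_projections; rewrite /affine_fun /= /dot /= /GRing.scale /=.
    transitivity (z.1 + (y.1 - z.1) * (e1.1 ^+ 2 + e2.1 ^+ 2) + (y.2 - z.2) * (e1.1 * e1.2 + e2.1 * e2.2)).
      by rewrite h1 h3; ring.
    by ring.
  transitivity (z.2 + (y.2 - z.2) * (e1.2 ^+ 2 + e2.2 ^+ 2) + (y.1 - z.1) * (e1.1 * e1.2 + e2.1 * e2.2)).
    by rewrite h2 h3; ring.
  by ring.
have [d d0 hd] : exists2 d : R, 0 < d & forall y : plane R, `|y.1 - z.1| < d -> `|y.2 - z.2| < d -> (closure Om)^° y.
  by apply/nbhs_box; apply: open_nbhs_nbhs; split; [exact: open_interior|].
(* Half of the radii keeps z - ep e2 and its small neighbourhood inside the chart. *)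
pose ep := Num.min d (Num.min h r) / 2.
pose y := z - ep *: e2.
have m0 : 0 < Num.min d (Num.min h r) by rewrite !lt_min d0 h0 r0.
have ep0 : 0 < ep by rewrite divr_gt0.
have [epd eph] : 2 * ep <= d /\ 2 * ep <= h.
  by rewrite /ep mulrC divfK//; split; rewrite !ge_min lexx ?orbT.
have iy : (closure Om)^° y.
  have ee (b : R) : `|b| <= enorm e2 -> `|- (ep * b)| < d.
    rewrite n2 normrN normrM (gtr0_norm ep0) => b1; apply: (@le_lt_trans _ _ ep); last by lra.
    by rewrite -[leRHS]mulr1 ler_pM2l.
  apply: hd; rewrite /= /GRing.scale /= addrC addKr; apply: ee.
    exact: norm_fst_le.
  exact: norm_snd_le.
have y1 : affine_fun k1 y = 0.
  transitivity (- ep * dot e1 e2); last by rewrite o mulr0.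
  by rewrite /affine_fun /= /dot /= /GRing.scale /=; ring.
have y2 : affine_fun k2 y = - ep.
  transitivity (- ep * dot e2 e2); last by rewrite e22 mulr1.
  by rewrite /affine_fun /= /dot /= /GRing.scale /=; ring.
have [M M0 gM] : exists2 M : R, 0 < M & forall s t, `|gam s - gam t| <= M * `|s - t|.
  exists (`|L| + 1); first by rewrite ltr_wpDl.
  move=> s t; apply: (le_trans (gL (s, t) _)) => //=.
  by apply: ler_wpM2r => //; rewrite (le_trans (ler_norm _))// lerDl.
have [w [Ow [w1 w2]]] : exists w, Om w /\ (`|affine_fun k1 w| < Num.min r (ep / (2 * M))
   /\ `|affine_fun k2 w + ep| < ep / 2).
  apply: (interior_subset iy).
  have r1 : 0 < Num.min r (ep / (2 * M)) by rewrite lt_min r0 divr_gt0// mulr_gt0.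
  have r2 : 0 < ep / 2 by rewrite divr_gt0.
  have /cvgrPdist_lt/(_ _ r1) := @continuous_affine _ k1 y.
  have /cvgrPdist_lt/(_ _ r2) := @continuous_affine _ k2 y.
  apply: filterS2 => v; rewrite y1 y2 sub0r normrN => v2 v1; split => //.
  by rewrite -normrN opprD addrC.
move: Ow; rewrite (dec w); move: w1 w2; move: (affine_fun k1 w) (affine_fun k2 w) => s t.
rewrite lt_min => /andP[s1 s2] t1.
have [t2 t3] : - (ep / 2) < t + ep /\ t + ep < ep / 2 by move: t1; rewrite ltr_norml => /andP[].
have th : `|t| < h by rewrite ltr_norml; apply/andP; split; lra.
move=> /(hO _ _ s1 th) gt.
have := gM 0 s; rewrite sub0r normrN => gM0.
have : M * `|s| < ep / 2.
  rewrite -ltr_pdivlMl//; apply: lt_le_trans s2 _.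
  by rewrite invfM mulrA [ep / 2 / M]mulrC.
have := ler_norm (gam 0 - gam s).
by lra.
Qed.
End Cells.

Section Decomposition.
Variable R : realType.
Local Notation mu := (mu2 R).

Lemma ae_hull_cell (K : 3.-tuple (plane R)) : nondegenerate_triangle K ->
  {ae mu, forall x, hull K x -> cell K x}.
Proof.
move=> /barycentric_exists[_ [lam bK]].
have h i : {ae mu, forall x, lam i x != 0}.
  have [k E] := let: And3 a _ _ := bK in a i.
  exists [set x | lam i x = 0]; split; [|exact: barycentric_null bK|].
    rewrite E -[X in measurable X]setTI.
    exact: (continuous_measurable_plane (@continuous_affine _ k)) measurableT _ (measurable_set1 0).
  by move=> x /= /negP/negPn/eqP.
apply: filterS3 (h 0) (h 1) (h 2) => x h0 h1 h2 hx.
by apply: hull_cell bK hx _; apply: ord3_ind.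
Qed.

Lemma ae_all_mem (I : eqType) (s : seq I) (P : I -> plane R -> Prop) :
  (forall i, i \in s -> {ae mu, forall x, P i x}) ->
  {ae mu, forall x, forall i, i \in s -> P i x}.
Proof.
elim: s => [|i s IH] h; first by apply: aeW.
have h1 := h i (mem_head _ _).
have := IH (fun j js => h j (mem_behead (s := i :: s) js)).
by apply: filterS2 h1 => x h1 h2 j; rewrite inE => /predU1P[->|/h2].
Qed.

Variables (Om : set (mplane R)) (T : seq (3.-tuple (plane R))).
Hypotheses (oOm : open (Om : set (plane R))) (lip : lipschitz_boundary Om) (hT : triangulation Om T).

Lemma cell_sub K : K \in T -> cell K `<=` Om.
Proof.
move=> KT; have [_ cl _] := hT.
apply: subset_trans (lipschitz_interior_closure lip).
by rewrite cl; apply: interiorS => x hx; exists K.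
Qed.

Lemma triangulation_uniq : uniq T.
Proof.
have [_ _ h] := hT.
apply/(uniqPn [tuple 0; 0; 0]) => -[i [j [ij jT e]]].
have [|ne _] := h i j (ltn_trans ij jT) jT; first by move=> E; move: ij; rewrite E ltnn.
by apply: ne; rewrite e.
Qed.

Lemma triangulation_trivIset : trivIset [set` T] (fun K => cell K : set (mplane R)).
Proof.
have [nd _ h] := hT.
move=> K L /= KT LT KL; apply: contrapT => KL'.
have iK : (index K T < size T)%N by rewrite index_mem.
have iL : (index L T < size T)%N by rewrite index_mem.
have [|] := h _ _ iK iL.
  by move=> e; apply: KL'; rewrite -(nth_index [tuple 0; 0; 0] KT) e nth_index.
rewrite !nth_index// => h1 h2.
have := cell_disjoint (nd _ KT) (nd _ LT) h1 h2.
by case: KL => x xx E; move: xx; rewrite E.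
Qed.

(** The cells are disjoint, contained in Om, and cover Om up to the sides of the
triangles, which are null sets. *)
Lemma triangulation_integral (f : mplane R -> \bar R) : (forall x, 0 <= f x)%E -> measurable_fun Om f ->
  (\int[mu]_(x in Om) f x = \sum_(K <- T) \int[mu]_(x in cell K) f x)%E.
Proof.
move=> f0 mf; have [nd cl _] := hT.
have sub : \big[setU/set0]_(K <- T) cell K `<=` Om.
  by rewrite big_seq; elim/big_ind : _ => // [A B hA hB|K /cell_sub//]; rewrite subUset.
rewrite -(ge0_integral_bigsetU mu (F := fun K => cell K : set (mplane R))) //.
- apply/eqP; rewrite eq_le; apply/andP; split; last first.
    apply: ge0_subset_integral => //; [|exact: open_measurable_plane].
    by apply: bigsetU_measurable => K _; exact: measurable_cell.
  rewrite [leLHS]integral_mkcond [leRHS]integral_mkcond.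
  apply: ae_le_integral => [x|x|]; rewrite ?erestrict_ge0//.
  have := ae_all_mem (fun K KT => ae_hull_cell (nd K KT)).
  apply: filterS => x hx; rewrite !patchE; case: ifPn => //; last first.
    by case: ifPn.
  rewrite inE => Ox.
  have : closure Om x by exact: subset_closure.
  rewrite cl => -[K /= KT /(hx _ KT) xK].
  by rewrite ifT// inE -bigcup_seq; exists K.
- exact: measurable_cell.
- exact: triangulation_uniq.
- exact: triangulation_trivIset.
- apply: measurable_funS mf => //; exact: open_measurable_plane.
Qed.
End Decomposition.

(** * Elliptic matrices of size two and their square roots *)

Section Matrices.
Variable R : realType.
Implicit Types (M B : 'M[R]_2) (x y : plane R).

Definition elliptic_matrix (alpha beta : R) M : Prop := M^T = M /\
  forall x, alpha * enorm x ^+ 2 <= dot x (mulmxv M x) <= beta * enorm x ^+ 2.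

Lemma ord2_ind (P : 'I_2 -> Prop) : P 0 -> P 1 -> forall i, P i.
Proof.
move=> P0 P1; case=> [[|[|//]]] h; [have -> : Ordinal h = 0 by exact: val_inj|
  have -> : Ordinal h = 1 by exact: val_inj] => //.
Qed.

Lemma mulmx2E B M (i j : 'I_2) : (B *m M) i j = B i 0 * M 0 j + B i 1 * M 1 j.
Proof.
rewrite mxE !big_ord_recl big_ord0 addr0.
by congr (_ + B i _ * M _ j); exact: val_inj.
Qed.

Lemma mulmxvM B M x : mulmxv (B *m M) x = mulmxv B (mulmxv M x).
Proof.
by rewrite /mulmxv !mulmx2E; apply: injective_projections => /=; ring.
Qed.

Lemma mulmxv1 x : mulmxv 1%:M x = x.
Proof.
by rewrite /mulmxv !mxE /= !mulr0n !mulr1n; apply: injective_projections => /=; ring.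
Qed.

Lemma mulmxvD M x y : mulmxv M (x + y) = mulmxv M x + mulmxv M y.
Proof. by apply: injective_projections => /=; ring. Qed.

Lemma mulmxvN M x : mulmxv M (- x) = - mulmxv M x.
Proof. by apply: injective_projections => /=; ring. Qed.

Lemma mulmxvB M x y : mulmxv M (x - y) = mulmxv M x - mulmxv M y.
Proof. by rewrite mulmxvD mulmxvN. Qed.

Lemma sym_dot M x y : M^T = M -> dot x (mulmxv M y) = dot (mulmxv M x) y.
Proof.
move=> s; have e : M 1 0 = M 0 1 by rewrite -[in LHS]s mxE.
by rewrite /dot /mulmxv /= e; ring.
Qed.

Section Elliptic.
Variables (alpha beta : R) (M : 'M[R]_2).
Hypotheses (alpha0 : 0 < alpha) (hM : elliptic_matrix alpha beta M).

Let a := M 0 0. Let b := M 0 1. Let c := M 1 1.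

Let sym : M 1 0 = b.
Proof. by have [s _] := hM; rewrite /b -[in LHS]s mxE. Qed.

Let dot_ge x : alpha * dot x x <= dot x (mulmxv M x).
Proof. by have [_ /(_ x)/andP[]] := hM; rewrite enorm_sqr. Qed.

Let a_gt0 : 0 < a.
Proof.
have := dot_ge (1, 0); rewrite /dot /mulmxv /= -/a => h.
by apply: lt_le_trans alpha0 _; lra.
Qed.

Let c_gt0 : 0 < c.
Proof.
have := dot_ge (0, 1); rewrite /dot /mulmxv /= -/c => h.
by apply: lt_le_trans alpha0 _; lra.
Qed.

Let det_gt0 : 0 < a * c - b ^+ 2.
Proof.
have := dot_ge (- b, a); rewrite /dot /mulmxv /= sym -/a -/b -/c => h.
rewrite -(pmulr_rgt0 _ a_gt0); apply: (@lt_le_trans _ _ (alpha * (b ^+ 2 + a ^+ 2))).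
  by rewrite mulr_gt0// ltr_wpDl ?sqr_ge0// exprn_gt0.
by apply: le_trans (le_trans h _); rewrite le_eqVlt; apply/orP; left; apply/eqP; ring.
Qed.

(** In size two, the square root of M is (M + s) / t with s^2 = det M and
t^2 = tr M + 2 s: by the Cayley-Hamilton theorem,
(M + s)^2 = M^2 + 2 s M + s^2 = (tr M + 2 s) M. *)
Lemma sqrtmx_spec : [/\ (sqrtmx M)^T = sqrtmx M,
  forall x, 0 <= dot x (mulmxv (sqrtmx M) x) & sqrtmx M *m sqrtmx M = M].
Proof.
suff [B hB] : exists B : 'M[R]_2, [/\ B^T = B, forall x, 0 <= dot x (mulmxv B x) & B *m B = M].
  exact: (@xgetI _ 0 [set B | [/\ B^T = B, forall x, 0 <= dot x (mulmxv B x) & B *m B = M]] B hB).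
pose s := Num.sqrt (a * c - b ^+ 2).
have s0 : 0 < s by rewrite sqrtr_gt0.
have s2 : s ^+ 2 = a * c - b ^+ 2 by rewrite sqr_sqrtr// ltW.
pose t := Num.sqrt (a + c + 2 * s).
have w0 : 0 < a + c + 2 * s by rewrite !addr_gt0// mulr_gt0.
have t0 : 0 < t by rewrite sqrtr_gt0.
have t2 : t ^+ 2 = a + c + 2 * s by rewrite sqr_sqrtr// ltW.
have [ms hM'] := hM.
pose B : 'M[R]_2 := t^-1 *: (M + s%:M).
have B00 : B 0 0 = t^-1 * (a + s) by rewrite !mxE mulr1n.
have B01 : B 0 1 = t^-1 * b by rewrite !mxE mulr0n addr0.
have B10 : B 1 0 = t^-1 * b by rewrite !mxE mulr0n addr0 sym.
have B11 : B 1 1 = t^-1 * (c + s) by rewrite !mxE mulr1n.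
exists B; split.
- by rewrite /B linearZ /= linearD /= ms tr_scalar_mx.
- move=> x; have -> : dot x (mulmxv B x) = t^-1 * (dot x (mulmxv M x) + s * dot x x).
    by rewrite /mulmxv B00 B01 B10 B11 /dot /= sym -/a -/b -/c; ring.
  apply: mulr_ge0; first by rewrite invr_ge0 ltW.
  apply: addr_ge0; last by rewrite mulr_ge0 ?dot_ge0// ltW.
  by apply: le_trans (dot_ge x); rewrite mulr_ge0 ?dot_ge0// ltW.
have tn : t != 0 by rewrite gt_eqF.
have tt k : t^-1 * (t^-1 * (t ^+ 2 * k)) = k by field.
apply/matrixP; apply: ord2_ind; apply: ord2_ind;
  rewrite mulmx2E ?B00 ?B01 ?B10 ?B11 ?sym -[RHS]tt t2 -/a -/b -/c.
- transitivity (t^-1 * (t^-1 * (a ^+ 2 + 2 * a * s + s ^+ 2 + b ^+ 2))); first by ring.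
  by rewrite s2; ring.
- by ring.
- by ring.
- transitivity (t^-1 * (t^-1 * (c ^+ 2 + 2 * c * s + s ^+ 2 + b ^+ 2))); first by ring.
  by rewrite s2; ring.
Qed.

Lemma sqrtmx_enorm x : enorm (mulmxv (sqrtmx M) x) ^+ 2 = dot x (mulmxv M x).
Proof.
have [s _ e] := sqrtmx_spec.
by rewrite enorm_sqr -sym_dot// -mulmxvM e.
Qed.

(** An inverse of M, from the cofactors, gives one of its square root. *)
Lemma sqrtmx_unit : sqrtmx M \in unitmx.
Proof.
have [_ _ e] := sqrtmx_spec.
pose d := (a * c - b ^+ 2)^-1.
pose N : 'M[R]_2 := \matrix_(i, j) (if i == 0 then if j == 0 then d * c else - (d * b)
  else if j == 0 then - (d * b) else d * a).
have dd : d * (a * c - b ^+ 2) = 1 by rewrite mulVf// gt_eqF.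
have MN : M *m N = 1%:M.
  apply/matrixP; apply: ord2_ind; apply: ord2_ind; rewrite mulmx2E !mxE /= ?sym -/a -/b -/c ?mulr0n ?mulr1n.
  - by rewrite -dd; ring.
  - by ring.
  - by ring.
  - by rewrite -dd; ring.
by have [] := @mulmx1_unit _ _ (sqrtmx M) (sqrtmx M *m N) _; rewrite ?mulmxA ?e.
Qed.

Hypothesis alpha_beta : alpha <= beta.

(** Apply the bound |B x|^2 <= beta |x|^2 twice, B being the square root of M. *)
Lemma elliptic_enorm_le x : enorm (mulmxv M x) <= beta * enorm x.
Proof.
have b0 : 0 <= beta by exact: ltW (lt_le_trans _ alpha_beta).
apply: le_sqr_enorm; first by rewrite mulr_ge0 ?enorm_ge0.
have [_ _ e] := sqrtmx_spec; have [_ h] := hM.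
rewrite -enorm_sqr -[in leLHS]e mulmxvM sqrtmx_enorm.
have /andP[_ h1] := h (mulmxv (sqrtmx M) x); apply: le_trans h1 _.
rewrite sqrtmx_enorm; have /andP[_ h2] := h x.
by rewrite exprMn expr2 -mulrA ler_wpM2l.
Qed.

(** If B is the square root of M then B E = G, and |B E|^2 = E . M E lies between
alpha |E|^2 and beta |E|^2. *)
Lemma energy_residual y q : let G := y + mulmxv M q in
  let E := mulmxv (invmx (sqrtmx M)) y + mulmxv (sqrtmx M) q in
  enorm G <= Num.sqrt beta * enorm E /\ enorm E <= (Num.sqrt alpha)^-1 * enorm G.
Proof.
have b0 : 0 <= beta by exact: ltW (lt_le_trans _ alpha_beta).
move=> G E; have [_ _ e] := sqrtmx_spec; have [_ h] := hM.
have GE : mulmxv (sqrtmx M) E = G.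
  by rewrite /E mulmxvD -!mulmxvM mulmxV ?sqrtmx_unit// mulmxv1 e.
have := sqrtmx_enorm E; rewrite GE; have /andP[h1 h2] := h E => g2.
split.
  apply: le_sqr_enorm; first by rewrite mulr_ge0 ?sqrtr_ge0 ?enorm_ge0.
  by rewrite -enorm_sqr g2 exprMn sqr_sqrtr.
have sa : 0 < Num.sqrt alpha by rewrite sqrtr_gt0.
apply: le_sqr_enorm; first by rewrite mulr_ge0 ?invr_ge0 ?sqrtr_ge0 ?enorm_ge0.
by rewrite exprMn g2 exprVn sqr_sqrtr ?(ltW alpha0)// ler_pdivlMl// -enorm_sqr.
Qed.
End Elliptic.
End Matrices.

(** * The flux of the Dirac problem and the stability of the Dirichlet problem *)

Section ContinuousProblem.
Variable R : realType.
Local Notation mu := (mu2 R).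
Variables (Om : set (mplane R)) (A : plane R -> 'M[R]_2) (alpha beta p M : R) (x0 : plane R).
Hypotheses (mOm : measurable Om) (Omfin : (mu Om < +oo)%E) (M0 : 0 < M)
  (OmM : forall x : plane R, Om x -> `|x.1| < M /\ `|x.2| < M)
  (alpha0 : 0 < alpha) (alpha_beta : alpha <= beta)
  (hA : elliptic_coefficient Om A alpha beta) (hp : 1 < p < 2).

Let p1 : 1 < p. Proof. by move: hp => /andP[]. Qed.
Let p1' : 1 <= p. Proof. exact: ltW. Qed.

Lemma Om_off_box x : off_box M x -> ~ Om x.
Proof. by move=> [|] h /OmM[h1 h2]; [move: h1|move: h2]; rewrite ltNge h. Qed.

Lemma conj_exp_gt1 : 1 < conj_exp p.
Proof. by rewrite /conj_exp ltr_pdivlMr ?subr_gt0// mul1r gtrBl. Qed.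

Lemma conj_exp_inv : p^-1 + (conj_exp p)^-1 = 1.
Proof.
rewrite /conj_exp; have h : p != 0 by rewrite gt_eqF// (lt_trans _ p1).
have h' : p - 1 != 0 by rewrite gt_eqF// subr_gt0.
by field; rewrite h h'.
Qed.

Lemma ae_elliptic : {ae mu, forall x, Om x -> elliptic_matrix alpha beta (A x)}.
Proof.
by have [_] := hA; apply: filterS => x h /h[s e]; split.
Qed.

Lemma measurable_coefficient i j : measurable_fun Om (fun x => A x i j).
Proof.
have [/(_ i j) h _] := hA.
apply/(measurable_restrictT _ mOm).
by move: h; rewrite inE /= => /andP[]; rewrite inE.
Qed.

Lemma measurable_mulmxv (F : mplane R -> plane R) :
  measurable_fun Om (fst \o F) -> measurable_fun Om (snd \o F) ->
  measurable_fun Om (fst \o (fun x => mulmxv (A x) (F x))) /\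
  measurable_fun Om (snd \o (fun x => mulmxv (A x) (F x))).
Proof.
move=> m1 m2; split; apply: measurable_funD; apply: measurable_funM => //; exact: measurable_coefficient.
Qed.

Lemma Lpv_mulmxv q (F : mplane R -> plane R) : 1 <= q -> Lpv Om q F -> Lpv Om q (fun x => mulmxv (A x) (F x)).
Proof.
move=> q1 hF; have [m1 m2] := measurable_mulmxv (Lpv_measurable1 mOm hF) (Lpv_measurable2 mOm hF).
apply/LpvP => //.
apply: (@Lp_dom _ _ _ _ (fun x => beta * enorm (F x))) => //.
- exact: lt_le_trans q1.
- exact: measurable_enorm.
- by apply: LpZ => //; exact: Lpv_enorm.
apply: filterS ae_elliptic => x h /h hx.
rewrite ger0_norm ?enorm_ge0// (le_trans _ (ler_norm _))//.
exact: elliptic_enorm_le hx alpha_beta _.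
Qed.

Lemma Lpvnorm_mulmxv q (F : mplane R -> plane R) : 1 <= q -> Lpv Om q F ->
  (Lpvnorm Om q (fun x => mulmxv (A x) (F x)) <= beta%:E * Lpvnorm Om q F)%E.
Proof.
move=> q1 hF; apply: Lpvnorm_ae_le => //; first exact: ltW (lt_le_trans alpha0 alpha_beta).
apply: filterS ae_elliptic => x h /h hx.
exact: elliptic_enorm_le hx alpha_beta _.
Qed.

Lemma Lpv_dirac_field : Lpv Om p (dirac_field x0).
Proof.
apply: (dirac_field_Lp _ M0) => // x /OmM[h1 h2]; apply/boxP; split; exact: ltW.
Qed.

Lemma dirac_field_test phi : test_function Om phi ->
  \int[mu]_(x in Om) dot (dirac_field x0 x) (grad phi x) = - phi x0.
Proof.
move=> /test_functionP[phi1 [phi2 [-> _ _ hC [K [cK KO hK]]]]].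
have [N N0 hN] := supp_off_box cK hK.
rewrite Rintegral_off; last first.
  by move=> x nx; have [] := hK x (fun h => nx (KO _ h)) => _ h1 h2; rewrite /dot /= h1 h2 !mulr0 addr0.
by rewrite /Rintegral (dirac_divergence x0 N0 hC hN).
Qed.

Lemma test_function0 : test_function Om (fun _ => 0).
Proof.
split; last by exists set0; split => //; exact: compact0.
have h v : 'D_v (fun _ : plane R => 0 : R) = (fun _ => 0).
  by apply/funext => x; rewrite derive_val.
elim=> [|n IH]; split => //; try by move=> x; exact: cvg_cst.
split; [|by rewrite h|by rewrite h].
by move=> x; split; exact: derivable_cst.
Qed.

Lemma W10_0 q : 1 <= q -> W10 Om q 0.
Proof.
move=> q1; have := test_function_W10 mOm Omfin q1 test_function0.
congr W10; congr pair; apply/funext => x; rewrite /grad.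
by congr pair; rewrite derive_val.
Qed.

(** Traces are classes modulo W^{1,q}_0, so that equality of traces is membership
of the difference. *)
Lemma W10_of_trace q (v w : sobfun R) (g : set (sobfun R)) : 1 <= q -> W1 Om q v ->
  trace Om q v = g -> trace Om q w = g -> W10 Om q (w - v).
Proof.
move=> q1 hv tv tw.
have : trace Om q w v by rewrite tw -tv; split => //; rewrite subrr; exact: W10_0.
by case.
Qed.
Variables (f1 : plane R -> R) (g : set (sobfun R)) (u : sobfun R).
Hypotheses (hf1 : Lp Om p f1) (hu : dirac_solution Om A p x0 f1 g u).

Lemma Lpv_flux : Lpv Om p (flux A x0 u).
Proof.
have [[_ hu2 _] _ _] := hu.
apply: LpvB => //; last exact: Lpv_dirac_field.
by apply: LpvN => //; exact: Lpv_mulmxv.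
Qed.

(** Testing the equation for u against phi produces the value phi x0, which is
cancelled by the divergence of the Dirac field. *)
Lemma flux_divergence : weak_divergence Om (flux A x0 u, f1).
Proof.
move=> phi tphi; have [[_ hu2 _] _ hE] := hu.
have q1 := conj_exp_gt1; have pq := conj_exp_inv.
have := hE _ (test_function_W10 mOm Omfin (ltW q1) tphi) _ => /= hE'.
have cphi : {within Om, continuous phi}.
  by apply: continuous_subspaceT; have [/(_ 0%N)[c _] _] := tphi; exact: c.
have {}hE' := hE' cphi.
have [_ Lg] := test_function_Lp mOm Omfin (ltW q1) tphi.
have i1 := Lpv_dot_integrable mOm p1' (ltW q1) pq (Lpv_mulmxv p1' hu2) Lg.
have i2 := Lpv_dot_integrable mOm p1' (ltW q1) pq Lpv_dirac_field Lg.
have -> : \int[mu]_(x in Om) (f1 x * phi x) = \int[mu]_(x in Om) dot (mulmxv (A x) (u.2 x)) (grad phi x)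
    + \int[mu]_(x in Om) dot (dirac_field x0 x) (grad phi x).
  by rewrite hE' dirac_field_test// addrK.
rewrite -(RintegralD mOm i1 i2) -mulN1r -RintegralZl//; last exact: (integrableD mOm i1 i2).
apply: eq_Rintegral => x _; rewrite /flux dotBl dotNl.
by move: (dot _ _) (dot (dirac_field _ _) _) => a b; ring.
Qed.

(** By density from test functions, for which it is the difference of the two weak
divergences. *)
Lemma flux_residual (t : divfield R) (chi : sobfun R) : Hdiv Om t -> W10 Om (conj_exp p) chi ->
  \int[mu]_(x in Om) dot ((flux A x0 u - t.1) x) (chi.2 x)
  + \int[mu]_(x in Om) ((f1 - t.2) x * chi.1 x) = 0.
Proof.
move=> [t1 t2 td] hchi; have q1 := conj_exp_gt1; have pq := conj_exp_inv.
have p2 : p <= 2 by move: hp => /andP[_ /ltW].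
have t1p := Lpv_sub mOm Omfin p1' p2 t1; have t2p := Lp_sub mOm Omfin p1' p2 t2.
apply: (W10_density mOm Omfin p1 q1 pq _ _ _ hchi).
- by apply: LpvB => //; exact: Lpv_flux.
- by apply: LpB.
move=> phi tphi; have := flux_divergence tphi; have := td _ tphi => /=.
have [Lf Lg] := test_function_Lp mOm Omfin (ltW q1) tphi.
have i1 := Lpv_dot_integrable mOm p1' (ltW q1) pq Lpv_flux Lg.
have i2 := Lpv_dot_integrable mOm p1' (ltW q1) pq t1p Lg.
have i3 := Lp_hoelder_integrable mOm (lt_trans ltr01 p1) (lt_trans ltr01 q1) pq hf1 Lf.
have i4 := Lp_hoelder_integrable mOm (lt_trans ltr01 p1) (lt_trans ltr01 q1) pq t2p Lf.
move=> e2 e1.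
transitivity (\int[mu]_(x in Om) (dot (flux A x0 u x) (grad phi x) - dot (t.1 x) (grad phi x))
    + \int[mu]_(x in Om) (f1 x * phi x - t.2 x * phi x)).
  by congr (_ + _); apply: eq_Rintegral => x _; rewrite ?dotBl// -mulrBl.
by rewrite RintegralB// RintegralB// e1 e2; ring.
Qed.
End ContinuousProblem.

Section APriori.
Variable R : realType.
Local Notation mu := (mu2 R).
Variables (Om : set (mplane R)) (A : plane R -> 'M[R]_2) (alpha beta p Creg : R).
Hypotheses (mOm : measurable Om) (Omfin : (mu Om < +oo)%E)
  (alpha0 : 0 < alpha) (alpha_beta : alpha <= beta)
  (hA : elliptic_coefficient Om A alpha beta) (hp : 1 < p < 2)
  (hreg : W1_well_posed Om A p Creg).

Let p1 : 1 < p. Proof. by move: hp => /andP[]. Qed.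
Let p1' : 1 <= p. Proof. exact: ltW. Qed.
Let q1 : 1 < conj_exp p. Proof. exact: conj_exp_gt1. Qed.
Let q1' : 1 <= conj_exp p. Proof. exact: ltW. Qed.

Let energy (z : sobfun R) (v : sobfun R) : R :=
  \int[mu]_(x in Om) dot (mulmxv (A x) (z.2 x)) (v.2 x).

Let energy_integrable (z v : sobfun R) : Lpv Om p z.2 -> W10 Om (conj_exp p) v ->
  mu.-integrable Om (fun x => (dot (mulmxv (A x) (z.2 x)) (v.2 x))%:E).
Proof.
move=> hz [[_ hv _] _].
exact: (Lpv_dot_integrable mOm p1' q1' (conj_exp_inv hp) (Lpv_mulmxv mOm alpha0 alpha_beta hA p1' hz) hv).
Qed.

(** The right hand side that z itself solves; it is a bounded functional by
Holder's inequality. *)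
Lemma energy_dual (z : sobfun R) : W10 Om p z -> dual_W10 Om (conj_exp p) (energy z).
Proof.
move=> [[_ hz _] _]; split.
  move=> a v v' hv hv'; have i1 := energy_integrable hz hv; have i2 := energy_integrable hz hv'.
  rewrite /energy -RintegralZl// -RintegralD//; last exact: (integrableZl mOm a i1).
  by apply: eq_Rintegral => x _; rewrite dotDr dotZr.
have hAz := Lpv_mulmxv mOm alpha0 alpha_beta hA p1' hz.
have fin := Lpvnorm_fin mOm p1' hAz.
have ge0 : (0 <= Lpvnorm Om p (fun x => mulmxv (A x) (z.2 x)))%E by exact: Lpnorm_ge0.
exists (fine (Lpvnorm Om p (fun x => mulmxv (A x) (z.2 x)))) => v [[hv1 hv2 _] _].
have := Lpv_dot_le mOm p1' q1' (conj_exp_inv hp) hAz hv2 => /le_trans; apply.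
rewrite fineK ?ge0_fin_numE//; apply: lee_pmul => //; first exact: Lpnorm_ge0.
by have [] := W1norm_ge mOm q1' hv1 hv2.
Qed.

(** The case in which the supremum that defines the dual norm is over the empty
set: then the test functions vanish, hence also their gradients, and by
density also that of z. *)
Lemma W10_trivial_gradient (z : sobfun R) : W10 Om p z ->
  (forall v, W10 Om (conj_exp p) v -> {ae mu, forall x, Om x -> v.1 x = 0}) ->
  (Lpvnorm Om p z.2 <= 0)%E.
Proof.
move=> hz triv.
apply/lee_addgt0Pr => e e0; rewrite add0e.
have [phi [tphi _ h]] := W10_approx mOm Omfin p1' hz e0.
apply: le_trans h; apply: Lpnorm_ae_le; first exact: lt_trans p1.
have W := test_function_W10 mOm Omfin q1' tphi.
have := W10_gradient_unique mOm Omfin q1 W (W10_0 mOm Omfin q1') (triv _ W).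
apply: filterS => x h Ox; have {}h : grad phi x = 0 by exact: h Ox.
have -> : (z.2 - grad phi) x = z.2 x by transitivity (z.2 x - grad phi x); rewrite // h subr0.
exact: lexx.
Qed.

(** By uniqueness z agrees with the solution that well-posedness provides, and
their gradients agree by [W10_gradient_unique]. The constant Creg may have any
sign in the hypothesis. As the dual norm lies in [-K, K] when it is a supremum
over a nonempty set, the bound holds with |Creg| K. *)
Lemma stability (z : sobfun R) (K : R) : 0 <= K -> W10 Om p z ->
  (forall v, W10 Om (conj_exp p) v -> (`|energy z v|%:E <= K%:E * Lpvnorm Om (conj_exp p) v.2)%E) ->
  (Lpvnorm Om p z.2 <= (`|Creg| * K)%:E)%E.
Proof.
move=> K0 hz bound.
have [z' [[hz' ez'] uniq' le']] := hreg (energy_dual hz).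
have zz' : {ae mu, forall x, Om x -> z.2 x = z'.2 x}.
  by apply: (W10_gradient_unique mOm Omfin p1 hz hz'); apply: uniq'; split.
have -> : Lpvnorm Om p z.2 = Lpvnorm Om p z'.2.
  apply: Lpnorm_ae_eq; first exact: lt_trans p1.
  by apply: filterS zz' => x h /h ->.
have [triv|] := pselect (forall v, W10 Om (conj_exp p) v -> {ae mu, forall x, Om x -> v.1 x = 0}).
  by apply: le_trans (W10_trivial_gradient hz' triv) _; rewrite lee_fin mulr_ge0.
move=> /existsNP[v /not_implyP[hv nv]].
have quot w : W10 Om (conj_exp p) w -> `|energy z w / fine (Lpvnorm Om (conj_exp p) w.2)| <= K.
  move=> hw; have [[_ hw2 _] _] := hw; have := bound _ hw.
  have f := Lpvnorm_fin mOm q1' hw2; have g0 : (0 <= Lpvnorm Om (conj_exp p) w.2)%E by exact: Lpnorm_ge0.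
  rewrite -{1}(fineK (_ : Lpvnorm Om (conj_exp p) w.2 \is a fin_num)) ?ge0_fin_numE//.
  rewrite -EFinM lee_fin => h; have := fine_ge0 g0.
  rewrite le_eqVlt => /predU1P[<-|r0]; first by rewrite invr0 mulr0 normr0.
  by rewrite normrM normfV (gtr0_norm r0) ler_pdivrMr.
have ub : (dual_norm Om (conj_exp p) (energy z) <= K%:E)%E.
  apply: ge_ereal_sup => _ [w [hw _] <-]; rewrite lee_fin.
  by apply: le_trans (ler_norm _) (quot _ hw).
have lb : ((- K)%:E <= dual_norm Om (conj_exp p) (energy z))%E.
  apply: (@le_trans _ _ (energy z v / fine (Lpvnorm Om (conj_exp p) v.2))%:E).
    by rewrite lee_fin; have := quot _ hv; rewrite ler_norml => /andP[].
  by apply: ereal_sup_ubound; exists v.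
apply: le_trans le' _; move: ub lb; rewrite -/(energy z).
move: (dual_norm Om (conj_exp p) (energy z)) => [r| |] //; rewrite !lee_fin => h1 h2.
rewrite (le_trans (ler_norm _))// normrM ler_wpM2l// ler_norml.
by rewrite h1 h2.
Qed.
End APriori.

(** * Estimator, residuals and errors *)

Section Estimator.
Variable R : realType.
Local Notation mu := (mu2 R).
Variables (Om : set (mplane R)) (T : seq (3.-tuple (plane R))) (A : plane R -> 'M[R]_2)
  (alpha beta p : R).
Hypotheses (oOm : open (Om : set (plane R))) (lip : lipschitz_boundary Om)
  (hT : triangulation Om T) (alpha0 : 0 < alpha) (alpha_beta : alpha <= beta)
  (hA : elliptic_coefficient Om A alpha beta) (p1 : 1 <= p).

Let p0 : 0 < p. Proof. exact: lt_le_trans p1. Qed.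

Let mOm : measurable Om. Proof. exact: open_measurable_plane. Qed.

(** Raised to the power p, the norm is additive over the cells. *)
Lemma Lpnorm_triangulation f : measurable_fun Om f ->
  (Lpnorm Om p f `^ p = \sum_(K <- T) Lpnorm (cell K) p f `^ p)%E.
Proof.
move=> mf; rewrite LpnormE ?gt_eqF//.
rewrite (triangulation_integral oOm lip hT (f := fun x => (`|f x| `^ p)%:E)).
- by apply: eq_bigr => K _; rewrite LpnormE ?gt_eqF.
- by move=> x; rewrite lee_fin powR_ge0.
apply/measurable_EFinP; apply: (@measurableT_comp _ _ _ _ _ _ (fun t : R => t `^ p)).
  exact: measurable_powR.
exact: measurableT_comp.
Qed.

Variables (y q : mplane R -> plane R) (d : mplane R -> R).

Let G := (y + (fun x => mulmxv (A x) (q x)))%R.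
Let E : mplane R -> plane R := fun x =>
  mulmxv (invmx (sqrtmx (A x))) (y x) + mulmxv (sqrtmx (A x)) (q x).

Hypotheses (LG : Lpv Om p G) (Ld : Lp Om p d).

Let ae_residual K : K \in T -> {ae mu, forall x, cell K x ->
  enorm (G x) <= Num.sqrt beta * enorm (E x) /\
  enorm (E x) <= (Num.sqrt alpha)^-1 * enorm (G x)}.
Proof.
move=> KT; apply: filterS (ae_elliptic hA) => x h /(cell_sub lip hT KT)/h hx.
exact: energy_residual hx alpha_beta _ _.
Qed.

Let Lp_cell K (f : mplane R -> R) : K \in T -> Lp Om p f -> Lp (cell K) p f.
Proof.
move=> KT /(LpP _ _ mOm)[mf ff]; have mK := measurable_cell K.
have mK' : measurable_fun (cell K) f by apply: measurable_funS mf => //; exact: cell_sub KT.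
apply: Lp_int => //; apply: le_lt_trans (poweR_lty p ff); rewrite LpnormE ?gt_eqF//.
apply: ge0_subset_integral => //; last exact: cell_sub KT.
apply/measurable_EFinP; apply: (@measurableT_comp _ _ _ _ _ _ (fun t : R => t `^ p)).
  exact: measurable_powR.
exact: measurableT_comp.
Qed.

Let k : R := Num.max 1 (Num.max (Num.sqrt beta) (Num.sqrt alpha)^-1).

Let S : \bar R := (\sum_(K <- T) (Lpvnorm (cell K) p E `^ p + Lpnorm (cell K) p d `^ p))%E.

Let N : \bar R := ((Lpvnorm Om p G `^ p + Lpnorm Om p d `^ p) `^ p^-1)%E.

(** Cell by cell, G and E are comparable by [energy_residual] with constants that
depend on alpha and beta only. *)
Lemma residual_estimator : (N <= k%:E * S `^ p^-1)%E /\ (S `^ p^-1 <= k%:E * N)%E.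
Proof.
have LeG := Lpv_enorm mOm p1 LG.
have NE : N = ((\sum_(K <- T) (Lpvnorm (cell K) p G `^ p + Lpnorm (cell K) p d `^ p)) `^ p^-1)%E.
  rewrite /N /Lpvnorm (Lpnorm_triangulation (Lp_measurable mOm LeG)).
  by rewrite (Lpnorm_triangulation (Lp_measurable mOm Ld)) big_split.
have k1 : 1 <= k by rewrite /k le_max lexx.
have k0 : 0 <= k by exact: le_trans k1.
have b0 : 0 < Num.sqrt beta by rewrite sqrtr_gt0 (lt_le_trans alpha0).
have a0 : 0 < (Num.sqrt alpha)^-1 by rewrite invr_gt0 sqrtr_gt0.
have nn (f : mplane R -> R) D : (0 <= Lpnorm D p f)%E by exact: Lpnorm_ge0.
have nnv (F : mplane R -> plane R) D : (0 <= Lpvnorm D p F)%E by exact: Lpnorm_ge0.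
have selfk (x : \bar R) : (0 <= x -> x <= k%:E * x)%E.
  by move=> x0; rewrite -[leLHS]mul1e lee_wpmul2r// lee_fin.
have ck (c : R) (a b : \bar R) : (c <= k)%R -> (0 <= b -> a <= c%:E * b -> a <= k%:E * b)%E.
  by move=> h b0' /le_trans; apply; rewrite lee_wpmul2r// lee_fin.
rewrite NE; split; apply: pnorm_sum_le => // K KT; split => //; try exact: selfk.
- apply: (ck (Num.sqrt beta)) => //; first by rewrite /k !le_max lexx !orbT.
  have LK := Lp_cell KT LeG.
  have h : ((Num.sqrt beta)^-1%:E * Lpvnorm (cell K) p G <= Lpvnorm (cell K) p E)%E.
    rewrite -[X in (X%:E * _)%E]ger0_norm ?invr_ge0 ?(ltW b0)// -LpnormZ//.
    apply: Lpnorm_ae_le => //; apply: filterS (ae_residual KT) => x hx /hx[e1 e2].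
    rewrite ger0_norm ?mulr_ge0 ?invr_ge0 ?(ltW b0) ?enorm_ge0//.
    by rewrite ger0_norm ?enorm_ge0// ler_pdivrMl.
  rewrite -[leLHS]mul1e -(mulfV (lt0r_neq0 b0)) EFinM -muleA.
  by apply: lee_wpmul2l => //; rewrite lee_fin ltW.
- apply: (ck (Num.sqrt alpha)^-1) => //; first by rewrite /k !le_max lexx !orbT.
  have LK := Lp_cell KT LeG.
  rewrite -[X in (_ <= X%:E * _)%E](ger0_norm (ltW a0)) -LpnormZ//.
  apply: Lpnorm_ae_le => //; apply: filterS (ae_residual KT) => x hx /hx[e1 e2].
  rewrite ger0_norm ?enorm_ge0// ger0_norm//.
  by rewrite mulr_ge0 ?(ltW a0) ?enorm_ge0.
Qed.
End Estimator.

(** The letters stand for the norms of the residuals (nG, nd), of the gradient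
error (nz), of the flux error (ns), for the W^{1,p} error (b), and for the
l^p combination of the residuals (n); c stands for |Creg|. *)
Lemma combine_errors (R : realType) (beta c M nG nd nz ns b n : R) :
  0 <= beta -> 0 <= c -> 0 < M -> 0 <= nG -> 0 <= nd -> 0 <= nz -> 0 <= ns ->
  nz <= c * (nG + 2 * M * nd) -> b <= (2 * M + 1) * nz -> nz <= b ->
  ns <= beta * nz + nG -> nG <= beta * nz + ns ->
  nG <= n -> nd <= n -> n <= nG + nd ->
  let C := beta * c * (1 + 2 * M) + 1 + (2 * M + 1) * (c * (1 + 2 * M)) + 1 in
  ns + b + nd <= 2 * C * n /\ n <= (1 + beta) * (ns + b + nd).
Proof.
move=> beta0 c0 M0 nG0 nd0 nz0 ns0 g1 w1 w2 s1 r1 N1 N2 N3 C.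
have mG : 0 <= M * nG := mulr_ge0 (ltW M0) nG0.
have g2 : nz <= c * ((1 + 2 * M) * (nG + nd)).
  by apply: le_trans g1 _; apply: ler_wpM2l => //; lra.
have m0 : 0 <= 2 * M + 1 by lra.
split.
  have h : ns + b + nd <= C * (nG + nd).
    have := ler_wpM2l beta0 g2; have := ler_wpM2l m0 g2 => h1 h2.
    by rewrite /C; lra.
  apply: le_trans h _; rewrite [2 * C]mulrC -mulrA; apply: ler_wpM2l; last by lra.
  have m1 : 0 <= 1 + 2 * M by lra.
  by rewrite /C !addr_ge0// !mulr_ge0.
have h1 := ler_wpM2l beta0 w2.
have h2 : 0 <= beta * ns by exact: mulr_ge0.
have h3 : 0 <= beta * nd by exact: mulr_ge0.
by apply: le_trans N3 _; lra.
Qed.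

Section ErrorBounds.
Variable R : realType.
Local Notation mu := (mu2 R).
Variables (Om : set (mplane R)) (A : plane R -> 'M[R]_2) (alpha beta p M Creg : R) (x0 : plane R).
Hypotheses (mOm : measurable Om) (Omfin : (mu Om < +oo)%E) (M0 : 0 < M)
  (OmM : forall x : plane R, Om x -> `|x.1| < M /\ `|x.2| < M)
  (alpha0 : 0 < alpha) (alpha_beta : alpha <= beta)
  (hA : elliptic_coefficient Om A alpha beta) (hp : 1 < p < 2)
  (hreg : W1_well_posed Om A p Creg).
Variables (f1 : plane R -> R) (g : set (sobfun R)) (u : sobfun R).
Hypotheses (hf1 : Lp Om p f1) (hu : dirac_solution Om A p x0 f1 g u).
Variables (t : divfield R) (w : sobfun R).
Hypotheses (ht : Hdiv Om t) (hw : W1 Om p w) (hwg : trace Om p w = g).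

Let p1 : 1 < p. Proof. by move: hp => /andP[]. Qed.
Let p1' : 1 <= p. Proof. exact: ltW. Qed.
Let q1 : 1 < conj_exp p. Proof. exact: conj_exp_gt1. Qed.
Let q1' : 1 <= conj_exp p. Proof. exact: ltW. Qed.
Let pq : p^-1 + (conj_exp p)^-1 = 1. Proof. exact: conj_exp_inv. Qed.
Let p2 : p <= 2. Proof. by move: hp => /andP[_ /ltW]. Qed.
Let p0 : 0 < p. Proof. exact: lt_trans p1. Qed.

Let d : mplane R -> R := f1 - t.2.
Let G : mplane R -> plane R := ((fun x => t.1 x + dirac_field x0 x) + (fun x => mulmxv (A x) (w.2 x)))%R.
Let z : sobfun R := w - u.
Let s : mplane R -> plane R := flux A x0 u - t.1.

Let Lw : Lpv Om p w.2. Proof. by have [] := hw. Qed.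
Let Lt : Lpv Om p t.1. Proof. by have [h _ _] := ht; exact: Lpv_sub h. Qed.

Lemma residual_Lpv : Lpv Om p G.
Proof.
apply: LpvD => //; last exact: (Lpv_mulmxv mOm alpha0 alpha_beta hA p1' Lw).
by apply: LpvD => //; exact: (Lpv_dirac_field _ mOm M0 OmM hp).
Qed.

Lemma residual_Lp : Lp Om p d.
Proof. by apply: LpB => //; have [_ h _] := ht; exact: Lp_sub h. Qed.

Let Ls : Lpv Om p s.
Proof. by apply: LpvB => //; exact: (Lpv_flux mOm M0 OmM alpha0 alpha_beta hA hp hu). Qed.

Let hz : W10 Om p z.
Proof. by have [u1 tu _] := hu; exact: (W10_of_trace mOm Omfin p1' u1 tu hwg). Qed.

Let Lz : Lpv Om p z.2. Proof. by have [[]] := hz. Qed.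
Let LAz : Lpv Om p (fun x => mulmxv (A x) (z.2 x)).
Proof. exact: (Lpv_mulmxv mOm alpha0 alpha_beta hA p1' Lz). Qed.

Lemma residual_splitE x : mulmxv (A x) (z.2 x) = G x + s x.
Proof.
have -> : z.2 x = w.2 x - u.2 x by [].
rewrite mulmxvB.
transitivity ((t.1 x + dirac_field x0 x + mulmxv (A x) (w.2 x))
  + (- mulmxv (A x) (u.2 x) - dirac_field x0 x - t.1 x)); last by [].
move: (mulmxv _ _) (mulmxv _ _) (dirac_field _ _) (t.1 x) => a b c e.
by rewrite addrACA -[c in X in _ = X + _]opprK; apply: injective_projections => /=; ring.
Qed.

Let nG := fine (Lpvnorm Om p G). Let nd := fine (Lpnorm Om p d).
Let nz := fine (Lpvnorm Om p z.2). Let ns := fine (Lpvnorm Om p s).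

Let finv (F : mplane R -> plane R) : Lpv Om p F -> (fine (Lpvnorm Om p F))%:E = Lpvnorm Om p F.
Proof.
by move=> hF; rewrite fineK// ge0_fin_numE ?Lpnorm_ge0//; exact: Lpvnorm_fin.
Qed.
Let find : nd%:E = Lpnorm Om p d. Proof. by rewrite fineK//; apply: Lp_fin_num; exact: residual_Lp. Qed.

Let nG0 : 0 <= nG. Proof. by apply: fine_ge0; exact: Lpnorm_ge0. Qed.
Let nd0 : 0 <= nd. Proof. by apply: fine_ge0; exact: Lpnorm_ge0. Qed.

(** Holder's and Poincare's inequalities bound the functional that z solves, and
[stability] concludes. *)
Lemma gradient_error : nz <= `|Creg| * (nG + 2 * M * nd).
Proof.
rewrite -lee_fin /nz finv//; apply: (stability mOm Omfin alpha0 alpha_beta hA hp hreg) => //.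
  by rewrite addr_ge0// mulr_ge0// mulr_ge0// ltW.
move=> v hv; have [[Lv1 Lv2 _] _] := hv.
have i1 := Lpv_dot_integrable mOm p1' q1' pq residual_Lpv Lv2.
have i2 := Lpv_dot_integrable mOm p1' q1' pq Ls Lv2.
have := flux_residual mOm Omfin M0 OmM alpha0 alpha_beta hA hp hf1 hu ht hv.
move=> /eqP; rewrite addr_eq0 => /eqP e.
have -> : \int[mu]_(x in Om) dot (mulmxv (A x) (z.2 x)) (v.2 x) =
    \int[mu]_(x in Om) dot (G x) (v.2 x) - \int[mu]_(x in Om) (d x * v.1 x).
  rewrite -e -RintegralD//; apply: eq_Rintegral => x _.
  by rewrite residual_splitE dotDl.
have h1 := Lpv_dot_le mOm p1' q1' pq residual_Lpv Lv2.
have h2 := Lp_hoelder_le mOm p0 (lt_trans ltr01 q1) pq residual_Lp Lv1.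
have h3 := W10_poincare mOm Omfin (ltW M0) q1 (Om_off_box OmM) hv.
have fv : Lpvnorm Om (conj_exp p) v.2 \is a fin_num.
  by rewrite ge0_fin_numE ?Lpnorm_ge0//; exact: Lpvnorm_fin.
apply: le_trans (_ : `|\int[mu]_(x in Om) dot (G x) (v.2 x)|%:E + `|\int[mu]_(x in Om) (d x * v.1 x)|%:E <= _)%E.
  by rewrite -EFinD lee_fin ler_normB.
apply: le_trans (leeD h1 h2) _.
apply: le_trans (leeD (lexx _) (lee_wpmul2l (Lpnorm_ge0 _ _ _) h3)) _.
rewrite -(finv residual_Lpv) -find -(fineK fv) -!EFinM -EFinD lee_fin.
rewrite -/nG le_eqVlt; apply/orP; left; apply/eqP; ring.
Qed.

Lemma W1_error : (W1norm Om p (u - w)%R <= ((2 * M + 1) * nz)%:E)%E /\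
  (nz%:E <= W1norm Om p (u - w)%R)%E.
Proof.
have [[Lz1 _ _] _] := hz.
have e1 : (u - w)%R.1 = - z.1 by apply/funext => x; rewrite /z /=; exact: (esym (opprB (w.1 x) (u.1 x))).
have e2 : (u - w)%R.2 = - z.2 by apply/funext => x; exact: (esym (opprB (w.2 x) (u.2 x))).
have L1 : Lp Om p (u - w)%R.1 by rewrite e1; exact: LpN.
have L2 : Lpv Om p (u - w)%R.2 by rewrite e2; exact: LpvN.
split.
  apply: le_trans (W1norm_le mOm p1' L1 L2) _.
  rewrite e1 e2 LpnormN// LpvnormN// mulrDl mul1r EFinD EFinM (finv Lz) leeD2r//.
  exact: (W10_poincare mOm Omfin (ltW M0) p1 (Om_off_box OmM) hz).
by have [_] := W1norm_ge mOm p1' L1 L2; rewrite e2 LpvnormN// (finv Lz).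
Qed.

Lemma flux_error : ns <= beta * nz + nG.
Proof.
rewrite -lee_fin EFinD EFinM (finv Ls) (finv Lz) (finv residual_Lpv).
have -> : s = (fun x => mulmxv (A x) (z.2 x)) - G.
  by apply/funext => x; rewrite -[RHS]/(mulmxv (A x) (z.2 x) - G x) residual_splitE addrC addKr.
apply: le_trans (Lpvnorm_triangle mOm p1' LAz (LpvN p1' residual_Lpv)) _.
by rewrite LpvnormN// leeD2r//; exact: (Lpvnorm_mulmxv mOm alpha0 alpha_beta hA p1' Lz).
Qed.

Lemma residual_le : nG <= beta * nz + ns.
Proof.
rewrite -lee_fin EFinD EFinM (finv Ls) (finv Lz) (finv residual_Lpv).
have -> : G = (fun x => mulmxv (A x) (z.2 x)) - s.
  by apply/funext => x; rewrite -[RHS]/(mulmxv (A x) (z.2 x) - s x) residual_splitE addrK.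
apply: le_trans (Lpvnorm_triangle mOm p1' LAz (LpvN p1' Ls)) _.
by rewrite LpvnormN// leeD2r//; exact: (Lpvnorm_mulmxv mOm alpha0 alpha_beta hA p1' Lz).
Qed.

Let Cerr := beta * `|Creg| * (1 + 2 * M) + 1 + (2 * M + 1) * (`|Creg| * (1 + 2 * M)) + 1.

Let err := (Lpvnorm Om p (flux A x0 u - t.1)%R + W1norm Om p (u - w)%R + Lpnorm Om p (f1 - t.2)%R)%E.
Let N : \bar R := ((Lpvnorm Om p G `^ p + Lpnorm Om p d `^ p) `^ p^-1)%E.

(** The l^p combination of the two residual norms is an intermediate quantity: it
is comparable to the error here, and to the estimator in
[residual_estimator]. *)
Lemma error_residual : (err <= (2 * Cerr)%:E * N)%E /\ (N <= (1 + beta)%:E * err)%E.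
Proof.
have beta0 : 0 <= beta by exact: ltW (lt_le_trans alpha0 alpha_beta).
have NE : N = ((nG `^ p + nd `^ p) `^ p^-1)%:E.
  by rewrite /N -(finv residual_Lpv) -find !poweR_EFin.
have N1 := le_pnorm nG0 nd0 p1'; have N2 := le_pnorm nd0 nG0 p1'.
rewrite [nd `^ _ + _]addrC in N2.
have N3 := pnorm_le nG0 nd0 p1'.
have [w1 w2] := W1_error.
have s1 := flux_error; have r1 := residual_le; have g1 := gradient_error.
have ns0 : 0 <= ns by apply: fine_ge0; exact: Lpnorm_ge0.
have nz0 : 0 <= nz by apply: fine_ge0; exact: Lpnorm_ge0.
have c0 : 0 <= `|Creg| by [].
rewrite NE; move: w1 w2; rewrite /err -(finv Ls) -/ns -find.
have := poweR_ge0 (Lpnorm Om p (u - w)%R.1 `^ p + Lpvnorm Om p (u - w)%R.2 `^ p)%E p^-1.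
rewrite -/(W1norm Om p (u - w)%R); case: (W1norm Om p (u - w)%R) => [b| |] //; rewrite !lee_fin => b0 w1 w2.
set n := (_ `^ p^-1) in N1 N2 N3 *.
exact: (combine_errors beta0 c0 M0 nG0 nd0 nz0 ns0 g1 w1 w2 s1 r1 N1 N2 N3).
Qed.
End ErrorBounds.

(** * The two-sided a posteriori estimate *)

Theorem theorem7p5 (R : realType) (Om : set (plane R)) (x0 : plane R)
    (A : plane R -> 'M[R]_2) (alpha beta p Creg : R)
    (f1 : plane R -> R) (g : set (sobfun R)) (u : sobfun R)
    (hOm : bounded_sc_lipschitz_domain Om) (hx0 : Om x0)
    (halpha : 0 < alpha <= beta) (hA : elliptic_coefficient Om A alpha beta)
    (hp : 1 < p < 2)
    (hf1 : Lp Om p f1) (hg : trace_space Om p g)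
    (hu : unique_dirac_solution Om A p x0 f1 g u)
    (hreg : W1_well_posed Om A p Creg) :
  forall kappa : R, exists c C : R, [/\ 0 < c, 0 < C &
    forall (T : seq (3.-tuple (plane R))) (sigmah : divfield R)
        (uh : plane R -> R),
      triangulation Om T -> shape_regular kappa T ->
      unique_mixed_solution Om A x0 f1 g T sigmah uh ->
    forall w : sobfun R, W1 Om p w -> trace Om p w = g ->
      let eta := estimator A p x0 f1 T sigmah w in
      let err := (Lpvnorm Om p (flux A x0 u - sigmah.1)%R
                  + W1norm Om p (u - w)%R
                  + Lpnorm Om p (f1 - sigmah.2)%R)%E in
      (c%:E * eta <= err /\ err <= C%:E * eta)%E].
Proof.
move=> kappa; have [[oOm _ _] bOm _ lip] := hOm.
have /andP[alpha0 alpha_beta] := halpha.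
have p1 : 1 <= p by move: hp => /andP[/ltW].
have beta0 : 0 < beta by exact: lt_le_trans alpha_beta.
have mOm : measurable (Om : set (mplane R)) by exact: open_measurable_plane.
have Omfin : (mu2 R Om < +oo)%E by exact: bounded_fin_measure.
have [M M0 OmM] := bounded_box bOm.
pose k := Num.max 1 (Num.max (Num.sqrt beta) (Num.sqrt alpha)^-1).
have k0 : 0 < k by rewrite lt_max ltr01.
pose Cerr := beta * `|Creg| * (1 + 2 * M) + 1 + (2 * M + 1) * (`|Creg| * (1 + 2 * M)) + 1.
have Cerr0 : 0 < Cerr.
  have m0 : 0 <= 1 + 2 * M by rewrite addr_ge0// mulr_ge0// ltW.
  have m1 : 0 <= 2 * M + 1 by rewrite addrC.
  have h1 : 0 <= beta * `|Creg| * (1 + 2 * M) by rewrite !mulr_ge0// ltW.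
  have h2 : 0 <= (2 * M + 1) * (`|Creg| * (1 + 2 * M)) by rewrite !mulr_ge0.
  by rewrite /Cerr; lra.
have b1 : 0 < 1 + beta by rewrite addr_gt0.
exists ((k * (1 + beta))^-1), (2 * Cerr * k); split.
- by rewrite invr_gt0 mulr_gt0.
- by rewrite !mulr_gt0.
move=> T sigmah uh hT _ [[[hdiv _] _ _ _] _] w hw hwg eta err.
have [eN Ne] := error_residual mOm Omfin M0 OmM alpha0 alpha_beta hA hp hreg hf1 (proj1 hu) hdiv hw hwg.
have LG := residual_Lpv x0 mOm Omfin M0 OmM alpha0 alpha_beta hA hp hdiv hw.
have Ld := residual_Lp mOm Omfin hp hf1 hdiv.
have [NS SN] := residual_estimator oOm lip hT alpha0 alpha_beta hA p1 LG Ld.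
have kE : (0 <= k%:E)%E by rewrite lee_fin ltW.
split.
  have h : (eta <= (k * (1 + beta))%:E * err)%E.
    by apply: le_trans SN _; rewrite EFinM -muleA lee_wpmul2l.
  have kb : 0 < k * (1 + beta) by exact: mulr_gt0.
  apply: le_trans (_ : ((k * (1 + beta))^-1)%:E * ((k * (1 + beta))%:E * err) <= _)%E.
    by apply: lee_wpmul2l h; rewrite lee_fin invr_ge0 ltW.
  by rewrite muleA -EFinM mulVf ?mul1e// gt_eqF.
have c1E : (0 <= (2 * Cerr)%:E)%E by rewrite lee_fin ltW// mulr_gt0.
apply: le_trans eN _; apply: le_trans (lee_wpmul2l c1E NS) _.
by rewrite muleA -EFinM.
Qed.
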